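(* For any language $L\subseteq\mathbb{S}$, $L\in\mathbf{BPP}$ if and only if there is a $\Sigma^b_1$-formula $G(x,y)$ of $\mathcal{RL}$ such that: (1) $R\Sigma^b_1\text{-NIA}\vdash\forall x.\exists!y.G(x,y)$; (2) $\vDash\mathsf{NotErratic}[G]$; (3) $L=\mathcal{L}(f_G)$.
   Context: Let $\mathbb{S}=\{0,1\}^*$, $\mathbb{O}=\{0,1\}^{\mathbb{S}}$ with the probability measure $\mu$ on the $\sigma$-algebra generated by cylinders $\{\omega\mid\omega(\sigma)=b\}$, each of measure $1/2$. The language $\mathcal{RL}$ has terms $t,s::= x\mid \epsilon\mid \mathtt{0}\mid\mathtt{1}\mid t\frown s\mid t\times s$ and formulas built from atoms $\mathtt{Flip}(t)$, $t=s$, $t\subseteq s$ with $\neg,\wedge,\vee,\exists,\forall$; over $\mathbb{S}$, $\frown$ is concatenation, $t\times s$ is $t$ repeated $|s|$ times, $\subseteq$ is the prefix relation. $\mathtt{1}^t:=\mathtt{1}\times t$, $t\preceq s:=\mathtt{1}^t\subseteq\mathtt{1}^s$, $\exists x\preceq t.F:=\exists x.(\mathtt{1}^x\subseteq\mathtt{1}^t\wedge F)$; subword quantifiers $\exists x\subseteq^* t.F:=\exists x.\exists w.(w\subseteq t\wedge wx\subseteq t\wedge F)$, $\forall x\subseteq^* t.F:=\forall x.(\exists w.(w\subseteq t\wedge wx\subseteq t)\to F)$. A $\Sigma^b_1$-formula has the form $\exists x_1\preceq t_1\cdots\exists x_n\preceq t_n.G$ with only subword quantifiers in $G$. For closed $F$,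 $[\![F]\!]\subseteq\mathbb O$ is the set of $\omega$ making $F$ true in the standard structure on $\mathbb S$ with $\mathtt{Flip}(t)$ read as $\omega(t)=1$; $\vDash$ is truth in the standard structure (for $\mathtt{Flip}$-free formulas); $\overline\sigma$ is the term for $\sigma$. $R\Sigma^b_1\text{-NIA}$: axioms (for $\mathtt b\in\{\mathtt0,\mathtt1\}$) $x\epsilon=x$; $x(y\mathtt b)=(xy)\mathtt b$; $x\times\epsilon=\epsilon$; $x\times y\mathtt b=(x\times y)x$; $x\subseteq\epsilon\leftrightarrow x=\epsilon$; $x\subseteq y\mathtt b\leftrightarrow x\subseteq y\vee x=y\mathtt b$; $x\mathtt b=y\mathtt b\to x=y$; $x\mathtt0\neq y\mathtt1$; $x\mathtt b\neq\epsilon$; plus induction on notation $B(\epsilon)\wedge\forall x.(B(x)\to B(x\mathtt0)\wedge B(x\mathtt1))\to\forall x.B(x)$ for all $\Sigma^b_1$-formulas $B$. For a $\Sigma^b_1$-formula $G(x,y)$, $\mathsf{TwoThirds}[G](x,y)$ is a $\mathtt{Flip}$-free formula of the form $\forall z_1\cdots\forall z_k.H$ with $H$ containing only bounded/subword quantifiers, such that for all $\sigma,\tau$: $\vDash\mathsf{TwoThirds}[G](\overline\sigma,\overline\tau)$ iff $\mu([\![G(\overline\sigma,\overline\tau)]\!])\ge 2/3$. $\mathsf{NotErratic}[G]$ is the formula $\forall x.\exists y\preceq\mathtt0.\mathsf{TwoThirds}[G](x,y)$ (so $\vDash\mathsf{NotErratic}[G]$ iff for every $\sigma$ there is $\tau$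 with $|\tau|\le1$ and $\mu([\![G(\overline\sigma,\overline\tau)]\!])\ge2/3$). $f_G(\sigma)(\tau):=\mu([\![G(\overline\sigma,\overline\tau)]\!])$; $\mathcal{L}(f)=\{\sigma\mid f(\sigma)(\epsilon)>1/2\}$. $\mathbf{BPP}$ is the class of $L$ decided by some polynomial-time probabilistic Turing machine with error probability at most $1/3$ on every input. *)

(* Defs.v *)
From HB Require Import structures.
From Stdlib Require List.
From mathcomp Require Import all_boot all_order all_algebra.
From mathcomp Require Import archimedean.
From mathcomp Require Import all_classical all_reals all_analysis.

Set Implicit Arguments.
Unset Strict Implicit.
Unset Printing Implicit Defensive.

Import Order.TTheory GRing.Theory Num.Theory.

Local Open Scope classical_set_scope.
Local Open Scope ring_scope.

(* A word is read from left to right: its first letter is the head. *)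
Definition word := seq bool.

(* Variables are de Bruijn indices. *)
Inductive term : Type :=
| tVar (n : nat)
| tEps
| tZero
| tOne
| tCat (t s : term)
| tTimes (t s : term).

Inductive formula : Type :=
| fFlip (t : term)
| fEq (t s : term)
| fSub (t s : term)
| fNot (F : formula)
| fAnd (F G : formula)
| fOr (F G : formula)
| fEx (F : formula)
| fAll (F : formula).

Definition fImp F G := fOr (fNot F) G.
Definition fIff F G := fAnd (fImp F G) (fImp G F).

Fixpoint tsubst (s : nat -> term) (t : term) : term :=
  match t with
  | tVar n => s n
  | tEps => tEps
  | tZero => tZero
  | tOne => tOne
  | tCat t1 t2 => tCat (tsubst s t1) (tsubst s t2)
  | tTimes t1 t2 => tTimes (tsubst s t1) (tsubst s t2)
  end.

Definition tshift : term -> term := tsubst (fun n => tVar n.+1).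

Definition up (s : nat -> term) (n : nat) : term :=
  if n is m.+1 then tshift (s m) else tVar 0.

Fixpoint fsubst (s : nat -> term) (F : formula) : formula :=
  match F with
  | fFlip t => fFlip (tsubst s t)
  | fEq t1 t2 => fEq (tsubst s t1) (tsubst s t2)
  | fSub t1 t2 => fSub (tsubst s t1) (tsubst s t2)
  | fNot A => fNot (fsubst s A)
  | fAnd A B => fAnd (fsubst s A) (fsubst s B)
  | fOr A B => fOr (fsubst s A) (fsubst s B)
  | fEx A => fEx (fsubst (up s) A)
  | fAll A => fAll (fsubst (up s) A)
  end.

Definition fshift : formula -> formula := fsubst (fun n => tVar n.+1).

(* F[t/0], the remaining variables being lowered by one. *)
Definition finst (t : term) : formula -> formula :=
  fsubst (fun n => if n is m.+1 then tVar m else t).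

(* F[t/0], the remaining variables being left unchanged. *)
Definition fsubst0 (t : term) : formula -> formula :=
  fsubst (fun n => if n is m.+1 then tVar m.+1 else t).

Fixpoint tfv (k : nat) (t : term) : bool :=
  match t with
  | tVar n => (n < k)%N
  | tCat t1 t2 | tTimes t1 t2 => tfv k t1 && tfv k t2
  | _ => true
  end.

(* All the free variables of the formula are smaller than k. *)
Fixpoint ffv (k : nat) (F : formula) : bool :=
  match F with
  | fFlip t => tfv k t
  | fEq t s | fSub t s => tfv k t && tfv k s
  | fNot A => ffv k A
  | fAnd A B | fOr A B => ffv k A && ffv k B
  | fEx A | fAll A => ffv k.+1 A
  end.

Fixpoint Flip_free (F : formula) : bool :=
  match F with
  | fFlip _ => false
  | fEq _ _ | fSub _ _ => true
  | fNot A | fEx A | fAll A => Flip_free A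
  | fAnd A B | fOr A B => Flip_free A && Flip_free B
  end.

Definition tbit (b : bool) : term := if b then tOne else tZero.

Definition numeral (w : word) : term :=
  foldl (fun t b => tCat t (tbit b)) tEps w.

Definition tPow1 (t : term) : term := tTimes tOne t.

Definition fLe (t s : term) : formula := fSub (tPow1 t) (tPow1 s).

(* In the four quantifiers below, t does not contain the bound variable,
   which is variable 0 of F. *)
Definition fExB (t : term) (F : formula) : formula :=
  fEx (fAnd (fLe (tVar 0) (tshift t)) F).

Definition fAllB (t : term) (F : formula) : formula :=
  fAll (fImp (fLe (tVar 0) (tshift t)) F).

(* Under the two binders of fExSW, x is variable 1 and w is variable 0;
   fshift F is F without w. *)
Definition fExSW (t : term) (F : formula) : formula :=
  fEx (fEx (fAnd (fSub (tVar 0) (tshift (tshift t)))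
           (fAnd (fSub (tCat (tVar 0) (tVar 1)) (tshift (tshift t)))
                 (fshift F)))).

Definition fAllSW (t : term) (F : formula) : formula :=
  fAll (fImp
    (fEx (fAnd (fSub (tVar 0) (tshift (tshift t)))
               (fSub (tCat (tVar 0) (tVar 1)) (tshift (tshift t)))))
    F).

Inductive subword_formula : formula -> Prop :=
| SW_Flip t : subword_formula (fFlip t)
| SW_Eq t s : subword_formula (fEq t s)
| SW_Sub t s : subword_formula (fSub t s)
| SW_Not F : subword_formula F -> subword_formula (fNot F)
| SW_And F G : subword_formula F -> subword_formula G ->
    subword_formula (fAnd F G)
| SW_Or F G : subword_formula F -> subword_formula G ->
    subword_formula (fOr F G)
| SW_Ex t F : subword_formula F -> subword_formula (fExSW t F)
| SW_All t F : subword_formula F -> subword_formula (fAllSW t F).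

Inductive Sigma1b : formula -> Prop :=
| Sigma1b_matrix F : subword_formula F -> Sigma1b F
| Sigma1b_Ex t F : Sigma1b F -> Sigma1b (fExB t F).

Inductive bounded_formula : formula -> Prop :=
| BF_Flip t : bounded_formula (fFlip t)
| BF_Eq t s : bounded_formula (fEq t s)
| BF_Sub t s : bounded_formula (fSub t s)
| BF_Not F : bounded_formula F -> bounded_formula (fNot F)
| BF_And F G : bounded_formula F -> bounded_formula G ->
    bounded_formula (fAnd F G)
| BF_Or F G : bounded_formula F -> bounded_formula G ->
    bounded_formula (fOr F G)
| BF_ExB t F : bounded_formula F -> bounded_formula (fExB t F)
| BF_AllB t F : bounded_formula F -> bounded_formula (fAllB t F)
| BF_ExSW t F : bounded_formula F -> bounded_formula (fExSW t F)
| BF_AllSW t F : bounded_formula F -> bounded_formula (fAllSW t F).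

Inductive Pi1_formula : formula -> Prop :=
| Pi1_matrix F : bounded_formula F -> Pi1_formula F
| Pi1_All F : Pi1_formula F -> Pi1_formula (fAll F).

Section Provability.
Variable Th : formula -> Prop.

(* The axioms in Th may be open; since prv_ax holds in any context and
   prv_allI shifts only the context, they stand for their universal
   closures. *)
Inductive provable : seq formula -> formula -> Prop :=
| prv_ax Ga F : Th F -> provable Ga F
| prv_hyp Ga F : List.In F Ga -> provable Ga F
| prv_notI Ga F G : provable (F :: Ga) G -> provable (F :: Ga) (fNot G) ->
    provable Ga (fNot F)
| prv_raa Ga F G : provable (fNot F :: Ga) G ->
    provable (fNot F :: Ga) (fNot G) -> provable Ga F
| prv_andI Ga F G : provable Ga F -> provable Ga G -> provable Ga (fAnd F G)
| prv_andE1 Ga F G : provable Ga (fAnd F G) -> provable Ga F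
| prv_andE2 Ga F G : provable Ga (fAnd F G) -> provable Ga G
| prv_orI1 Ga F G : provable Ga F -> provable Ga (fOr F G)
| prv_orI2 Ga F G : provable Ga G -> provable Ga (fOr F G)
| prv_orE Ga F G H : provable Ga (fOr F G) -> provable (F :: Ga) H ->
    provable (G :: Ga) H -> provable Ga H
| prv_allI Ga F : provable (map fshift Ga) F -> provable Ga (fAll F)
| prv_allE Ga F t : provable Ga (fAll F) -> provable Ga (finst t F)
| prv_exI Ga F t : provable Ga (finst t F) -> provable Ga (fEx F)
| prv_exE Ga F G : provable Ga (fEx F) ->
    provable (F :: map fshift Ga) (fshift G) -> provable Ga G
| prv_eqI Ga t : provable Ga (fEq t t)
| prv_eqE Ga t s F : provable Ga (fEq t s) -> provable Ga (finst t F) ->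
    provable Ga (finst s F).

End Provability.

Section Theory.
Let x := tVar 0.
Let y := tVar 1.

Inductive RSigma1bNIA : formula -> Prop :=
| NIA_cat_eps : RSigma1bNIA (fEq (tCat x tEps) x)
| NIA_cat_bit b :
    RSigma1bNIA (fEq (tCat x (tCat y (tbit b))) (tCat (tCat x y) (tbit b)))
| NIA_times_eps : RSigma1bNIA (fEq (tTimes x tEps) tEps)
| NIA_times_bit b :
    RSigma1bNIA (fEq (tTimes x (tCat y (tbit b))) (tCat (tTimes x y) x))
| NIA_sub_eps : RSigma1bNIA (fIff (fSub x tEps) (fEq x tEps))
| NIA_sub_bit b :
    RSigma1bNIA (fIff (fSub x (tCat y (tbit b)))
              (fOr (fSub x y) (fEq x (tCat y (tbit b)))))
| NIA_bit_inj b :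
    RSigma1bNIA (fImp (fEq (tCat x (tbit b)) (tCat y (tbit b))) (fEq x y))
| NIA_bit_neq : RSigma1bNIA (fNot (fEq (tCat x tZero) (tCat y tOne)))
| NIA_bit_eps b : RSigma1bNIA (fNot (fEq (tCat x (tbit b)) tEps))
(* The induction variable is variable 0 of B, the others are parameters. *)
| NIA_ind B : Sigma1b B ->
    RSigma1bNIA (fImp
      (fAnd (finst tEps B)
            (fAll (fImp B (fAnd (fsubst0 (tCat x tZero) B)
                                (fsubst0 (tCat x tOne) B)))))
      (fAll B)).

End Theory.

Definition RSigma1bNIA_proves (F : formula) : Prop := provable RSigma1bNIA [::] F.

Definition wtimes (v w : word) : word := flatten (nseq (size w) v).

Fixpoint teval (r : nat -> word) (t : term) : word :=
  match t with
  | tVar n => r n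
  | tEps => [::]
  | tZero => [:: false]
  | tOne => [:: true]
  | tCat t1 t2 => teval r t1 ++ teval r t2
  | tTimes t1 t2 => wtimes (teval r t1) (teval r t2)
  end.

Definition scons (w : word) (r : nat -> word) (n : nat) : word :=
  if n is m.+1 then r m else w.

Fixpoint sat (o : word -> bool) (r : nat -> word) (F : formula) : Prop :=
  match F with
  | fFlip t => o (teval r t) = true
  | fEq t s => teval r t = teval r s
  | fSub t s => prefix (teval r t) (teval r s)
  | fNot A => ~ sat o r A
  | fAnd A B => sat o r A /\ sat o r B
  | fOr A B => sat o r A \/ sat o r B
  | fEx A => exists w : word, sat o (scons w r) A
  | fAll A => forall w : word, sat o (scons w r) A
  end.

(* Only used for closed formulas, for which the valuation is irrelevant. *)
Definition interp (F : formula) : set (word -> bool) :=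
  [set o | sat o (fun=> [::]) F].

(* Only used for closed Flip-free formulas, for which the oracle is
   irrelevant as well. *)
Definition models (F : formula) : Prop := forall o, interp F o.

Definition cylinders : set (set (word -> bool)) :=
  [set C | exists (s : word) (b : bool), C = [set o | o s = b]].

Definition oracle := g_sigma_algebraType cylinders.

Section Coin.
Variable R : realType.

(* n-th binary digit after the point of a nonnegative real. *)
Definition digit (n : nat) (x : R) : bool := odd (Num.truncn (x * 2 ^+ n.+1)).

Definition digits (x : measurableTypeR R) : oracle :=
  fun s => digit (pickle s) x.

Lemma digit_in_dyadic m k (x : R) :
  k%:R / 2 ^+ m <= x < k.+1%:R / 2 ^+ m -> Num.truncn (x * 2 ^+ m) = k.
Proof.
move=> h; apply: truncn_def.
have h2 : 0 < (2 : R) ^+ m by rewrite exprn_gt0.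
by rewrite ler_pdivrMr // ltr_pdivlMr // in h.
Qed.

Lemma digit_set n : [set x : R | digit n x = true] =
  \bigcup_(k in [set k | odd k])
     `[(k%:R / 2 ^+ n.+1 : R), (k.+1%:R / 2 ^+ n.+1 : R)[%classic.
Proof.
have h2 : 0 < (2 : R) ^+ n.+1 by rewrite exprn_gt0.
apply/seteqP; split => x /=.
  rewrite /digit; set y := x * _ => oy.
  exists (Num.truncn y) => //=; rewrite in_itv /=.
  rewrite ler_pdivrMr // ltr_pdivlMr //; apply: truncn_itv.
  have := odd_gt0 oy; rewrite truncn_gt0; exact: le_trans.
by case=> k /= ok; rewrite in_itv /= => /digit_in_dyadic h; rewrite /digit h.
Qed.

Lemma measurable_digits : measurable_fun setT digits.
Proof.
apply: (@measurability _ _ (measurableTypeR R) oracle setT digits cylinders) => //.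
move=> _ [_ [s [b ->]] <-]; rewrite setTI.
have mt : measurable [set x : measurableTypeR R | digit (pickle s) x = true].
  rewrite digit_set; apply: bigcup_measurable => k _.
  exact: measurable_itv.
case: b => //.
rewrite (_ : _ @^-1` _ = ~` [set x : R | digit (pickle s) x = true]).
  exact: measurableC.
by apply/seteqP; split => x /=; rewrite /digits /=; case: digit.
Qed.

HB.instance Definition _ :=
  isMeasurableFun.Build _ _ _ _ digits measurable_digits.

(* The countably many coins o(s) are the binary digits of a uniformly
   distributed real of [0, 1]; coin_measure_cylinder below says that they are
   independent and fair, which determines the measure. *)
Definition coin_measure : probability oracle R :=
  distribution (uniform_prob (@ltr01 R)) digits.

Let U : probability (measurableTypeR R) R := uniform_prob (@ltr01 R).
Let I m k : set (measurableTypeR R) :=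
  `[(k%:R / 2 ^+ m : R), (k.+1%:R / 2 ^+ m : R)[%classic.

Lemma uniform_prob_dyadic m k : (k < 2 ^ m)%N -> U (I m k) = (2 ^- m)%:E.
Proof.
move=> km; have h2 : 0 < (2 : R) ^+ m by rewrite exprn_gt0.
rewrite /U /= /uniform_prob (eq_integral (cst 1%:E)).
  rewrite integral_cst /=; last exact: measurable_itv.
  rewrite lebesgue_measure_itv /= lte_fin ltr_pM2r ?invr_gt0 //.
  by rewrite ltr_nat ltnSn mul1e -EFinD -mulrBl -natrB // subSnn mul1r.
move=> x; rewrite inE /I /= in_itv /= => /andP[a b].
rewrite /uniform_pdf (le_trans _ a) /=; last by rewrite divr_ge0 // ltW.
rewrite (le_trans (ltW b)) ?subr0 ?invr1 //.
by rewrite ler_pdivrMr // mul1r -natrX ler_nat.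
Qed.

Lemma dyadic_halves m k : I m k = I m.+1 k.*2 `|` I m.+1 k.*2.+1.
Proof.
have h2 : 0 < (2 : R) ^+ m by rewrite exprn_gt0.
have e j : (j.*2)%:R / 2 ^+ m.+1 = j%:R / 2 ^+ m :> R.
  by rewrite -muln2 natrM exprSr -mulf_div divff // mulr1.
have l : k%:R / 2 ^+ m <= (k.*2.+1)%:R / 2 ^+ m.+1 :> R.
  by rewrite -e ler_pM2r ?invr_gt0 ?exprn_gt0 // ler_nat.
have r : (k.*2.+1)%:R / 2 ^+ m.+1 <= k.+1%:R / 2 ^+ m :> R.
  by rewrite -[leRHS]e ler_pM2r ?invr_gt0 ?exprn_gt0 // ler_nat doubleS.
rewrite /I -doubleS !e; apply/seteqP; split => x /=; rewrite !in_itv /=.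
  move=> /andP[-> ->] /=; rewrite andbT.
  by case: (ltP x (k.*2.+1%:R / 2 ^+ m.+1)); [left|right].
case=> /andP[a b]; rewrite ?a ?b ?andbT /=; first exact: lt_le_trans r.
exact: le_trans a.
Qed.

Lemma dyadic_disj m k : I m.+1 k.*2 `&` I m.+1 k.*2.+1 = set0.
Proof.
apply/seteqP; split => x //= [].
by rewrite /I /= !in_itv /= => /andP[_ +] /andP[+ _] => /lt_le_trans h /h; rewrite ltxx.
Qed.

Let E (p : nat -> option bool) m n k : set (measurableTypeR R) :=
  I m k `&` [set x | forall i b, (m <= i < m + n)%N -> p i = Some b ->
     digit i x = b].

Lemma dyadic_pattern p n m k : (k < 2 ^ m)%N ->
  measurable (E p m n k) /\
  U (E p m n k) = (2 ^- (m + count (isSome \o p) (iota m n)))%:E.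
Proof.
elim: n m k => [|n IH] m k km.
  have -> : E p m 0 k = I m k.
    apply/seteqP; split => x; first by case.
    by move=> Ix; split => // i b; rewrite addn0 ltnNge andbN.
  by rewrite addn0; split; [exact: measurable_itv|exact: uniform_prob_dyadic].
have k2 (c : bool) : (k.*2 + c < 2 ^ m.+1)%N.
  by rewrite expnS mul2n (leq_ltn_trans (leq_add (leqnn _) (leq_b1 c))) // addn1 ltn_Sdouble.
have kE : E p m n.+1 k = (E p m.+1 n k.*2 `&` [set x | if p m is Some b then b = false else True])
  `|` (E p m.+1 n k.*2.+1 `&` [set x | if p m is Some b then b = true else True]).
  have dg (c : bool) x : I m.+1 (k.*2 + c) x -> digit m x = c.
    rewrite /I /= in_itv /= => /digit_in_dyadic; rewrite /digit => ->.
    by rewrite oddD odd_double oddb.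
  apply/seteqP; split => x.
    case; rewrite dyadic_halves => Ix hx.
    case: Ix => Ix; [left|right]; (split; first split) => //=.
    - by move=> i b /andP[a c]; apply: hx; rewrite (ltnW a) addnS -addSn.
    - have := hx m; rewrite leqnn -addSnnS leq_addr /=; case: (p m) => // b /(_ _ isT erefl) <-.
      by apply: (dg false); rewrite addn0.
    - by move=> i b /andP[a c]; apply: hx; rewrite (ltnW a) addnS -addSn.
    - have := hx m; rewrite leqnn -addSnnS leq_addr /=; case: (p m) => // b /(_ _ isT erefl) <-.
      by apply: (dg true); rewrite addn1.
  have key (c : bool) : I m.+1 (k.*2 + c) x ->
      (forall i b, (m.+1 <= i < m.+1 + n)%N -> p i = Some b -> digit i x = b) ->
      (if p m is Some b then b = c else True) -> E p m n.+1 k x.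
    move=> Ix h pm; split.
      rewrite dyadic_halves; case: c Ix {pm}; [rewrite addn1|rewrite addn0] => Ix; [by right|by left].
    move=> i b /andP[]; rewrite leq_eqVlt => /orP[/eqP <-|mi] ib pi.
      by rewrite pi in pm; rewrite pm; apply: dg.
    by apply: h => //; rewrite mi addSnnS.
  case=> -[[Ix h] pm]; first by apply: (key false) => //; rewrite addn0.
  by apply: (key true) => //; rewrite addn1.
have [m0 u0] := IH m.+1 k.*2 (eq_ind _ (fun a => (a < _)%N) (k2 false) _ (addn0 _)).
have [m1 u1] := IH m.+1 k.*2.+1 (eq_ind _ (fun a => (a < _)%N) (k2 true) _ (addn1 _)).
rewrite kE /=; case: (p m) => [[]|] /=.
- rewrite [X in _ `&` X](_ : _ = set0); last by apply/seteqP; split.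
  rewrite setI0 set0U [X in _ `&` X](_ : _ = setT); last by apply/seteqP; split.
  by rewrite setIT; split => //; rewrite u1 addnA addn1.
- rewrite [X in _ `|` (_ `&` X)](_ : _ = set0); last by apply/seteqP; split.
  rewrite setI0 setU0 [X in _ `&` X](_ : _ = setT); last by apply/seteqP; split.
  by rewrite setIT; split => //; rewrite u0 addnA addn1.
- rewrite !setIT; split; first exact: measurableU.
  have -> : U (E p m.+1 n k.*2 `|` E p m.+1 n k.*2.+1) =
      (U (E p m.+1 n k.*2) + U (E p m.+1 n k.*2.+1))%E.
    apply: measureU => //; apply/seteqP; split => x //= [[a _] [b _]].
    have : (I m.+1 k.*2 `&` I m.+1 k.*2.+1) x by split.
    by rewrite dyadic_disj.
  rewrite u0 u1 -EFinD add0n addSn exprS invfM; congr EFin.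
  by rewrite -mulrDl -div1r -mulrDl divff ?mul1r.
Qed.

Lemma coin_measure_cylinder (S : seq word) (f : word -> bool) : uniq S ->
  coin_measure [set o | forall s, s \in S -> o s = f s] = (2 ^- size S)%:E.
Proof.
move=> uS; pose p i := if @pickle_inv word i is Some s then
  (if s \in S then Some (f s) else None) else None.
pose N := (\max_(s <- S) (pickle s)).+1.
have SN s : s \in S -> (pickle s < N)%N.
  by move=> sS; rewrite ltnS; exact: leq_bigmax_seq.
have [m0 u0] := dyadic_pattern p N (ltn0Sn 0 : (0 < 2 ^ 0)%N).
rewrite -[LHS]/(U [set x | forall s, s \in S -> digit (pickle s) x = f s]).
set A := [set x | _].
have EA : E p 0 N 0 = I 0 0 `&` A.
  apply/seteqP; split => x [Ix h]; split => //.
    move=> s sS; apply: h; first by rewrite add0n SN.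
    by rewrite /p pickleK_inv sS.
  move=> i b _; rewrite /p; case e: pickle_inv => [s|] //.
  case: ifP => // sS [<-]; rewrite -(h s sS); congr digit.
  by have := @pickle_invK word i; rewrite e.
have mA : measurable A.
  rewrite (_ : A = \bigcap_(s in [set` S]) [set x | digit (pickle s) x = f s]); last by [].
  apply: fin_bigcap_measurable => [|s _]; first exact: finite_seq.
  rewrite -[X in measurable X]setTI.
  apply: (measurable_digits measurableT (Y := [set o : oracle | o s = f s])).
  by apply: sub_sigma_algebra; exists s, (f s).
have mI : measurable (I 0 0) by exact: measurable_itv.
rewrite -(setIT A) -(setUv (I 0 0)) setIUr.
have -> : U (A `&` I 0 0 `|` A `&` ~` I 0 0) =
    (U (A `&` I 0 0) + U (A `&` ~` I 0 0))%E.
  apply: measureU.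
  - exact: measurableI.
  - by apply: measurableI => //; exact: measurableC.
  - by rewrite setIACA setICr setI0.
rewrite (_ : U (A `&` ~` I 0 0) = 0%E) ?adde0; last first.
  apply/eqP; rewrite eq_le measure_ge0 andbT.
  rewrite (_ : 0%E = U (~` I 0 0)).
    by apply: le_measure; rewrite ?inE; [apply: measurableI => //|..|exact: subIsetr]; exact: measurableC.
  by rewrite probability_setC // uniform_prob_dyadic // expr0 invr1 subee.
rewrite setIC -EA u0 add0n; congr (_ ^- _)%:E.
rewrite -size_filter -(size_map pickle S).
apply/perm_size/uniq_perm.
- by rewrite filter_uniq // iota_uniq.
- by rewrite map_inj_uniq //; exact: (pcan_inj pickleK_inv).
move=> i; rewrite mem_filter mem_iota leq0n add0n /=; apply/idP/mapP.
  move=> /andP[]; rewrite /p; case e: pickle_inv => [s|] //; case: ifP => // sS _ _.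
  by exists s => //; have := @pickle_invK word i; rewrite e.
by case=> s sS ->; rewrite /p pickleK_inv sS SN.
Qed.

End Coin.

(* In a formula G(x, y), y is variable 0 and x is variable 1, so that
   fAll (fEx G) is "forall x, exists y, G(x, y)". *)

Definition fapp2 (G : formula) (s t : word) : formula :=
  fsubst (fun n => match n with
                   | 0%N => numeral t
                   | 1%N => numeral s
                   | m.+2 => tVar m
                   end) G.

(* forall x, exists! y, G(x, y).  Under the three binders, z is variable 0,
   y is variable 1, x is variable 2, and the substituted formula is G(x, z). *)
Definition fAllExUnique (G : formula) : formula :=
  fAll (fEx (fAnd G
    (fAll (fImp (fsubst (fun n => if n is m.+1 then tVar m.+2 else tVar 0) G)
                (fEq (tVar 0) (tVar 1)))))).

Definition prob_of (R : realType) (G : formula) (s t : word) : \bar R :=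
  coin_measure R (interp (fapp2 G s t)).

Definition lang_of (R : realType) (f : word -> word -> \bar R) : set word :=
  [set s | ((2^-1 : R)%:E < f s [::])%E].

Definition is_TwoThirds (R : realType) (G T : formula) : Prop :=
  [/\ Flip_free T, Pi1_formula T, ffv 2 T &
      forall s t : word,
        models (fapp2 T s t) <-> ((2 / 3 : R)%:E <= prob_of R G s t)%E].

Definition NotErratic (TwoThirds : formula -> formula) (G : formula) :
    formula :=
  fAll (fExB tZero (TwoThirds G)).

Inductive move := MoveLeft | MoveStay | MoveRight.

(* The tape alphabet contains the blank None, the bits and finitely many other
   symbols.  A machine has two transition functions, and flips a fair coin at
   each step in order to choose which one to apply. *)
Record PTM := {
  ptm_state : finType;
  ptm_extra : finType;
  ptm_start : ptm_state;
  ptm_acc : ptm_state;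
  ptm_rej : ptm_state;
  ptm_acc_rej : ptm_acc != ptm_rej;
  ptm_delta : bool -> ptm_state -> option (bool + ptm_extra) ->
              ptm_state * option (bool + ptm_extra) * move
}.

Section Machine.
Variable M : PTM.

Definition ptm_sym := option (bool + ptm_extra M).

(* One two-way infinite tape.  In (l, r), the scanned cell is the head of r and
   the cells on its left are listed in l from right to left; the cells beyond
   the two lists are blank. *)
Definition tape := (seq ptm_sym * seq ptm_sym)%type.

Definition tape_move (d : move) (tp : tape) : tape :=
  let: (l, r) := tp in
  match d with
  | MoveLeft => (behead l, head None l :: r)
  | MoveStay => (l, r)
  | MoveRight => (head None r :: l, behead r)
  end.

Definition ptm_config := (ptm_state M * tape)%type.

Definition ptm_init (x : word) : ptm_config :=
  (ptm_start M, ([::], [seq Some (inl b) | b <- x])).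

Definition ptm_accepting (c : ptm_config) : bool := c.1 == ptm_acc M.

Definition ptm_halted (c : ptm_config) : bool :=
  (c.1 == ptm_acc M) || (c.1 == ptm_rej M).

Definition ptm_step (c : ptm_config) (coin : bool) : ptm_config :=
  if ptm_halted c then c else
  let: (q, (l, r)) := c in
  let: (q', a, d) := ptm_delta coin q (head None r) in
  (q', tape_move d (l, a :: behead r)).

Definition ptm_run (x : word) (coins : seq bool) : ptm_config :=
  foldl ptm_step (ptm_init x) coins.

Definition ptm_error_prob (x : word) (time : nat) (answer : bool) : rat :=
  #|[pred coins : time.-tuple bool |
       ptm_accepting (ptm_run x coins) != answer]|%:R / 2 ^+ time.

End Machine.

Definition BPP (L : set word) : Prop :=
  exists (M : PTM) (p : {poly nat}), forall x : word,
    let time := p.[size x] in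
    (forall coins : time.-tuple bool, ptm_halted (ptm_run M x coins)) /\
    ptm_error_prob M x time `[< L x >] <= 1 / 3.

(* Main.v *)
(** If L is in BPP, the computation of a machine on x is coded by a history: a word each of
    whose letters is determined by a subword formula in the letters before it, the coin of
    step j being the oracle bit o(1^(j+1)).  Induction on notation proves that there is
    exactly one history of the required length, hence exactly one answer y.

    Conversely, a formula G which is provably total is witnessed by an expression f of Cobham's
    function algebra with oracle: otherwise a Herbrand-saturated model of the theory, whose
    elements are named by such expressions, would have an x without y.  The expression is
    compiled to a program on stacks and then to a single-tape machine, which answers every new
    query by a coin flip and records the answer in a log.  Reading the acceptance probability
    from a configuration as the conditional probability, given the log, of the event f(x) = [::]
    reduces correctness to the fact that a fresh flip averages the two conditional
    probabilities.  Since the events f(x) = y are disjoint and one of them has measure at least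
    2/3, the event f(x) = [::] has measure above 1/2 only if it has measure at least 2/3, and
    measure at most 1/3 otherwise. *)

Require Import Defs.
From mathcomp Require Import all_boot all_order all_algebra.
From mathcomp Require Import all_classical all_reals all_analysis.
From mathcomp Require Import zify lra ring.

Set Implicit Arguments.
Unset Strict Implicit.
Unset Printing Implicit Defensive.

Import Order.TTheory GRing.Theory Num.Theory.

(** * Tarskian structures *)

Arguments fshift : simpl never.
Arguments tshift : simpl never.
Arguments finst : simpl never.

(** In the first direction no machine is ever analysed inside the theory. Existence and uniqueness
    of histories are shown for an arbitrary subword formula in place of the transition rule, by
    ordinary reasoning in models, and completeness turns this into provability; the machine is
    studied in the standard structure only. In the other direction the obstacle is that the
    induction hypothesis gives a witness for each element of a model, but no function from witnesses
    to witnesses. Saturation supplies one expression that works for all elements at once, and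
    limited recursion can then iterate it. A second obstacle is that queries are adaptive and may be
    repeated, so that no fixed correspondence links the coins of the machine to the bits of the
    oracle. Assigning to each configuration a conditional probability avoids any coupling of the two
    probability spaces. Bounds on time and space are kept as powers n^a with n at least 2, so that
    sums and compositions only change the exponent. *)

Definition dcons {D : Type} (d : D) (r : nat -> D) (n : nat) : D :=
  if n is m.+1 then r m else d.

(* Equality is interpreted by a relation, which congruent requires to be a congruence. *)
Record structure := Structure {
  dom :> Type;
  s_eps : dom;
  s_bit : bool -> dom;
  s_cat : dom -> dom -> dom;
  s_times : dom -> dom -> dom;
  s_eq : dom -> dom -> Prop;
  s_sub : dom -> dom -> Prop;
  s_flip : dom -> Prop
}.
Arguments s_eps {s}.
Arguments s_bit {s}.

Record congruent (S : structure) : Prop := Congruent {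
  eq_refl_ax : forall x : S, s_eq x x;
  eq_sym_ax : forall x y : S, s_eq x y -> s_eq y x;
  eq_trans_ax : forall x y z : S, s_eq x y -> s_eq y z -> s_eq x z;
  eq_cat_ax : forall x x' y y' : S, s_eq x x' -> s_eq y y' ->
    s_eq (s_cat x y) (s_cat x' y');
  eq_times_ax : forall x x' y y' : S, s_eq x x' -> s_eq y y' ->
    s_eq (s_times x y) (s_times x' y');
  eq_sub_ax : forall x x' y y' : S, s_eq x x' -> s_eq y y' ->
    s_sub x y -> s_sub x' y';
  eq_flip_ax : forall x x' : S, s_eq x x' -> s_flip x -> s_flip x'
}.

Fixpoint dval (S : structure) (r : nat -> S) (t : term) : S :=
  match t with
  | tVar n => r n
  | tEps => s_eps
  | tZero => s_bit false
  | tOne => s_bit true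
  | tCat t1 t2 => s_cat (dval r t1) (dval r t2)
  | tTimes t1 t2 => s_times (dval r t1) (dval r t2)
  end.

Fixpoint ssat (S : structure) (r : nat -> S) (F : formula) : Prop :=
  match F with
  | fFlip t => s_flip (dval r t)
  | fEq t s => s_eq (dval r t) (dval r s)
  | fSub t s => s_sub (dval r t) (dval r s)
  | fNot A => ~ ssat r A
  | fAnd A B => ssat r A /\ ssat r B
  | fOr A B => ssat r A \/ ssat r B
  | fEx A => exists w : S, ssat (dcons w r) A
  | fAll A => forall w : S, ssat (dcons w r) A
  end.

(** These equations open one connective at a time, where simplification would go on into the
    subformulas. *)
Lemma ssat_all (S : structure) (r : nat -> S) A :
  ssat r (fAll A) = (forall w, ssat (dcons w r) A).
Proof. by []. Qed.

Lemma ssat_ex (S : structure) (r : nat -> S) A :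
  ssat r (fEx A) = (exists w, ssat (dcons w r) A).
Proof. by []. Qed.

Lemma ssat_and (S : structure) (r : nat -> S) A B :
  ssat r (fAnd A B) = (ssat r A /\ ssat r B).
Proof. by []. Qed.

Lemma dval_subst (S : structure) (r : nat -> S) s t :
  dval r (tsubst s t) = dval (fun n => dval r (s n)) t.
Proof. by elim: t => //= t1 -> t2 ->. Qed.

Lemma dval_shift (S : structure) (r : nat -> S) w t : dval (dcons w r) (tshift t) = dval r t.
Proof. by rewrite /tshift dval_subst. Qed.

Lemma dval_up (S : structure) (r : nat -> S) w s :
  (fun n => dval (dcons w r) (up s n)) = dcons w (fun n => dval r (s n)).
Proof. by apply: funext => -[//|n] /=; rewrite dval_shift. Qed.

Lemma ssat_subst (S : structure) (r : nat -> S) s F :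
  ssat r (fsubst s F) = ssat (fun n => dval r (s n)) F.
Proof.
elim: F r s => /= [t|t u|t u|A IH|A IHA B IHB|A IHA B IHB|A IH|A IH] r s;
  rewrite ?dval_subst ?IH ?IHA ?IHB //.
  by apply: eq_exists => w; rewrite IH dval_up.
by apply: eq_forall => w; rewrite IH dval_up.
Qed.

Lemma ssat_shift (S : structure) (r : nat -> S) w F : ssat (dcons w r) (fshift F) = ssat r F.
Proof. by rewrite /fshift ssat_subst. Qed.

Lemma ssat_inst (S : structure) (r : nat -> S) t F :
  ssat r (finst t F) = ssat (dcons (dval r t) r) F.
Proof. by rewrite /finst ssat_subst; congr ssat; apply: funext => -[]. Qed.

Lemma ssat_imp (S : structure) (r : nat -> S) A B :
  ssat r (fImp A B) <-> (ssat r A -> ssat r B).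
Proof.
split=> /=; first by case.
by move=> h; have [a|a] := pselect (ssat r A); [right; apply: h|left].
Qed.

Lemma ssat_iff (S : structure) (r : nat -> S) A B :
  ssat r (fIff A B) <-> (ssat r A <-> ssat r B).
Proof.
have h1 := ssat_imp r A B; have h2 := ssat_imp r B A.
by split=> [[/h1 a /h2 b] //|[a b]]; split; [apply/h1|apply/h2].
Qed.

Section Congruence.
Variables (S : structure) (cS : congruent S).

Lemma dval_congr (r r' : nat -> S) t :
  (forall n, s_eq (r n) (r' n)) -> s_eq (dval r t) (dval r' t).
Proof.
move=> h; elim: t => //=; try by move=> *; apply: (eq_refl_ax cS).
  by move=> t1 IH1 t2 IH2; apply: (eq_cat_ax cS).
by move=> t1 IH1 t2 IH2; apply: (eq_times_ax cS).
Qed.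

Lemma ssat_congr (r r' : nat -> S) F :
  (forall n, s_eq (r n) (r' n)) -> ssat r F <-> ssat r' F.
Proof.
have sy a b : (forall n : nat, @s_eq S (a n) (b n)) -> forall n, s_eq (b n) (a n).
  by move=> h n; apply/(eq_sym_ax cS)/h.
have dc w a b : (forall n : nat, @s_eq S (a n) (b n)) ->
    forall n, s_eq (dcons w a n) (dcons w b n).
  by move=> h [|n] //=; apply: (eq_refl_ax cS).
elim: F r r' => /= [t|t u|t u|A IH|A IHA B IHB|A IHA B IHB|A IH|A IH] r r' h.
- by split; apply: (eq_flip_ax cS); apply: dval_congr => //; apply: sy.
- have ht := dval_congr t h; have hu := dval_congr u h.
  split => e.
    by apply: (eq_trans_ax cS) (eq_trans_ax cS e hu); apply: (eq_sym_ax cS).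
  by apply: (eq_trans_ax cS ht) (eq_trans_ax cS e _); apply: (eq_sym_ax cS).
- by split; apply: (eq_sub_ax cS); apply: dval_congr => //; apply: sy.
- by rewrite (IH _ _ h).
- by rewrite (IHA _ _ h) (IHB _ _ h).
- by rewrite (IHA _ _ h) (IHB _ _ h).
- by split=> -[w hw]; exists w; apply/(IH _ _ (dc w _ _ h)).
- by split=> hw w; apply/(IH _ _ (dc w _ _ h)).
Qed.

End Congruence.

Definition is_model (Th : formula -> Prop) (S : structure) : Prop :=
  forall F, Th F -> forall r : nat -> S, ssat r F.

Lemma soundness Th (S : structure) Ga F : congruent S -> is_model Th S ->
  provable Th Ga F ->
  forall r : nat -> S, (forall H, List.In H Ga -> ssat r H) -> ssat r F.
Proof.
move=> cS mS; elim=> {Ga F}.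
- by move=> Ga F /mS.
- by move=> Ga F inF r; apply.
- move=> Ga F G _ IH1 _ IH2 r h /= sF.
  have h' H : List.In H (F :: Ga) -> ssat r H by case=> [<-|/h].
  exact: (IH2 r h' (IH1 r h')).
- move=> Ga F G _ IH1 _ IH2 r h; apply: contrapT => sF.
  have h' H : List.In H (fNot F :: Ga) -> ssat r H by case=> [<-|/h].
  exact: (IH2 r h' (IH1 r h')).
- by move=> Ga F G _ IH1 _ IH2 r h; split; [apply: IH1|apply: IH2].
- by move=> Ga F G _ IH r h; case: (IH r h).
- by move=> Ga F G _ IH r h; case: (IH r h).
- by move=> Ga F G _ IH r h; left; apply: IH.
- by move=> Ga F G _ IH r h; right; apply: IH.
- move=> Ga F G H _ IH _ IH1 _ IH2 r h; case: (IH r h) => s.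
    by apply: IH1 => A [<-|/h].
  by apply: IH2 => A [<-|/h].
- move=> Ga F _ IH r h w; apply: IH => A /List.in_map_iff[B [<- /h]].
  by rewrite ssat_shift.
- by move=> Ga F t _ IH r h; rewrite ssat_inst; apply: (IH r h).
- by move=> Ga F t _ IH r h; exists (dval r t); rewrite -ssat_inst; apply: IH.
- move=> Ga F G _ IH1 _ IH2 r h; have [w hw] := IH1 r h.
  rewrite -(ssat_shift r w); apply: IH2 => A [<- //|/List.in_map_iff[B [<- /h]]].
  by rewrite ssat_shift.
- by move=> Ga t r _; apply: (eq_refl_ax cS).
- move=> Ga t s F _ IH1 _ IH2 r h.
  have := IH2 r h; rewrite !ssat_inst; apply: (iffLR (ssat_congr cS _ _)).
  by case=> [|n] /=; [apply: (IH1 r h)|apply: (eq_refl_ax cS)].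
Qed.

(** * Substitution in formulas and derivations *)

Lemma tsubst_comp s s' t : tsubst s (tsubst s' t) = tsubst (fun n => tsubst s (s' n)) t.
Proof. by elim: t => //= t1 -> t2 ->. Qed.

Lemma tsubst_id t : tsubst tVar t = t.
Proof. by elim: t => //= t1 -> t2 ->. Qed.

Lemma up_comp s s' : (fun n => tsubst (up s) (up s' n)) = up (fun n => tsubst s (s' n)).
Proof. by apply: funext => -[//|n] /=; rewrite /tshift !tsubst_comp. Qed.

Lemma up_id : up tVar = tVar.
Proof. by apply: funext => -[]. Qed.

Lemma fsubst_comp s s' F : fsubst s (fsubst s' F) = fsubst (fun n => tsubst s (s' n)) F.
Proof.
elim: F s s' => /= [t|t u|t u|A IH|A IHA B IHB|A IHA B IHB|A IH|A IH] s s';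
  by rewrite ?tsubst_comp ?IH ?IHA ?IHB ?up_comp.
Qed.

Lemma fsubst_id F : fsubst tVar F = F.
Proof.
elim: F => /= [t|t u|t u|A IH|A IHA B IHB|A IHA B IHB|A IH|A IH];
  by rewrite ?tsubst_id ?up_id ?IH ?IHA ?IHB.
Qed.

Lemma fsubst_up_shift s F : fsubst (up s) (fshift F) = fshift (fsubst s F).
Proof. by rewrite /fshift !fsubst_comp. Qed.

Lemma finst_shift t F : finst t (fshift F) = F.
Proof. by rewrite /finst /fshift fsubst_comp fsubst_id. Qed.

Lemma tinst_shift t u : tsubst (fun n => if n is m.+1 then tVar m else t) (tshift u) = u.
Proof. by rewrite /tshift tsubst_comp tsubst_id. Qed.

Lemma fsubst_inst s t F : fsubst s (finst t F) = finst (tsubst s t) (fsubst (up s) F).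
Proof.
rewrite /finst !fsubst_comp; congr fsubst; apply: funext => -[//|n] /=.
by rewrite tinst_shift.
Qed.

Lemma finst_up s t F : finst t (fsubst (up s) F) = fsubst (dcons t s) F.
Proof.
rewrite /finst fsubst_comp; congr fsubst; apply: funext => -[//|n] /=.
by rewrite tinst_shift.
Qed.

Lemma tsubst_ext k s s' t :
  (forall n, n < k -> s n = s' n) -> tfv k t -> tsubst s t = tsubst s' t.
Proof.
move=> h; elim: t => //= [t1 IH1 t2 IH2|t1 IH1 t2 IH2].
  by move=> /andP[/IH1-> /IH2->].
by move=> /andP[/IH1-> /IH2->].
Qed.

Lemma fsubst_ext k s s' F :
  (forall n, n < k -> s n = s' n) -> ffv k F -> fsubst s F = fsubst s' F.
Proof.
have uph j (a b : nat -> term) : (forall n, n < j -> a n = b n) ->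
    forall n, n < j.+1 -> up a n = up b n.
  by move=> h [|n] //= /h ->.
elim: F k s s' => /= [t|t u|t u|A IH|A IHA B IHB|A IHA B IHB|A IH|A IH] k s s' h.
- by move=> /(tsubst_ext h) ->.
- by move=> /andP[/(tsubst_ext h)-> /(tsubst_ext h)->].
- by move=> /andP[/(tsubst_ext h)-> /(tsubst_ext h)->].
- by move=> /(IH _ _ _ h) ->.
- by move=> /andP[/(IHA _ _ _ h)-> /(IHB _ _ _ h)->].
- by move=> /andP[/(IHA _ _ _ h)-> /(IHB _ _ _ h)->].
- by move=> /(IH _ _ _ (uph _ _ _ h)) ->.
- by move=> /(IH _ _ _ (uph _ _ _ h)) ->.
Qed.

Fixpoint tbound (t : term) : nat :=
  match t with
  | tVar n => n.+1
  | tCat t1 t2 | tTimes t1 t2 => maxn (tbound t1) (tbound t2)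
  | _ => 0
  end.

(** Quantifiers do not lower the bound. The overestimate is harmless: any bound serves to close an
    axiom or to pick a fresh variable. *)
Fixpoint fbound (F : formula) : nat :=
  match F with
  | fFlip t => tbound t
  | fEq t s | fSub t s => maxn (tbound t) (tbound s)
  | fNot A | fEx A | fAll A => fbound A
  | fAnd A B | fOr A B => maxn (fbound A) (fbound B)
  end.

Lemma tboundP k t : tbound t <= k -> tfv k t.
Proof.
by elim: t => //= [t1 IH1 t2 IH2|t1 IH1 t2 IH2]; rewrite geq_max => /andP[/IH1-> /IH2->].
Qed.

Lemma fboundP k F : fbound F <= k -> ffv k F.
Proof.
elim: F k => /= [t|t u|t u|A IH|A IHA B IHB|A IHA B IHB|A IH|A IH] k;
  rewrite ?geq_max.
- exact: tboundP.
- by move=> /andP[/tboundP-> /tboundP->].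
- by move=> /andP[/tboundP-> /tboundP->].
- exact: IH.
- by move=> /andP[/IHA-> /IHB->].
- by move=> /andP[/IHA-> /IHB->].
- by move=> h; apply: IH; apply: leq_trans h _.
- by move=> h; apply: IH; apply: leq_trans h _.
Qed.

(** * Admissible rules: instances of axioms, weakening, substitution *)

Section Derivations.
Variable Th : formula -> Prop.

Lemma fsubst_alln j s F :
  fsubst s (iter j fAll F) = iter j fAll (fsubst (iter j up s) F).
Proof. by elim: j s => //= j IH s; rewrite IH -iterSr. Qed.

Lemma upn_comp j s s' : (fun n => tsubst (iter j up s) (iter j up s' n)) =
  iter j up (fun n => tsubst s (s' n)).
Proof. by elim: j => //= j IH; rewrite up_comp IH. Qed.

Lemma upn_small k s n : n < k -> iter k up s n = tVar n.
Proof. by elim: k n => //= k IH [|n] //= /IH ->. Qed.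

(* Open axioms may be instantiated: generalize all the variables, then specialize them
   one by one, starting from the outermost. *)
Lemma prv_ax_subst Ga F s : Th F -> provable Th Ga (fsubst s F).
Proof.
move=> ThF; pose k := fbound F.
(* In [P j] the variables below j are still quantified and variable j + n has become [s (j + n)].
   [P k] is the full closure, on which the substitution is inert, and [P 0] is the goal. *)
pose P j := provable Th Ga (iter j fAll (fsubst (iter j up (fun n => s (j + n))) F)).
have Pk : P k.
  rewrite /P (fsubst_ext (s' := tVar) (k := k)); [|by move=> n /upn_small ->|exact: fboundP].
  rewrite fsubst_id; clear P; elim: (k) Ga => [|m IHm] Ga; first exact: prv_ax.
  by apply: prv_allI; apply: IHm.
have PS j : P j.+1 -> P j.
  rewrite /P /= => /(@prv_allE _ _ _ (s j)).
  rewrite /finst fsubst_alln fsubst_comp -iterS iterSr upn_comp.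
  congr (provable _ _ (iter _ _ (fsubst (iter _ _ _) _))); apply: funext => -[|n] /=.
    by rewrite addn0.
  by rewrite tinst_shift addSnnS.
by elim: k Pk => // k IH /PS.
Qed.

Lemma prv_weak Ga Ga' F : provable Th Ga F -> List.incl Ga Ga' -> provable Th Ga' F.
Proof.
have inc A (G G' : seq formula) : List.incl G G' -> List.incl (A :: G) (A :: G').
  by move=> h B [->|/h]; [left|right].
have inm (G G' : seq formula) : List.incl G G' -> List.incl (map fshift G) (map fshift G').
  by move=> h B /List.in_map_iff[C [<- /h i]]; apply/List.in_map_iff; exists C.
move=> p; elim: p Ga' => {Ga F}.
- by move=> *; apply: prv_ax.
- by move=> Ga F i Ga' /(_ _ i); apply: prv_hyp.
- by move=> Ga F G _ IH1 _ IH2 Ga' h; apply: prv_notI (IH1 _ _) (IH2 _ _); apply: inc.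
- by move=> Ga F G _ IH1 _ IH2 Ga' h; apply: prv_raa (IH1 _ _) (IH2 _ _); apply: inc.
- by move=> Ga F G _ IH1 _ IH2 Ga' h; apply: prv_andI; [apply: IH1|apply: IH2].
- by move=> Ga F G _ IH Ga' h; apply: prv_andE1 (IH _ h).
- by move=> Ga F G _ IH Ga' h; apply: prv_andE2 (IH _ h).
- by move=> Ga F G _ IH Ga' h; apply: prv_orI1 (IH _ h).
- by move=> Ga F G _ IH Ga' h; apply: prv_orI2 (IH _ h).
- move=> Ga F G H _ IH _ IH1 _ IH2 Ga' h.
  by apply: prv_orE (IH _ h) (IH1 _ _) (IH2 _ _); apply: inc.
- by move=> Ga F _ IH Ga' h; apply: prv_allI (IH _ _); apply: inm.
- by move=> Ga F t _ IH Ga' h; apply: prv_allE (IH _ h).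
- by move=> Ga F t _ IH Ga' h; apply: prv_exI (IH _ h).
- by move=> Ga F G _ IH1 _ IH2 Ga' h; apply: prv_exE (IH1 _ h) (IH2 _ _); apply/inc/inm.
- by move=> *; apply: prv_eqI.
- by move=> Ga t s F _ IH1 _ IH2 Ga' h; apply: prv_eqE (IH1 _ h) (IH2 _ h).
Qed.

(** The quantifier rules keep the eigenvariable at index 0 and shift the context, so that [up s]
    passes under them without side conditions. *)
Lemma prv_subst s Ga F :
  provable Th Ga F -> provable Th (map (fsubst s) Ga) (fsubst s F).
Proof.
have sm s' (G : seq formula) :
    map (fsubst (up s')) (map fshift G) = map fshift (map (fsubst s') G).
  by rewrite -!map_comp; apply: eq_map => A /=; rewrite fsubst_up_shift.
move=> p; elim: p s => {Ga F} /=.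
- by move=> *; apply: prv_ax_subst.
- move=> Ga F i s; apply: prv_hyp; apply/List.in_map_iff; by exists F.
- by move=> Ga F G _ IH1 _ IH2 s; apply: prv_notI (IH1 _) (IH2 _).
- by move=> Ga F G _ IH1 _ IH2 s; apply: prv_raa (IH1 _) (IH2 _).
- by move=> Ga F G _ IH1 _ IH2 s; apply: prv_andI.
- by move=> Ga F G _ IH s; apply: prv_andE1 (IH _).
- by move=> Ga F G _ IH s; apply: prv_andE2 (IH _).
- by move=> Ga F G _ IH s; apply: prv_orI1 (IH _).
- by move=> Ga F G _ IH s; apply: prv_orI2 (IH _).
- by move=> Ga F G H _ IH _ IH1 _ IH2 s; apply: prv_orE (IH _) (IH1 _) (IH2 _).
- by move=> Ga F _ IH s; apply: prv_allI; rewrite -sm; apply: IH.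
- by move=> Ga F t _ IH s; rewrite fsubst_inst; apply: prv_allE (IH _).
- by move=> Ga F t _ IH s; apply: (prv_exI (t := tsubst s t)); rewrite -fsubst_inst.
- move=> Ga F G _ IH1 _ IH2 s; apply: prv_exE (IH1 _) _.
  by rewrite -sm -fsubst_up_shift; apply: IH2.
- by move=> *; apply: prv_eqI.
- move=> Ga t s F _ IH1 _ IH2 s'; rewrite fsubst_inst.
  by apply: prv_eqE (IH1 _) _; rewrite -fsubst_inst.
Qed.

Lemma prv_absurd Ga A B : provable Th Ga A -> provable Th Ga (fNot A) -> provable Th Ga B.
Proof.
by move=> a na; apply: (prv_raa (G := A)); [apply: prv_weak a _|apply: prv_weak na _];
  move=> C; right.
Qed.

(** Serves the universal case of the truth lemma. In the shifted context a counterexample at the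
    eigenvariable 0 proves [fEx (fNot A)], with variable 0 as witness. *)
Lemma prv_allN Ga A : provable Th Ga (fNot (fEx (fNot A))) -> provable Th Ga (fAll A).
Proof.
have E : finst (tVar 0) (fsubst (up (fun n => tVar n.+1)) A) = A.
  by rewrite finst_up -[RHS]fsubst_id; congr fsubst; apply: funext => -[].
move=> h; apply: prv_allI; apply: (prv_raa (G := fEx (fNot (fsubst (up (fun n => tVar n.+1)) A)))).
  apply: (prv_exI (t := tVar 0)); apply: prv_hyp; left.
  by rewrite -[in LHS]E.
by apply: prv_weak (prv_subst (fun n => tVar n.+1) h) _ => C i; right.
Qed.

End Derivations.

(** * Completeness *)

Section Enumeration.

Fixpoint tcode (t : term) : GenTree.tree nat :=
  match t with
  | tVar n => GenTree.Leaf n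
  | tEps => GenTree.Node 0 [::]
  | tZero => GenTree.Node 1 [::]
  | tOne => GenTree.Node 2 [::]
  | tCat t s => GenTree.Node 3 [:: tcode t; tcode s]
  | tTimes t s => GenTree.Node 4 [:: tcode t; tcode s]
  end.

Fixpoint fcode (F : formula) : GenTree.tree nat :=
  match F with
  | fFlip t => GenTree.Node 0 [:: tcode t]
  | fEq t s => GenTree.Node 1 [:: tcode t; tcode s]
  | fSub t s => GenTree.Node 2 [:: tcode t; tcode s]
  | fNot A => GenTree.Node 3 [:: fcode A]
  | fAnd A B => GenTree.Node 4 [:: fcode A; fcode B]
  | fOr A B => GenTree.Node 5 [:: fcode A; fcode B]
  | fEx A => GenTree.Node 6 [:: fcode A]
  | fAll A => GenTree.Node 7 [:: fcode A]
  end.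

Lemma tcode_inj : injective tcode.
Proof.
elim=> [n|||| t1 IH1 t2 IH2|t1 IH1 t2 IH2] [m|||| u1 u2|u1 u2] //=.
- by case=> ->.
- by case=> /IH1-> /IH2->.
- by case=> /IH1-> /IH2->.
Qed.

Lemma fcode_inj : injective fcode.
Proof.
elim=> [t|t u|t u|A IH|A IHA B IHB|A IHA B IHB|A IH|A IH]
  [t'|t' u'|t' u'|A'|A' B'|A' B'|A'|A'] //=.
- by case=> /tcode_inj->.
- by case=> /tcode_inj-> /tcode_inj->.
- by case=> /tcode_inj-> /tcode_inj->.
- by case=> /IH->.
- by case=> /IHA-> /IHB->.
- by case=> /IHA-> /IHB->.
- by case=> /IH->.
- by case=> /IH->.
Qed.

(** The index of [x] is the number of its code; [x0] provides a value at the indices that are not of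
    this form. *)
Lemma enum_of_inj (T : Type) (C : countType) (code : T -> C) (x0 : T) :
  injective code -> exists e : nat -> T, forall x, exists n, e n = x.
Proof.
move=> ci; have /choice[e he] : forall n, exists x, (exists y, pickle (code y) = n) ->
    pickle (code x) = n.
  move=> n; have [[y hy]|h] := pselect (exists y, pickle (code y) = n).
    by exists y.
  by exists x0.
exists e => x; exists (pickle (code x)); apply: ci; apply: (pcan_inj (@pickleK C)).
by apply: he; exists x.
Qed.

End Enumeration.

(** * The Henkin construction, with free variables as witnessing constants *)

Section Henkin.
Variables (Th : formula -> Prop) (F0 : formula) (e : nat -> formula).
Hypothesis e_onto : forall F, exists n, e n = F.
Hypothesis F0_unprovable : ~ provable Th [::] F0.

Let bot := fNot (fEq tEps tEps).
Let con Ga := ~ provable Th Ga bot.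
Let fresh Ga F := maxn (fbound F) (\max_(A <- Ga) fbound A).
(** One operation serves two ends. On [fshift A] it returns [A], so that every formula gets decided;
    on a general [F] it returns the instance of [F] at a fresh variable, which witnesses [fEx F]. *)
Let next Ga F := finst (tVar (fresh Ga F)) F.

Fixpoint stage n : seq formula :=
  if n is m.+1 then
    if `[< con (next (stage m) (e m) :: stage m) >] then next (stage m) (e m) :: stage m
    else stage m
  else [:: fNot F0].

Lemma prv_bot Ga A : provable Th Ga bot -> provable Th Ga A.
Proof. by apply: prv_absurd; apply: prv_eqI. Qed.

Lemma stage_con n : con (stage n).
Proof.
elim: n => [|n IH] /=; last by case: asboolP.
move=> p; apply: F0_unprovable; apply: (prv_raa (G := fEq tEps tEps)) p.
exact: prv_eqI.
Qed.

Lemma stage_incl m n : m <= n -> List.incl (stage m) (stage n).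
Proof.
move=> /subnKC <-; elim: (n - m) => [|k IH]; first by rewrite addn0.
rewrite addnS /=; case: asboolP => _ // A /IH; by right.
Qed.

Definition entails A := exists n, provable Th (stage n) A.

Lemma entails_two A B C : entails A -> entails B ->
  (forall Ga, provable Th Ga A -> provable Th Ga B -> provable Th Ga C) -> entails C.
Proof.
move=> [m a] [n b] h; exists (maxn m n); apply: h.
  by apply: prv_weak a _; apply: stage_incl; rewrite leq_maxl.
by apply: prv_weak b _; apply: stage_incl; rewrite leq_maxr.
Qed.

Lemma entails_one A C : entails A ->
  (forall Ga, provable Th Ga A -> provable Th Ga C) -> entails C.
Proof. by move=> a h; apply: (entails_two a a) => Ga p _; apply: h. Qed.

Lemma entails_con A : entails A -> entails (fNot A) -> False.
Proof.
move=> a na; have [n] : entails bot by apply: (entails_two a na) => Ga; apply: prv_absurd.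
exact: stage_con.
Qed.

Lemma entails_dec A : entails A \/ entails (fNot A).
Proof.
have [n en] := e_onto (fshift A); have := erefl (stage n.+1).
rewrite [RHS]/= en /next finst_shift; case: asboolP => h hs.
  by left; exists n.+1; rewrite hs; apply: prv_hyp; left.
right; exists n; move: h => /contrapT h.
apply: (prv_notI (G := fEq tEps tEps)) h; exact: prv_eqI.
Qed.

Lemma entails_not A : entails (fNot A) <-> ~ entails A.
Proof.
by split=> [na a|]; [exact: entails_con a na|case: (entails_dec A)].
Qed.

(** The renaming turns the fresh variable m into an eigenvariable: m goes to 0 and the others are
    shifted, which is plain shifting on formulas without m. *)
Lemma fresh_shift A m : fbound A <= m ->
  fsubst (fun n => if n == m then tVar 0 else tVar n.+1) A = fshift A.
Proof.
move=> h; apply: (fsubst_ext (k := m)); last exact: fboundP.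
by move=> n; case: eqP => // ->; rewrite ltnn.
Qed.

(** A witnessing instance that was rejected is refutable from its stage. As its variable is fresh,
    existential elimination then refutes [fEx A] itself. *)
Lemma entails_ex A : entails (fEx A) -> exists t, entails (finst t A).
Proof.
move=> eA; have [n en] := e_onto A; set m := fresh (stage n) A.
have Am : fbound A <= m by rewrite leq_maxl.
have Gm B : List.In B (stage n) -> fbound B <= m.
  rewrite /m /fresh; set G := stage n => i; apply: leq_trans (leq_maxr _ _).
  elim: G i => //= C G IH; rewrite big_cons => -[->|/IH h]; first exact: leq_maxl.
  by apply: leq_trans h (leq_maxr _ _).
have := erefl (stage n.+1); rewrite [RHS]/= en /next -/m; case: asboolP => h hs.
  by exists (tVar m), n.+1; rewrite hs; apply: prv_hyp; left.
move: h => /contrapT /(prv_subst (fun n => if n == m then tVar 0 else tVar n.+1)) /=.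
have -> : fsubst (fun n => if n == m then tVar 0 else tVar n.+1) (finst (tVar m) A) = A.
  rewrite /finst fsubst_comp -[RHS]fsubst_id.
  apply: (fsubst_ext (k := m)); last exact: fboundP.
  case=> [|k] /=; first by rewrite eqxx.
  by move=> km; case: eqP => // ek; rewrite -ek ltnNge leqnSn in km.
have -> : map (fsubst (fun n => if n == m then tVar 0 else tVar n.+1)) (stage n) =
    map fshift (stage n).
  apply: List.map_ext_in => B /Gm; exact: fresh_shift.
move=> p; case: (@entails_con (fEx A)) => //; exists n.
apply: (prv_notI (G := bot)).
  apply: (prv_exE (F := A)); first by apply: prv_hyp; left.
  by apply: prv_weak p _ => B [->|i]; [left|do 2 right].
apply: (prv_notI (G := bot)); first by apply: prv_hyp; left.
apply: prv_bot; apply: prv_hyp; by left.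
Qed.

(** Open terms are elements too, since their variables are the Henkin constants. Equality is only a
    congruence here. *)
Definition herbrand : structure :=
  @Structure term tEps tbit tCat tTimes
    (fun t s => entails (fEq t s)) (fun t s => entails (fSub t s)) (fun t => entails (fFlip t)).

Lemma dval_herbrand (s : nat -> herbrand) t : dval s t = tsubst s t.
Proof. by elim: t => //= t1 -> t2 ->. Qed.

Lemma truth (s : nat -> herbrand) A : ssat s A <-> entails (fsubst s A).
Proof.
elim: A s => /= [t|t u|t u|A IH|A IHA B IHB|A IHA B IHB|A IH|A IH] s;
  rewrite ?dval_herbrand //.
- by rewrite IH entails_not.
- rewrite IHA IHB; split=> [[a b]|ab].
    by apply: (entails_two a b) => Ga; apply: prv_andI.
  by split; apply: (entails_one ab) => Ga; [apply: prv_andE1|apply: prv_andE2].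
- rewrite IHA IHB; split=> [[a|b]|ab].
  + by apply: (entails_one a) => Ga; apply: prv_orI1.
  + by apply: (entails_one b) => Ga; apply: prv_orI2.
  + have [a|na] := entails_dec (fsubst s A); first by left.
    right; apply: (entails_two ab na) => Ga p q.
    apply: prv_orE p _ _; last by apply: prv_hyp; left.
    apply: (prv_absurd (A := fsubst s A)); first by apply: prv_hyp; left.
    by apply: prv_weak q _ => C; right.
- split=> [[w]|]; first rewrite IH -finst_up => h.
    by apply: (entails_one h) => Ga; apply: prv_exI.
  by move=> /entails_ex[t]; rewrite finst_up -IH; exists t.
- split=> [h|h w]; last first.
    by rewrite IH -finst_up; apply: (entails_one h) => Ga; apply: prv_allE.
  (* If [fEx (fNot A)] is refuted the universal formula follows; if it is entailed, its Henkin
     witness contradicts [h]. *)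
  have [nex|] := entails_dec (fEx (fNot (fsubst (up s) A))); last first.
    by move=> /entails_one; apply=> Ga; apply: prv_allN.
  have [t] := entails_ex nex; rewrite /finst /= -/(finst _ _) finst_up => nt.
  by case: (entails_con _ nt); rewrite -IH.
Qed.

Lemma herbrand_congruent : congruent herbrand.
Proof.
have sub1 (x x' : term) A : entails (fEq x x') -> entails (finst x A) ->
    entails (finst x' A).
  by move=> h1 h2; apply: (entails_two h1 h2) => Ga; apply: prv_eqE.
have refl x : entails (fEq x x) by exists 0; apply: prv_eqI.
have sym x y : entails (fEq x y) -> entails (fEq y x).
  move=> h; have := sub1 _ _ (fEq (tVar 0) (tshift x)) h.
  by rewrite /finst /= !tinst_shift; apply.
have trans x y z : entails (fEq x y) -> entails (fEq y z) -> entails (fEq x z).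
  move=> h k; have := sub1 _ _ (fEq (tshift x) (tVar 0)) k.
  by rewrite /finst /= !tinst_shift; apply.
have cat1 (op : term -> term -> term)
    (opE : forall s t u, tsubst s (op t u) = op (tsubst s t) (tsubst s u)) x x' y y' :
    entails (fEq x x') -> entails (fEq y y') -> entails (fEq (op x y) (op x' y')).
  move=> h k; have := sub1 _ _ (fEq (tshift (op x y)) (op (tVar 0) (tshift y))) h.
  rewrite /finst /= !opE /= !tinst_shift => /(_ (refl _)) h1.
  have := sub1 _ _ (fEq (tshift (op x' y)) (op (tshift x') (tVar 0))) k.
  by rewrite /finst /= !opE /= !tinst_shift => /(_ (refl _)); apply: trans h1.
split=> //=.
- by move=> *; apply: cat1.
- by move=> *; apply: cat1.
- move=> x x' y y' h k a; have := sub1 _ _ (fSub (tVar 0) (tshift y)) h.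
  rewrite /finst /= !tinst_shift => /(_ a) b.
  have := sub1 _ _ (fSub (tshift x') (tVar 0)) k.
  by rewrite /finst /= !tinst_shift; apply.
- move=> x x' h a; have := sub1 _ _ (fFlip (tVar 0)) h; exact.
Qed.

Lemma herbrand_model : is_model Th herbrand.
Proof. by move=> A ThA r; apply/truth; exists 0; apply: prv_ax_subst. Qed.

Lemma herbrand_refutes : ~ ssat (tVar : nat -> herbrand) F0.
Proof.
move=> /truth; rewrite fsubst_id; apply/entails_not; exists 0; apply: prv_hyp; by left.
Qed.

End Henkin.

(** * Passing to a structure with genuine equality *)

Section Quotient.
Variables (S : structure) (cS : congruent S).

(** A choice function on predicates is applied to the equivalence class; by extensionality
    equivalent elements have the same class, hence the same representative. *)
Lemma quotient_choice :
  exists rep : S -> S, (forall x, s_eq x (rep x)) /\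
    (forall x y, s_eq x y -> rep x = rep y).
Proof.
have /choice[c hc] : forall P : S -> Prop, exists x, (exists y, P y) -> P x.
  move=> P; have [[y hy]|h] := pselect (exists y, P y); first by exists y.
  by exists s_eps.
exists (fun x => c (s_eq x)); split=> [x|x y xy].
  by apply: hc; exists x; apply: (eq_refl_ax cS).
congr c; apply: funext => z; apply: propext; split; apply: (eq_trans_ax cS) => //.
exact: (eq_sym_ax cS).
Qed.

Lemma quotient : exists (Q : structure) (pi : S -> Q),
  [/\ forall x y : Q, s_eq x y = (x = y), forall q : Q, exists x, pi x = q &
      forall (r : nat -> S) F, ssat (fun n => pi (r n)) F <-> ssat r F].
Proof.
have [rep [r1 r2]] := quotient_choice.
pose D := {x : S | rep x = x}.
have repK x : rep (rep x) = rep x by rewrite -(r2 _ _ (r1 x)).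
pose pi x : D := exist _ (rep x) (repK x).
have pi_eq x y : s_eq x y <-> pi x = pi y.
  split=> [/r2 h|[h]]; first by apply: eq_exist.
  by apply: (eq_trans_ax cS (r1 x)); rewrite h; apply/(eq_sym_ax cS)/r1.
have piK (q : D) : pi (sval q) = q by case: q => x hx; apply: eq_exist.
pose Q := @Structure D (pi s_eps) (fun b => pi (s_bit b))
  (fun a b => pi (s_cat (sval a) (sval b))) (fun a b => pi (s_times (sval a) (sval b)))
  (fun a b => a = b) (fun a b => s_sub (sval a) (sval b)) (fun a => s_flip (sval a)).
have r1' x : s_eq (rep x) x by apply: (eq_sym_ax cS).
exists Q, pi; split=> // [q|]; first by exists (sval q).
have dv (r : nat -> S) t : dval (fun n => pi (r n) : Q) t = pi (dval r t).
  elim: t => //= t1 -> t2 -> /=; apply/pi_eq; [apply: (eq_cat_ax cS)|apply: (eq_times_ax cS)];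
    exact: r1'.
have dd (r : nat -> S) x : (fun n => pi (dcons x r n)) = dcons (pi x) (fun n => pi (r n)).
  by apply: funext => -[].
move=> r F.
elim: F r => /= [t|t u|t u|A IH|A IHA B IHB|A IHA B IHB|A IH|A IH] r; rewrite ?dv /=.
- by split; apply: (eq_flip_ax cS).
- by rewrite pi_eq.
- by split; apply: (eq_sub_ax cS).
- by rewrite IH.
- by rewrite IHA IHB.
- by rewrite IHA IHB.
- split=> [[q]|[x]]; first by rewrite -(piK q) -dd IH; exists (sval q).
  by rewrite -IH dd; exists (pi x).
- split=> [h x|h q]; first by rewrite -IH dd.
  by rewrite -(piK q) -dd IH.
Qed.

End Quotient.

(** The restriction to models with genuine equality is what allows rewriting when provability is
    established by reasoning in models. *)
Lemma completeness Th F :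
  (forall S : structure, (forall x y : S, s_eq x y = (x = y)) -> is_model Th S ->
     forall r : nat -> S, ssat r F) ->
  provable Th [::] F.
Proof.
move=> h; apply: contrapT => np.
have [e he] := enum_of_inj (fEq tEps tEps) fcode_inj.
have cH := herbrand_congruent Th F e; have [Q [pi [Qeq Qs Qsat]]] := quotient cH.
apply: (herbrand_refutes he np); apply/Qsat; apply: h => // A ThA r.
have /choice[f hf] : forall n, exists x, pi x = r n by move=> n; apply: Qs.
have -> : r = (fun n => pi (f n)) by apply: funext => n; rewrite hf.
by apply/Qsat; apply: herbrand_model.
Qed.

(** * Histories: a provably total and single-valued family of formulas *)

Lemma tsubst_up_shift s t : tsubst (up s) (tshift t) = tshift (tsubst s t).
Proof. by rewrite /tshift !tsubst_comp. Qed.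

Lemma fsubst_ExSW s t F : fsubst s (fExSW t F) = fExSW (tsubst s t) (fsubst (up s) F).
Proof. by rewrite /fExSW /= fsubst_up_shift !tsubst_up_shift. Qed.

Lemma fsubst_AllSW s t F : fsubst s (fAllSW t F) = fAllSW (tsubst s t) (fsubst (up s) F).
Proof. by rewrite /fAllSW /fImp /= !tsubst_up_shift. Qed.

Lemma subword_subst s F : subword_formula F -> subword_formula (fsubst s F).
Proof.
move=> h; elim: h s => {F}; try by move=> * /=; constructor; auto.
  by move=> t F _ IH s; rewrite fsubst_ExSW; apply: SW_Ex.
by move=> t F _ IH s; rewrite fsubst_AllSW; apply: SW_All.
Qed.

Lemma ssat_ExSW (S : structure) (r : nat -> S) t F :
  ssat r (fExSW t F) <-> exists x w, [/\ s_sub w (dval r t),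
    s_sub (s_cat w x) (dval r t) & ssat (dcons x r) F].
Proof.
split=> [[x [w [h1 [h2 h3]]]]|[x [w [h1 h2 h3]]]]; exists x, w.
  have {}h3 : ssat (dcons w (dcons x r)) (fshift F) by [].
  by move: h1 h2 h3 => /=; rewrite ssat_shift !dval_shift.
split; [|split]; rewrite ?ssat_shift //= !dval_shift //.
Qed.

Lemma ssat_AllSW (S : structure) (r : nat -> S) t F :
  ssat r (fAllSW t F) <-> forall x, (exists w, s_sub w (dval r t) /\
    s_sub (s_cat w x) (dval r t)) -> ssat (dcons x r) F.
Proof.
rewrite /fAllSW ssat_all; split=> h x.
  move=> [w [a b]]; have /ssat_imp := h x.
  by apply; exists w => /=; rewrite !dval_shift.
apply/(ssat_imp (dcons x r)) => -[w /=]; rewrite !dval_shift => ab.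
by apply: h; exists w.
Qed.

Lemma model_ind (S : structure) B (r : nat -> S) : is_model RSigma1bNIA S -> Sigma1b B ->
  ssat (dcons s_eps r) B ->
  (forall x, ssat (dcons x r) B -> forall b, ssat (dcons (s_cat x (s_bit b)) r) B) ->
  forall x, ssat (dcons x r) B.
Proof.
move=> mS sB h0 hS; have /ssat_imp := mS _ (NIA_ind sB) r; apply.
split; first by rewrite ssat_inst.
move=> x; apply/ssat_imp => hx; have hb := hS x hx.
have e t : ssat (dcons x r) (fsubst0 t B) = ssat (dcons (dval (dcons x r) t) r) B.
  by rewrite /fsubst0 ssat_subst; congr ssat; apply: funext => -[].
by split; rewrite e; [apply: (hb false)|apply: (hb true)].
Qed.

(** Skips variable 1, which is the history under the quantifier of [histF] and the output y under
    that of [histG]. Sending all further variables to the empty word leaves x and y as the only free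
    variables of [histG]. *)
Definition ren02 (n : nat) : term :=
  match n with 0 => tVar 0 | 1 => tVar 2 | _ => tEps end.

(* In N, variable 0 is an initial segment u of the history and variable 1 is the input
   x; in histF N, variable 0 is the history z and variable 1 is x. *)
Definition histF (N : formula) : formula :=
  fAllSW (tVar 0)
    (fAnd (fImp (fSub (tCat (tVar 0) tOne) (tVar 1)) (fsubst ren02 N))
          (fImp (fSub (tCat (tVar 0) tZero) (tVar 1)) (fNot (fsubst ren02 N)))).

Arguments histF : simpl never.

(* The length of the history is that of t, a term in variable 0 only. *)
Definition histG (N Acc : formula) (t : term) : formula :=
  fExB (tsubst (fun=> tVar 1) t)
    (fAnd (fEq (tPow1 (tVar 0)) (tPow1 (tsubst (fun=> tVar 2) t)))
    (fAnd (fsubst ren02 (histF N))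
          (fOr (fAnd (fsubst ren02 Acc) (fEq (tVar 1) tEps))
               (fAnd (fNot (fsubst ren02 Acc)) (fEq (tVar 1) tZero))))).

Lemma subword_histF N : subword_formula N -> subword_formula (histF N).
Proof.
move=> /(subword_subst ren02) h; apply: SW_All; apply: SW_And.
  exact: SW_Or (SW_Not (SW_Sub _ _)) h.
exact: SW_Or (SW_Not (SW_Sub _ _)) (SW_Not h).
Qed.

Lemma Sigma1b_histG N Acc t :
  subword_formula N -> subword_formula Acc -> Sigma1b (histG N Acc t).
Proof.
move=> /subword_histF/(subword_subst ren02) hN /(subword_subst ren02) hA.
apply: Sigma1b_Ex; apply: Sigma1b_matrix; apply: SW_And (SW_Eq _ _) (SW_And hN _).
exact: SW_Or (SW_And hA (SW_Eq _ _)) (SW_And (SW_Not hA) (SW_Eq _ _)).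
Qed.

(** * Histories in an arbitrary model of the theory *)

Section HistoryModel.
Variables (S : structure) (N : formula).
Hypothesis Seq : forall x y : S, s_eq x y = (x = y).

Let env1 (x : S) : nat -> S := fun=> x.
Definition env2 (u x : S) : nat -> S := dcons u (dcons x (fun=> s_eps)).
(** The quantifier ranges over subwords, but the two guards place a letter of [z] right after [u],
    so only prefixes [u] are constrained. *)
Definition Hist (z x : S) : Prop := forall u : S,
  (exists w, s_sub w z /\ s_sub (s_cat w u) z) ->
  (s_sub (s_cat u (s_bit true)) z -> ssat (env2 u x) N) /\
  (s_sub (s_cat u (s_bit false)) z -> ~ ssat (env2 u x) N).
Definition len (x : S) : S := s_times (s_bit true) x.

Lemma ssat_ren02 (r : nat -> S) u y x F :
  ssat (dcons u (dcons y (dcons x r))) (fsubst ren02 F) = ssat (env2 u x) F.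
Proof. by rewrite ssat_subst; congr ssat; apply: funext => -[|[|n]]. Qed.

Lemma ssat_histF z x : ssat (env2 z x) (histF N) <-> Hist z x.
Proof.
rewrite /histF ssat_AllSW; split=> h u /h.
  rewrite ssat_and => -[/ssat_imp h1 /ssat_imp h2].
  by move: h1 h2; rewrite /= ssat_ren02.
by rewrite ssat_and !ssat_imp /= ssat_ren02.
Qed.

Lemma ssat_histG Acc t (r : nat -> S) x y :
  ssat (dcons y (dcons x r)) (histG N Acc t) <->
  exists z, [/\ s_sub (len z) (len (dval (env1 x) t)), len z = len (dval (env1 x) t),
     Hist z x & ssat (env2 z x) Acc /\ y = s_eps \/ ~ ssat (env2 z x) Acc /\ y = s_bit false].
Proof.
have E z : ssat (dcons z (dcons y (dcons x r))) (fAnd (fLe (tVar 0)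
    (tshift (tsubst (fun=> tVar 1) t)))
    (fAnd (fEq (tPow1 (tVar 0)) (tPow1 (tsubst (fun=> tVar 2) t)))
    (fAnd (fsubst ren02 (histF N))
          (fOr (fAnd (fsubst ren02 Acc) (fEq (tVar 1) tEps))
               (fAnd (fNot (fsubst ren02 Acc)) (fEq (tVar 1) tZero)))))) <->
  [/\ s_sub (len z) (len (dval (env1 x) t)), len z = len (dval (env1 x) t),
     Hist z x & ssat (env2 z x) Acc /\ y = s_eps \/ ~ ssat (env2 z x) Acc /\ y = s_bit false].
  rewrite !ssat_and ssat_ren02 ssat_histF /= dval_shift !Seq !ssat_ren02 !dval_subst.
  by split=> [[? [? []]]|[]].
by rewrite /histG /fExB ssat_ex; split=> -[z /E h]; exists z.
Qed.

Hypotheses (mS : is_model RSigma1bNIA S) (sN : subword_formula N).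
Local Notation "x +b b" := (s_cat x (s_bit b)) (at level 50).
Local Notation "x `<= y" := (s_sub x y) (at level 70).

Let rho (x y : S) : nat -> S := dcons x (dcons y (fun=> s_eps)).

Lemma bitE (r : nat -> S) b : dval r (tbit b) = s_bit b.
Proof. by case: b. Qed.

Lemma cat_eps (x : S) : s_cat x s_eps = x.
Proof. by have := mS NIA_cat_eps (rho x x); rewrite /= Seq. Qed.

Lemma cat_bit (x y : S) b : s_cat x (y +b b) = s_cat x y +b b.
Proof. by have := mS (NIA_cat_bit b) (rho x y); rewrite /= Seq !bitE. Qed.

Lemma len_bit (y : S) b : len (y +b b) = len y +b true.
Proof. by have := mS (NIA_times_bit b) (rho (s_bit true) y); rewrite /= Seq !bitE. Qed.

Lemma sub_eps (x : S) : x `<= s_eps <-> x = s_eps.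
Proof. by have /ssat_iff := mS NIA_sub_eps (rho x x); rewrite /= Seq. Qed.

Lemma sub_bit (x y : S) b : x `<= y +b b <-> x `<= y \/ x = y +b b.
Proof. by have /ssat_iff := mS (NIA_sub_bit b) (rho x y); rewrite /= Seq !bitE. Qed.

Lemma bit_inj (x y : S) b c : x +b b = y +b c -> x = y /\ b = c.
Proof.
have neq (u v : S) : u +b false <> v +b true.
  by have := mS NIA_bit_neq (rho u v); rewrite /= Seq.
have inj (u v : S) d : u +b d = v +b d -> u = v.
  by have /ssat_imp := mS (NIA_bit_inj d) (rho u v); rewrite /= !Seq !bitE.
case: b c => -[] h; try by have := inj _ _ _ h.
  by case: (neq _ _ (esym h)).
by case: (neq _ _ h).
Qed.

Lemma bit_eps (x : S) b : x +b b <> s_eps.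
Proof. by have := mS (NIA_bit_eps b) (rho x x); rewrite /= Seq bitE. Qed.

(** Each use names a formula beside the predicate, as the scheme applies to formulas only; the
    elements that occur as parameters are held by [r]. *)
Lemma ind_pred A (r : nat -> S) (P : S -> Prop) : subword_formula A ->
  (forall x, ssat (dcons x r) A <-> P x) ->
  P s_eps -> (forall x, P x -> forall b, P (x +b b)) -> forall x, P x.
Proof.
move=> /Sigma1b_matrix sA AP h0 hS x; apply/AP; apply: (model_ind mS sA).
  exact/AP.
by move=> y /AP hy b; apply/AP; apply: hS.
Qed.

(** The axioms recurse on the right argument, so that the left unit law needs induction. *)
Lemma eps_cat (x : S) : s_cat s_eps x = x.
Proof.
move: x; apply: (@ind_pred (fEq (tCat tEps (tVar 0)) (tVar 0)) (fun=> s_eps)).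
- exact: SW_Eq.
- by move=> y; rewrite /= Seq.
- exact: cat_eps.
- by move=> y h b; rewrite cat_bit h.
Qed.

Lemma sub_refl (x : S) : x `<= x.
Proof.
move: x; apply: (@ind_pred (fSub (tVar 0) (tVar 0)) (fun=> s_eps)) => //.
- exact: SW_Sub.
- exact/sub_eps.
- by move=> y _ b; apply/sub_bit; right.
Qed.

Lemma eps_sub (x : S) : s_eps `<= x.
Proof.
move: x; apply: (@ind_pred (fSub tEps (tVar 0)) (fun=> s_eps)) => //.
- exact: SW_Sub.
- exact/sub_eps.
- by move=> y h b; apply/sub_bit; left.
Qed.

Lemma sub_step (x : S) b : x `<= x +b b.
Proof. by apply/sub_bit; left; apply: sub_refl. Qed.

Lemma sub_pred (x y : S) b : x +b b `<= y -> x `<= y.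
Proof.
move: y; apply: (@ind_pred (fImp (fSub (tCat (tVar 1) (tbit b)) (tVar 0))
  (fSub (tVar 1) (tVar 0))) (fun=> x)).
- exact: SW_Or (SW_Not (SW_Sub _ _)) (SW_Sub _ _).
- by move=> y; rewrite ssat_imp /= bitE.
- by move=> /sub_eps /bit_eps.
- move=> z h c /sub_bit[/h h'|/bit_inj[-> _]]; last exact: sub_step.
  by apply/sub_bit; left.
Qed.

(** Both bits go through one induction: if y c d were a prefix of y c, then y c would be a prefix of
    y, which is excluded by the hypothesis for the bit c and not for d. *)
Lemma sub_irr (x : S) b : ~ x +b b `<= x.
Proof.
have [h0 h1] : ~ x +b false `<= x /\ ~ x +b true `<= x; last by case: b.
move: x; apply: (@ind_pred (fAnd (fNot (fSub (tCat (tVar 0) tZero) (tVar 0)))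
  (fNot (fSub (tCat (tVar 0) tOne) (tVar 0)))) (fun=> s_eps)) => //.
- exact: SW_And (SW_Not (SW_Sub _ _)) (SW_Not (SW_Sub _ _)).
- by split=> /sub_eps /bit_eps.
- move=> y [h0 h1] c; have hy d : ~ y +b d `<= y by case: d.
  have hc d : ~ (y +b c) +b d `<= y +b c.
    move=> /sub_bit[/sub_pred/hy //|/bit_inj[e _]].
    by apply: (hy c); rewrite e; apply: sub_refl.
  by split; apply: hc.
Qed.

Lemma sub_next (x y : S) : x `<= y -> x = y \/ exists b, x +b b `<= y.
Proof.
suff h : x `<= y -> x = y \/ x +b false `<= y \/ x +b true `<= y.
  by move=> /h[->|[e|e]]; [left|right; exists false|right; exists true].
move: y; apply: (@ind_pred (fImp (fSub (tVar 1) (tVar 0)) (fOr (fEq (tVar 1) (tVar 0))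
  (fOr (fSub (tCat (tVar 1) tZero) (tVar 0)) (fSub (tCat (tVar 1) tOne) (tVar 0)))))
  (fun=> x)).
- exact: SW_Or (SW_Not (SW_Sub _ _)) (SW_Or (SW_Eq _ _) (SW_Or (SW_Sub _ _) (SW_Sub _ _))).
- by move=> y; rewrite ssat_imp /= Seq.
- by move=> /sub_eps ->; left.
- move=> z h c; have w d : x +b d `<= z -> x +b d `<= z +b c by move=> ?; apply/sub_bit; left.
  move=> /sub_bit[/h [->|[/w e|/w e]]|->]; [right|right; left|right; right|left] => //.
  by case: c {w}; [right|left]; apply: sub_refl.
Qed.

Lemma len_sub (x y : S) b : x +b b `<= y -> len x +b true `<= len y.
Proof.
move: y; apply: (@ind_pred (fImp (fSub (tCat (tVar 1) (tbit b)) (tVar 0))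
  (fSub (tCat (tPow1 (tVar 1)) tOne) (tPow1 (tVar 0)))) (fun=> x)).
- exact: SW_Or (SW_Not (SW_Sub _ _)) (SW_Sub _ _).
- by move=> y; rewrite ssat_imp /= bitE.
- by move=> /sub_eps /bit_eps.
- move=> z h c; rewrite len_bit => /sub_bit[/h h'|/bit_inj[-> _]]; last exact: sub_refl.
  by apply/sub_bit; left.
Qed.

Lemma len_eq_sub (x y : S) : x `<= y -> len x = len y -> x = y.
Proof.
by move=> /sub_next[//|[b /len_sub h]] e; rewrite -e in h; case: (sub_irr h).
Qed.

Lemma hist_bit (z x u : S) b : Hist z x -> u +b b `<= z -> (b = true <-> ssat (env2 u x) N).
Proof.
move=> hz ub; have [] := hz u.
  by exists s_eps; rewrite eps_cat; split; [apply: eps_sub|apply: sub_pred ub].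
by case: b ub => ub h1 h0; split=> // h; [apply: h1|case: (h0 ub)].
Qed.

(** Every prefix [w] of [z] is a prefix of [z'], by induction on [w]. Since the lengths agree and
    [z] goes on after [w], so does [z']; and in both the next letter is the truth value of [N] at
    [w]. *)
Lemma hist_unique (z z' x : S) : Hist z x -> Hist z' x -> len z = len z' -> z = z'.
Proof.
move=> hz hz' e; apply: len_eq_sub => //.
suff h w : w `<= z -> w `<= z' by apply: h; apply: sub_refl.
move: w; apply: (@ind_pred (fImp (fSub (tVar 0) (tVar 1)) (fSub (tVar 0) (tVar 2)))
  (dcons z (fun=> z'))).
- exact: SW_Or (SW_Not (SW_Sub _ _)) (SW_Sub _ _).
- by move=> w; rewrite ssat_imp.
- by move=> _; apply: eps_sub.
move=> w h b wz; have wz' := h (sub_pred wz).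
case: (sub_next wz') => [E|[c wc]].
  by case: (@sub_irr (len z) true); rewrite {1}e -E; apply: len_sub wz.
suff -> : b = c by [].
have h1 := hist_bit hz wz; have h2 := hist_bit hz' wc.
by case: b c h1 h2 {wz wc} => -[] // h1 h2; [have /h2 : ssat (env2 w x) N by apply/h1|
  have /h1 : ssat (env2 w x) N by apply/h2].
Qed.

Lemma hist_extend (z x : S) b : Hist z x -> (b = true <-> ssat (env2 z x) N) ->
  Hist (z +b b) x.
Proof.
move=> hz hb u _.
have key c : u +b c `<= z +b b -> (c = true <-> ssat (env2 u x) N).
  move=> /sub_bit[|/bit_inj[-> ->] //]; exact: hist_bit.
by split=> /key [h1 h2]; [apply: h1|move=> /h2].
Qed.

(** Bounding the history by the induction variable puts the statement into [Sigma1b]. The step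
    appends the truth value of [N] at the history reached, which exists by excluded middle in the
    model. *)
Lemma hist_exists (w x : S) : exists z, len z = len w /\ Hist z x.
Proof.
pose B := fExB (tVar 0) (fAnd (fEq (tPow1 (tVar 0)) (tPow1 (tVar 1))) (fsubst ren02 (histF N))).
have sB : Sigma1b B.
  apply: Sigma1b_Ex; apply: Sigma1b_matrix; apply: SW_And; first exact: SW_Eq.
  exact/subword_subst/subword_histF.
have BE v : ssat (dcons v (dcons x (fun=> s_eps))) B <-> exists z, len z = len v /\ Hist z x.
  rewrite /B /fExB ssat_ex; split=> [[z]|[z [h1 h2]]].
    by rewrite !ssat_and ssat_ren02 ssat_histF /= Seq => -[_ h]; exists z.
  exists z; rewrite !ssat_and ssat_ren02 ssat_histF /= Seq -!/(len _) h1.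
  split=> //.
  exact: sub_refl.
apply/BE; apply: (model_ind mS sB).
  apply/BE; exists s_eps; split=> // u _.
  by split=> /sub_eps/bit_eps.
move=> v /BE[z [h1 h2]] b; apply/BE; exists (z +b `[< ssat (env2 z x) N >]).
rewrite !len_bit h1; split=> //; apply: hist_extend => //.
by split=> [/asboolP|h]; [|apply/asboolP].
Qed.

End HistoryModel.

(** At the unique history [Acc] holds or fails, and this fixes the output. *)
Lemma histG_provable N Acc t : subword_formula N ->
  RSigma1bNIA_proves (fAllExUnique (histG N Acc t)).
Proof.
move=> sN; apply: completeness => S Seq mS r.
rewrite /fAllExUnique ssat_all => x.
have [z [z1 z2]] := hist_exists Seq mS sN (dval (fun=> x) t) x.
have out : exists y : S, ssat (env2 z x) Acc /\ y = s_eps \/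
    ~ ssat (env2 z x) Acc /\ y = s_bit false.
  by have [a|a] := pselect (ssat (env2 z x) Acc); [exists s_eps; left|exists (s_bit false); right].
have [y hy] := out; rewrite ssat_ex; exists y; rewrite ssat_and ssat_all; split.
  apply/(ssat_histG N Seq); exists z; split=> //; rewrite z1; exact: sub_refl.
move=> y'; apply/ssat_imp; rewrite ssat_subst.
rewrite (_ : (fun n => _) = dcons y' (dcons x r)); last by apply: funext => -[|[|n]].
move=> /(ssat_histG N Seq)[z' [_ e z'2 hy']]; rewrite /= Seq.
have E : z = z' by apply: (hist_unique Seq mS z2 z'2); rewrite z1 e.
rewrite -E in hy'; by case: hy hy' => -[a ->] [[a' ->]|[a' ->]].
Qed.

Lemma tfv_tsubst k s t : (forall n, tfv k (s n)) -> tfv k (tsubst s t).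
Proof. by move=> h; elim: t => //= t1 -> t2 ->. Qed.

Lemma tfv_tshift k t : tfv k t -> tfv k.+1 (tshift t).
Proof. by elim: t => //= t1 IH1 t2 IH2 /andP[/IH1 h1 /IH2 h2]; rewrite /tshift /= h1. Qed.

Lemma ffv_fsubst k s F : (forall n, tfv k (s n)) -> ffv k (fsubst s F).
Proof.
elim: F k s => /= [t|t u|t u|A IH|A IHA B IHB|A IHA B IHB|A IH|A IH] k s h;
  rewrite ?tfv_tsubst ?IH ?IHA ?IHB //; by case=> // n /=; apply: tfv_tshift.
Qed.

Lemma ffv_histG N Acc t : ffv 2 (histG N Acc t).
Proof.
have h n : tfv 3 (ren02 n) by case: n => [|[|n]].
have e1 : tfv 2 (tsubst (fun=> tVar 1) t) by apply: tfv_tsubst.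
have e2 : tfv 3 (tsubst (fun=> tVar 2) t) by apply: tfv_tsubst.
rewrite /histG; have := ffv_fsubst (histF N) h; have := ffv_fsubst Acc h.
move: (fsubst ren02 (histF N)) (fsubst ren02 Acc) => A B hA hB /=.
by rewrite tfv_tshift // e2 hA hB.
Qed.

(** * The standard structure *)

Definition Std (o : word -> bool) : structure :=
  @Structure word [::] (fun b => [:: b]) cat wtimes eq (fun x y => prefix x y)
    (fun w => o w = true).

Lemma dval_std o (r : nat -> word) t : dval (r : nat -> Std o) t = teval r t.
Proof. by elim: t => //= t1 -> t2 ->. Qed.

Lemma scons_dcons w r : scons w r = dcons w r.
Proof. by apply: funext => -[]. Qed.

Lemma sat_std o (r : nat -> word) F : sat o r F = ssat (r : nat -> Std o) F.
Proof.
elim: F r => /= [t|t u|t u|A IH|A IHA B IHB|A IHA B IHB|A IH|A IH] r;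
  rewrite ?IH ?IHA ?IHB ?dval_std //.
  by apply: eq_exists => w; rewrite IH scons_dcons.
by apply: eq_forall => w; rewrite IH scons_dcons.
Qed.

Lemma std_congruent o : congruent (Std o).
Proof. by split=> //= [x y z -> ->|x x' y y' -> ->|x x' y y' -> ->|x x' y y' -> ->|x x' ->]. Qed.

Lemma wtimes_rcons v w b : wtimes v (w ++ [:: b]) = wtimes v w ++ v.
Proof.
by rewrite /wtimes size_cat nseqD flatten_cat /= cats0.
Qed.

Lemma size_wtimes v w : size (wtimes v w) = size v * size w.
Proof. by rewrite /wtimes size_flatten /shape map_nseq sumn_nseq. Qed.

Lemma wtimes1 w : wtimes [:: true] w = nseq (size w) true.
Proof. by rewrite /wtimes; elim: (size w) => //= n ->. Qed.

Lemma prefix_nseq m n : prefix (nseq m true) (nseq n true) = (m <= n).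
Proof. by elim: m n => [|m IH] [|n] //=; rewrite IH. Qed.

Lemma prefix_cat1 (x y : word) b : prefix x (y ++ [:: b]) = prefix x y || (x == y ++ [:: b]).
Proof.
rewrite !cats1; elim: x y => [|c x IH] [|d y] //=.
by rewrite IH eqseq_cons andb_orr.
Qed.

Lemma std_model o : is_model RSigma1bNIA (Std o).
Proof.
move=> F []; rewrite /tPow1.
- by move=> r /=; rewrite cats0.
- by move=> b r /=; rewrite catA.
- by [].
- by move=> b r; case: b; apply: (wtimes_rcons (r 0) (r 1)).
- have h (w : word) : prefix w [::] <-> w = [::] by rewrite prefixs0; split=> /eqP.
  by move=> r; apply/ssat_iff; apply: h.
- have h (v w : word) b : prefix v (w ++ [:: b]) <-> prefix v w \/ v = w ++ [:: b].
    rewrite prefix_cat1; split=> [/orP[->|/eqP->]|[->|->]] //; [by left|by right|].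
    by rewrite eqxx orbT.
  by move=> b r; apply/ssat_iff; case: b; apply: h.
- have h (v w : word) b : v ++ [:: b] = w ++ [:: b] -> v = w.
    by rewrite !cats1 => /rcons_inj[].
  by move=> b r; apply/ssat_imp; case: b; apply: h.
- have h (v w : word) : v ++ [:: false] <> w ++ [:: true].
    by rewrite !cats1 => /rcons_inj[].
  by move=> r; apply: h.
- have h (v : word) b : v ++ [:: b] <> [::] by case: v.
  by move=> b r; case: b; apply: h.
move=> B _ r; apply/ssat_imp; rewrite ssat_and ssat_inst !ssat_all => -[h0 hS] w.
have e x t : ssat (dcons x r) (fsubst0 t B) = ssat (dcons (dval (dcons x r : nat -> Std o) t) r) B.
  by rewrite /fsubst0 ssat_subst; congr ssat; apply: funext => -[].
elim/last_ind: w => // w b IH; move/ssat_imp: (hS w) => /(_ IH).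
by rewrite ssat_and !e -cats1; case: b => -[].
Qed.

Section StdSat.
Variable o : word -> bool.

Definition fLen t s := fEq (tPow1 t) (tPow1 s).

Lemma satLen r t s : sat o r (fLen t s) <-> size (teval r t) = size (teval r s).
Proof.
rewrite /= !wtimes1; split=> [/(congr1 size)|->//]; by rewrite !size_nseq.
Qed.

Lemma satLe r t s : sat o r (fLe t s) <-> size (teval r t) <= size (teval r s).
Proof. by rewrite /= !wtimes1 prefix_nseq. Qed.

Lemma teval_tshift r w t : teval (scons w r) (tshift t) = teval r t.
Proof. by have := @dval_shift (Std o) r w t; rewrite -scons_dcons !dval_std. Qed.

Lemma satExE r t F : sat o r (fExSW t F) -> exists v, sat o (scons v r) F.
Proof.
by rewrite sat_std ssat_ExSW => -[v [w [_ _]]]; rewrite -scons_dcons -sat_std; exists v.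
Qed.

Lemma satExI v r t F : prefix v (teval r t) -> sat o (scons v r) F -> sat o r (fExSW t F).
Proof.
move=> pv sF; rewrite sat_std ssat_ExSW; exists v, [::].
rewrite -scons_dcons -sat_std dval_std; split=> //; exact: prefix0s.
Qed.

Definition fFalse := fNot (fEq tEps tEps).
Definition bigOr (I : Type) (s : seq I) (F : I -> formula) := foldr (fun i A => fOr (F i) A) fFalse s.

Lemma sat_bigOr (I : eqType) r (s : seq I) F :
  sat o r (bigOr s F) <-> exists2 i, i \in s & sat o r (F i).
Proof.
elim: s => [|i s IH] /=; first by split=> // -[].
rewrite IH; split=> [[h|[j js h]]|[j]].
- by exists i; rewrite ?mem_head.
- by exists j; rewrite ?inE ?js ?orbT.
- by rewrite inE => /orP[/eqP->|js h]; [left|right; exists j].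
Qed.

Lemma subword_bigOr (I : Type) (s : seq I) F :
  (forall i, subword_formula (F i)) -> subword_formula (bigOr s F).
Proof.
move=> h; elim: s => [|i s IH] /=; first exact: SW_Not (SW_Eq _ _).
exact: SW_Or.
Qed.

End StdSat.

Lemma take_prefix (T : eqType) k (s : seq T) : prefix (take k s) s.
Proof. by apply/prefixP; exists (drop k s); rewrite cat_take_drop. Qed.

Lemma prefix_nth (u z : word) b :
  prefix (u ++ [:: b]) z <-> u = take (size u) z /\ size u < size z /\ nth false z (size u) = b.
Proof.
rewrite prefixE size_cat addn1; split=> [/eqP e|[e [h1 h2]]].
  have sz : size u < size z.
    rewrite ltnNge; apply/negP => h; have := congr1 size e.
    by rewrite take_oversize ?size_cat /=; lia.
  move: e; rewrite (take_nth false) // -cats1 => /eqP; rewrite eqseq_cat; last first.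
    by rewrite size_take sz.
  by move=> /andP[/eqP-> /eqP[->]].
by rewrite (take_nth false) // -cats1 -e h2.
Qed.

Fixpoint tOnes k := if k is j.+1 then tCat (tOnes j) tOne else tEps.

Lemma size_tOnes r k : size (teval r (tOnes k)) = k.
Proof. by elim: k => //= k IH; rewrite size_cat IH addn1. Qed.

(** * Turing machines as linear cellular automata *)

Section Automaton.
Variables (M : PTM) (a : nat).
Notation cell := (option (bool + ptm_extra M) * option (ptm_state M))%type.
(** A cell is a tape symbol, together with the state if the head is there. The history writes it in
    one-hot form on [K] letters: the letter number [rank g] tells whether the cell is [g]. *)
Let K := #|{: cell}|.
Let rank (g : cell) : nat := enum_rank g.

Lemma K_gt0 : 0 < K.
Proof. by apply/card_gt0P; exists (None, None). Qed.

Lemma rank_lt g : rank g < K.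
Proof. exact: ltn_ord. Qed.

Lemma rank_inj g h : (rank g == rank h) = (g == h).
Proof. by apply/eqP/eqP => [/ord_inj/enum_rank_inj|->]. Qed.

Definition haltq (q : ptm_state M) := (q == ptm_acc M) || (q == ptm_rej M).

Definition local_rule (l b r : cell) (coin : bool) : cell :=
  match b with
  | (s, Some q) => if haltq q then b else
      let: (q', s', d) := ptm_delta coin q s in
      (s', if d is MoveStay then Some q' else None)
  | (s, None) =>
      let from (c : cell) (arrives : move -> bool) : option (ptm_state M) :=
        if c is (s1, Some q1) then
          if haltq q1 then None else
          let: (q', _, d) := ptm_delta coin q1 s1 in if arrives d then Some q' else None
        else None in
      (s, if from l (fun d => if d is MoveRight then true else false) is Some q then Some q
          else from r (fun d => if d is MoveLeft then true else false))
  end.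

(* A configuration together with the position of the head on an absolute tape. *)
Definition pconf := (nat * ptm_config M)%type.

Definition pstep (C : pconf) (coin : bool) : pconf :=
  let: (P, cf) := C in
  if ptm_halted cf then C else
  let: (_, _, d) := ptm_delta coin cf.1 (head None cf.2.2) in
  (match d with MoveLeft => P.-1 | MoveStay => P | MoveRight => P.+1 end, ptm_step cf coin).

Definition cell_at (C : pconf) (j : nat) : cell :=
  let: (P, (q, (l, r))) := C in
  (if P <= j then nth None r (j - P) else nth None l (P.-1 - j),
   if j == P then Some q else None).

Lemma cell_at_state C j : (cell_at C j).2 = if j == C.1 then Some C.2.1 else None.
Proof. by case: C => P [q [l r]]. Qed.

Lemma cell_step C coin j l r : 0 < C.1 ->
  (j = C.1.+1 -> l = cell_at C C.1) -> (j <> C.1.+1 -> l.2 = None) ->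
  (j.+1 = C.1 -> r = cell_at C C.1) -> (j.+1 <> C.1 -> r.2 = None) ->
  cell_at (pstep C coin) j = local_rule l (cell_at C j) r coin.
Proof.
case: C => P [q [tl tr]] /= P0 hl1 hl2 hr1 hr2.
have cP : cell_at (P, (q, (tl, tr))) P = (head None tr, Some q).
  by rewrite /cell_at leqnn subnn eqxx nth0.
rewrite /ptm_halted -/(haltq q) /=.
have [jP|jP] := eqVneq j P.
  rewrite jP leqnn subnn nth0 /= /ptm_step /ptm_halted -/(haltq q) /=.
  case hq: (haltq q) => /=; first by rewrite leqnn subnn eqxx nth0.
  case: ptm_delta => -[q' s'] [] /=.
  - rewrite leq_pred (_ : P - P.-1 = 1); last by lia.
    by rewrite (_ : (P == P.-1) = false) //=; lia.
  - by rewrite leqnn subnn eqxx.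
  - rewrite ltnn /= subnn (_ : (P == P.+1) = false) //; lia.
rewrite /=.
have froml : forall f : cell -> option (ptm_state M), (forall s, f (s, None) = None) ->
   f l = if j == P.+1 then f (head None tr, Some q) else None.
  move=> f hf; case: eqP => e; first by rewrite (hl1 e) -cP.
  by have := hl2 e; case: l {hl1 hl2} => s h /= ->.
have fromr : forall f : cell -> option (ptm_state M), (forall s, f (s, None) = None) ->
   f r = if j.+1 == P then f (head None tr, Some q) else None.
  move=> f hf; case: eqP => e; first by rewrite (hr1 e) -cP.
  by have := hr2 e; case: r {hr1 hr2} => s h /= ->.
pose fl (c : cell) := if c is (s1, Some q1) then if haltq q1 then None else
  let: (q', _, d) := ptm_delta coin q1 s1 in
  if (if d is MoveRight then true else false) then Some q' else None else None.
pose fr (c : cell) := if c is (s1, Some q1) then if haltq q1 then None else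
  let: (q', _, d) := ptm_delta coin q1 s1 in
  if (if d is MoveLeft then true else false) then Some q' else None else None.
rewrite -/(fl l) -/(fr r) (froml fl) // (fromr fr) // /fl /fr.
rewrite /ptm_step /ptm_halted -/(haltq q) /=.
case hq: (haltq q) => /=.
  by rewrite (negPf jP) !if_same.
case: ptm_delta => -[q' s'] d; rewrite /tape_move.
case: d => /=.
- have -> : (P.-1 <= j) = (P <= j) || (j.+1 == P) by lia.
  have -> : (j == P.-1) = (j.+1 == P) by lia.
  rewrite if_same; congr pair; case: eqP => e; last first.
    rewrite orbF; case: leqP => h.
      have e1 : j - P.-1 = (j - P.+1).+2 by lia.
      have e2 : j - P = (j - P.+1).+1 by lia.
      by rewrite e1 e2 /= nth_behead.
    by rewrite nth_behead; congr (nth _ _ _); lia.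
  have e1 : j - P.-1 = 0 by lia.
  have e2 : P.-1 - j = 0 by lia.
  have e3 : (P <= j) = false by lia.
  by rewrite orbT e1 e2 e3 /= nth0.
- rewrite (negPf jP) !if_same; congr pair; case: leqP => // h.
  have e2 : j - P = (j - P.+1).+1 by lia.
  by rewrite e2 /= nth_behead.
- have -> : (P < j) = (P <= j) by lia.
  rewrite if_same; congr pair; last by case: eqP.
  case: leqP => h; first by rewrite nth_behead; congr (nth _ _ _); lia.
  have e2 : P - j = (P.-1 - j).+1 by lia.
  by rewrite e2.
Qed.

(** [sz] is the number of steps. Starting at [orig], the head stays between 1 and 2 [sz] + 1,
    strictly inside a row of [wid] = 2 [sz] + n + 4 cells, which also contains the input. The
    distance [wid1] from a cell to its right neighbour in the preceding row is defined first,
    because terms cannot subtract. *)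
Definition sz n := (n + 2) ^ a.
Definition orig n := (sz n).+1.
Definition wid1 n := sz n + sz n + (n + 3).
Definition wid n := (wid1 n).+1.

Section Run.
Variables (o : word -> bool) (x : word).
Let n := size x.

Fixpoint conf (i : nat) : pconf :=
  if i is i'.+1 then pstep (conf i') (o (nseq i true)) else (orig n, ptm_init M x).

Lemma conf_run i : (conf i).2 = ptm_run M x (mkseq (fun j => o (nseq j.+1 true)) i).
Proof.
elim: i => // i IH; rewrite /ptm_run mkseqS foldl_rcons -/(ptm_run M x _) -IH /=.
case: (conf i) => P cf; rewrite /pstep /=.
case: ifP => h; first by rewrite /ptm_step h.
by case: ptm_delta => -[q' s'] d.
Qed.

Lemma conf_pos i : orig n <= (conf i).1 + i /\ (conf i).1 <= orig n + i.
Proof.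
elim: i => [|i [h1 h2]] /=; first by rewrite addn0.
case: (conf i) h1 h2 => P cf /= h1 h2; case: ifP => _ /=; first by lia.
by case: ptm_delta => -[q' s'] [] /=; lia.
Qed.

Lemma conf_acc i j : i <= j -> (conf i).2.1 = ptm_acc M -> (conf j).2.1 = ptm_acc M.
Proof.
move=> /subnKC <- h; elim: (j - i) => [|k IH]; first by rewrite addn0.
rewrite addnS /=; case: (conf (i + k)) IH => P cf /= IH.
by rewrite /ptm_halted IH eqxx.
Qed.

(** The rows are laid end to end after one dummy cell, which the first cell of row 1 sees as its
    left neighbour. *)
Definition tcell (m : nat) : cell :=
  if m is m'.+1 then cell_at (conf (m' %/ wid n)) (m' %% wid n) else (None, None).

Lemma tcell_row i j : j < wid n -> tcell (i * wid n + j).+1 = cell_at (conf i) j.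
Proof. by move=> h; rewrite /= divnMDl // divn_small // addn0 modnMDl modn_small. Qed.

(** This is the dummy or the last cell of a row, which the head does not reach in time. *)
Lemma tcell_edge i : i <= sz n -> (tcell (i * wid n)).2 = None.
Proof.
case: i => [|i] hi; first by rewrite mul0n.
rewrite (_ : _ * _ = (i * wid n + wid1 n).+1); last by rewrite mulSn /wid; lia.
rewrite tcell_row // cell_at_state; case: eqP => // e.
by have [_] := conf_pos i; rewrite -e /orig /wid1; lia.
Qed.

Lemma tcell_step i j : 0 < i <= sz n -> j < wid n ->
  let m := (i * wid n + j).+1 in
  local_rule (tcell (m - (wid n).+1)) (tcell (m - wid n)) (tcell (m - wid1 n)) (o (nseq i true))
  = tcell m.
Proof.
case: i => // i /andP[_ hi] jw m.
have [p1 p2] := conf_pos i; have [q1 q2] := conf_pos i.+1.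
have wE : wid n = (wid1 n).+1 by [].
have e1 : m - wid n = (i * wid n + j).+1 by rewrite /m mulSn; lia.
have e0 : tcell m = cell_at (conf i.+1) j := tcell_row i.+1 jw.
have cS : conf i.+1 = pstep (conf i) (o (nseq i.+1 true)) by [].
rewrite e0 cS e1 tcell_row //; apply/esym/cell_step.
- by rewrite /orig in p1; lia.
- move=> e; rewrite (_ : _ - _ = (i * wid n + j.-1).+1); last by rewrite /m mulSn; lia.
  by rewrite tcell_row ?e //; lia.
- move=> e; case: (posnP j) => [j0|j0]; last first.
    rewrite (_ : _ - _ = (i * wid n + j.-1).+1); last by rewrite /m mulSn; lia.
    rewrite tcell_row; last by lia.
    by rewrite cell_at_state; case: eqP => // e'; lia.
  rewrite (_ : _ - _ = i * wid n); last by rewrite /m mulSn; lia.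
  exact: tcell_edge (ltnW hi).
- move=> e; rewrite (_ : _ - _ = (i * wid n + j.+1).+1); last first.
    by rewrite /m mulSn; lia.
  by rewrite tcell_row ?e //; rewrite /orig /wid /wid1 in p2 *; lia.
(* At the right edge the neighbour is the first cell of the next row; it bears no head, as head
   positions stay positive. *)
- move=> e; have [jw'|jw'] := ltnP j.+1 (wid n).
    rewrite (_ : _ - _ = (i * wid n + j.+1).+1); last by rewrite /m mulSn; lia.
    by rewrite tcell_row // cell_at_state; case: eqP => // e'; lia.
  rewrite (_ : _ - _ = (i.+1 * wid n + 0).+1); last by rewrite /m; lia.
  rewrite tcell_row // cell_at_state; case: eqP => // e'.
  by rewrite /orig in q1; lia.
Qed.

End Run.
End Automaton.

(** * The transition rule as a subword formula *)

Section AutomatonFormula.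
Variables (M : PTM) (a : nat).
Notation cell := (option (bool + ptm_extra M) * option (ptm_state M))%type.
Let K := #|{: cell}|.
Let rank (g : cell) : nat := enum_rank g.
Let K0 : 0 < K := K_gt0 M.
Let rank_ltK g : rank g < K := rank_lt g.

(** These terms are counters, of which only the lengths matter. [tLen] counts [sz] + 1 rows, the
    initial one included, and the dummy cell, with [K] letters for each cell. *)
Definition tS (x : term) := iter a (fun s => tTimes s (tCat x (tOnes 2))) tOne.
Definition tW1 x := tCat (tCat (tS x) (tS x)) (tCat x (tOnes 3)).
Definition tW x := tCat (tW1 x) tOne.
Definition tO1 x := tCat (tS x) (tOnes 2).
Definition tLen x := tTimes (tCat (tTimes (tCat (tS x) tOne) (tW x)) tOne) (tOnes K).

Lemma size_tS r x : size (teval r (tS x)) = sz a (size (teval r x)).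
Proof.
rewrite /tS /sz; elim: (a) => //= k IH.
by rewrite size_wtimes IH !size_cat /= expnSr.
Qed.

Lemma size_tW1 r x : size (teval r (tW1 x)) = wid1 a (size (teval r x)).
Proof. by rewrite /= !size_cat !size_tS /wid1 /= !addnA. Qed.

Lemma size_tW r x : size (teval r (tW x)) = wid a (size (teval r x)).
Proof. by rewrite [teval _ _]/= size_cat size_tW1 addn1. Qed.

Lemma size_tO1 r x : size (teval r (tO1 x)) = (orig a (size (teval r x))).+1.
Proof. by rewrite /= !size_cat size_tS /= addn2. Qed.

Local Opaque tS tW1 tW tO1 tOnes tshift.
Let szE := (size_cat, size_wtimes, size_tOnes, size_tS, size_tW1, size_tW, size_tO1, addn1).

Lemma size_tLen r x : size (teval r (tLen x)) =
  ((sz a (size (teval r x))).+1 * wid a (size (teval r x)) + 1) * K.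
Proof.
by rewrite /= !szE.
Qed.

(** The length of [u] is the position of the letter to be determined. It is read as m K + rank g,
    where m is the number of the cell and [g] its candidate content; a subword of length m witnesses
    the residue. *)
Definition modF g u := fExSW u (fLen (tCat (tTimes (tVar 0) (tOnes K)) (tOnes g)) (tshift u)).
(** The letter of [u] at position |u| + i - |d| is a one. For [d] = [offT w g], where |u| = m K +
    rank g, and i = rank l, this says that the cell |w| places back is [l]. *)
Definition backF (d : term) (i : nat) (u : term) := fExSW u
  (fAnd (fSub (tCat (tVar 0) tOne) (tshift u))
        (fLen (tCat (tVar 0) (tshift d)) (tCat (tshift u) (tOnes i)))).
(** The two inequalities force the length of the quantified word to be the row i of the current
    cell, the additional [K] standing for the dummy cell. The coin is then the oracle bit at 1^i. *)
Definition coinF (u x : term) := fExSW u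
  (fAnd (fLe (tCat (tTimes (tVar 0) (tshift (tTimes (tW x) (tOnes K)))) (tOnes K)) (tshift u))
  (fAnd (fNot (fLe (tCat (tTimes (tCat (tVar 0) tOne) (tshift (tTimes (tW x) (tOnes K))))
                (tOnes K)) (tshift u)))
        (fFlip (tPow1 (tVar 0))))).
Definition symF (b : bool) (g : cell) (u x : term) := fExSW x
  (fAnd (fSub (tCat (tVar 0) (tbit b)) (tshift x))
        (fLen (tCat (tTimes (tCat (tVar 0) (tshift (tO1 x))) (tOnes K)) (tOnes (rank g)))
              (tshift u))).
Definition headF (g : cell) (u x : term) :=
  fLen (tCat (tTimes (tO1 x) (tOnes K)) (tOnes (rank g))) u.
Definition initF (g : cell) (u x : term) := fAnd
  (match g.1 with
   | Some (inl b) => symF b g u x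
   | Some (inr _) => fFalse
   | None => fAnd (fNot (symF true g u x)) (fNot (symF false g u x))
   end)
  (match g.2 with
   | None => fNot (headF g u x)
   | Some q => if q == ptm_start M then headF g u x else fFalse
   end).
Definition offT (w : term) (g : cell) := tCat (tTimes w (tOnes K)) (tOnes (rank g)).
(** The local rule is used as a finite table: its lines are the neighbourhoods, with a coin, that
    produce [g]. *)
Definition stepF (g : cell) (u x : term) :=
  bigOr (enum {: cell * cell * cell * bool}) (fun q =>
    let: (l, b, r, e) := q in
    if local_rule l b r e == g then
      fAnd (backF (offT (tCat (tW x) tOne) g) (rank l) u)
     (fAnd (backF (offT (tW x) g) (rank b) u)
     (fAnd (backF (offT (tW1 x) g) (rank r) u)
           (if e then coinF u x else fNot (coinF u x))))
    else fFalse).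
(** The dummy and the initial row fill the cells 0 to [wid], so the cell number is compared with
    [wid] + 1. *)
Definition rowF (u x : term) := fLe (tTimes (tCat (tW x) tOne) (tOnes K)) u.
Definition nextF := let u := tVar 0 in let x := tVar 1 in
  bigOr (enum {: cell}) (fun g => fAnd (modF (rank g) u)
    (fOr (fAnd (fNot (rowF u x)) (initF g u x)) (fAnd (rowF u x) (stepF g u x)))).
(** It is enough to find an accepting cell in any row, since an accepting configuration never
    changes. *)
Definition accF := fExSW (tVar 0)
  (fAnd (fSub (tCat (tVar 0) tOne) (tVar 1))
    (bigOr (enum {: cell}) (fun g =>
       if g.2 == Some (ptm_acc M) then modF (rank g) (tVar 0) else fFalse))).

Lemma subword_back d i u : subword_formula (backF d i u).
Proof. exact: SW_Ex (SW_And (SW_Sub _ _) (SW_Eq _ _)). Qed.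

Lemma subword_coin u x : subword_formula (coinF u x).
Proof. exact: SW_Ex (SW_And (SW_Sub _ _) (SW_And (SW_Not (SW_Sub _ _)) (SW_Flip _))). Qed.

Lemma subword_mod g u : subword_formula (modF g u).
Proof. exact: SW_Ex (SW_Eq _ _). Qed.

Lemma subword_false : subword_formula fFalse.
Proof. exact: SW_Not (SW_Eq _ _). Qed.

Lemma subword_init g u x : subword_formula (initF g u x).
Proof.
have hs b : subword_formula (symF b g u x) by exact: SW_Ex (SW_And (SW_Sub _ _) (SW_Eq _ _)).
have hh : subword_formula (headF g u x) by exact: SW_Eq.
apply: SW_And; last by case: g.2 => [q|]; [case: ifP => // _; apply: subword_false|exact: SW_Not].
case: g.1 => [[b|e]|] //; first exact: subword_false.
exact: SW_And (SW_Not _) (SW_Not _).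
Qed.

Lemma subword_step g u x : subword_formula (stepF g u x).
Proof.
apply: subword_bigOr => -[[[l b] r] e]; case: ifP => _; last exact: subword_false.
have hb := subword_back; have hc := subword_coin u x.
by do 3 (apply: SW_And; first by []); case: e => //; apply: SW_Not.
Qed.

Lemma subword_next : subword_formula nextF.
Proof.
apply: subword_bigOr => g; apply: SW_And (subword_mod _ _) _.
exact: SW_Or (SW_And (SW_Not (SW_Sub _ _)) (subword_init _ _ _))
  (SW_And (SW_Sub _ _) (subword_step _ _ _)).
Qed.

Lemma subword_acc : subword_formula accF.
Proof.
apply: SW_Ex; apply: SW_And (SW_Sub _ _) _; apply: subword_bigOr => g.
by case: ifP => _; [apply: subword_mod|apply: subword_false].
Qed.

Section Semantics.
Variables (o : word -> bool).

Lemma satAnd r A B : sat o r (fAnd A B) = (sat o r A /\ sat o r B).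
Proof. by []. Qed.

Lemma satOr r A B : sat o r (fOr A B) = (sat o r A \/ sat o r B).
Proof. by []. Qed.

Lemma satNot r A : sat o r (fNot A) = ~ sat o r A.
Proof. by []. Qed.

Lemma sat_mod r g u :
  sat o r (modF g u) <-> exists m, size (teval r u) = m * K + g.
Proof.
split=> [/satExE[v /satLen]|[m e]].
  by rewrite teval_tshift //= !szE => <-; exists (size v).
apply: (@satExI o (take m (teval r u))); first exact: take_prefix.
apply/satLen; rewrite teval_tshift //= !szE e size_takel //.
by rewrite e; have := leq_pmulr m K0; lia.
Qed.

Lemma sat_back r d i u : sat o r (backF d i u) <-> exists k,
  [/\ k < size (teval r u), nth false (teval r u) k &
      k + size (teval r d) = size (teval r u) + i].
Proof.
split=> [/satExE[v]|[k [k1 k2 k3]]].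
  rewrite satAnd satLen.
  rewrite /= !teval_tshift // !szE => -[/prefix_nth[_ [h1 h2]] h3].
  by exists (size v).
apply: (@satExI o (take k (teval r u))); first exact: take_prefix.
split; last by apply/satLen; rewrite /= !teval_tshift // !szE size_takel // ltnW.
rewrite /= teval_tshift //; apply/prefix_nth; rewrite size_takel ?(ltnW k1) //; split=> //.
Qed.

Lemma sat_coin r u x : sat o r (coinF u x) <-> exists i,
  [/\ i * (wid a (size (teval r x)) * K) + K <= size (teval r u),
      size (teval r u) < i.+1 * (wid a (size (teval r x)) * K) + K & o (nseq i true)].
Proof.
split=> [/satExE[v]|[i [h1 h2 h3]]].
  rewrite !satAnd satNot => -[/satLe h1 [h2 h3]].
  rewrite satLe in h2; move: h1 h2.
  rewrite /= !teval_tshift //= !szE => h1 /negP; rewrite -ltnNge => h2.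
  by exists (size v); split=> //; move: h3; rewrite /= wtimes1.
have iu : i <= size (teval r u).
  have w0 : 0 < wid a (size (teval r x)) * K by rewrite muln_gt0 K0.
  by apply: leq_trans (leq_pmulr i w0) (leq_trans (leq_addr _ _) h1).
have st : size (take i (teval r u)) = i by rewrite size_takel.
apply: (@satExI o (take i (teval r u))); first exact: take_prefix.
split; last split.
- by apply/satLe; rewrite /= !teval_tshift //= !szE st.
- by move=> /satLe; rewrite /= !teval_tshift //= !szE st leqNgt h2.
- by rewrite /= wtimes1 st.
Qed.

Lemma sat_sym b g r u x : sat o r (symF b g u x) <-> exists k,
  [/\ k < size (teval r x), nth false (teval r x) k = b &
   (k + (orig a (size (teval r x))).+1) * K + rank g = size (teval r u)].
Proof.
have tb r' : teval r' (tbit b) = [:: b] by case: b.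
split=> [/satExE[v]|[k [k1 k2 k3]]].
  rewrite satAnd satLen /= tb !teval_tshift // !szE => -[/prefix_nth[_ [h1 h2]] h3].
  by exists (size v).
apply: (@satExI o (take k (teval r x))); first exact: take_prefix.
have st : size (take k (teval r x)) = k by rewrite size_takel // ltnW.
split; last first.
  by apply/satLen; rewrite /= !teval_tshift //= !szE st.
by rewrite /= tb teval_tshift //; apply/prefix_nth; rewrite st.
Qed.

Lemma sat_head g r u x : sat o r (headF g u x) <->
  (orig a (size (teval r x))).+1 * K + rank g = size (teval r u).
Proof.
by rewrite satLen /= !szE.
Qed.

Lemma sat_row r u x : sat o r (rowF u x) <-> (wid a (size (teval r x))).+1 * K <= size (teval r u).
Proof.
by rewrite satLe /= !szE.
Qed.

Variable X : word.
Let n := size X.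
Let W := wid a n.
Let c := tcell M a o X : nat -> cell.
Let bit (k : nat) : bool := rank (c (k %/ K)) == k %% K.

Lemma tcell_bitE m g : bit (m * K + rank g) = (c m == g).
Proof.
rewrite /bit divnMDl // divn_small // addn0 modnMDl modn_small //.
exact: rank_inj.
Qed.

Variables (r : nat -> word) (m : nat) (g : cell).
Hypotheses (rU : r 0 = mkseq bit (m * K + rank g)) (rX : r 1 = X).
Let sizeU : size (r 0) = m * K + rank g.
Proof. by rewrite rU size_mkseq. Qed.

Lemma eqn_mulK i j k l : k < K -> l < K -> (i * K + k = j * K + l) -> i = j /\ k = l.
Proof.
move=> hk hl e; have := congr1 (fun z => z %/ K) e; have := congr1 (fun z => z %% K) e.
by rewrite /= !divnMDl // !divn_small // !modnMDl !modn_small // !addn0.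
Qed.

Lemma sat_back_cell w l t : 0 < w <= m -> size (teval r t) = w ->
  sat o r (backF (offT t g) (rank l) (tVar 0)) <-> c (m - w) = l.
Proof.
move=> /andP[w0 wm] st; rewrite sat_back /= !szE st sizeU rU.
split=> [[k [k1 k2 k3]]|e].
  have ek : k = (m - w) * K + rank l.
    have -> : (m - w) * K = m * K - w * K by rewrite mulnBl.
    have : w * K <= m * K by rewrite leq_mul2r wm orbT.
    by lia.
  by move: k2; rewrite nth_mkseq ?ek ?tcell_bitE => [/eqP|] //; rewrite -ek.
have h : (m - w) * K + rank l < m * K + rank g.
  have : (m - w).+1 * K <= m * K by rewrite leq_mul2r; apply/orP; right; lia.
  by have := rank_ltK l; rewrite mulSn; lia.
exists ((m - w) * K + rank l); split=> //; first by rewrite nth_mkseq // tcell_bitE e eqxx.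
have -> : (m - w) * K = m * K - w * K by rewrite mulnBl.
have : w * K <= m * K by rewrite leq_mul2r wm orbT.
by lia.
Qed.

Lemma sat_init_cell : m <= W -> sat o r (initF g (tVar 0) (tVar 1)) <-> c m = g.
Proof.
move=> mW.
have hd : sat o r (headF g (tVar 0) (tVar 1)) <-> m = (orig a n).+1.
  rewrite sat_head /= rX sizeU -/n; split=> [/eqn_mulK[]|->] //.
have sy b : sat o r (symF b g (tVar 0) (tVar 1)) <->
    exists k, [/\ k < n, nth false X k = b & m = (k + orig a n).+1].
  rewrite sat_sym /= rX sizeU -/n; split=> [[k [k1 k2 /eqn_mulK[] // <- _]]|[k [k1 k2 ->]]].
    by exists k; rewrite -addnS.
  by exists k; rewrite -addnS.
pose v : option (bool + ptm_extra M) := if m is j.+1 then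
  (if orig a n <= j then nth None [seq Some (inl b) | b <- X] (j - orig a n) else None) else None.
have cm : c m = (v, if m == (orig a n).+1 then Some (ptm_start M) else None).
  rewrite /c /v; case: (m) mW => [|j] //= jW.
  by rewrite divn_small // modn_small //= nth_nil.
have nX j : orig a n <= j -> nth None [seq Some (inl b) | b <- X] (j - orig a n) =
    if j - orig a n < n then Some (inl (nth false X (j - orig a n))) else None
    :> option (bool + ptm_extra M).
  by move=> h; case: ltnP => h'; [rewrite (nth_map false)|rewrite nth_default // size_map].
have sy0 k : m = (k + orig a n).+1 -> k < n -> v = Some (inl (nth false X k)).
  by rewrite /v => -> kn; rewrite leq_addl nX ?leq_addl // addnK kn.
have sy1 b : v = Some (inl b) -> exists k, [/\ k < n, nth false X k = b & m = (k + orig a n).+1].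
  rewrite /v; case: (m) => // j; case: leqP => // h; rewrite nX //; case: ltnP => // h' [<-].
  by exists (j - orig a n); rewrite subnK.
have sy2 : v = None \/ exists b, v = Some (inl b).
  rewrite /v; case: (m) => [|j]; first by left.
  case h: (orig a n <= j); last by left.
  by rewrite nX //; case: ltnP => h'; [right; exists (nth false X (j - orig a n))|left].
have e1 : sat o r (match g.1 with
   | Some (inl b) => symF b g (tVar 0) (tVar 1)
   | Some (inr _) => fFalse
   | None => fAnd (fNot (symF true g (tVar 0) (tVar 1))) (fNot (symF false g (tVar 0) (tVar 1)))
   end) <-> (c m).1 = g.1.
  rewrite cm /=; case: g.1 => [[b|e]|].
  - by rewrite sy; split=> [[k [k1 <- k3]]|]; [apply: sy0|apply: sy1].
  - by split=> [h|]; [case: h|case: sy2 => [->|[b ->]]].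
  - rewrite satAnd !satNot !sy; split=> [[h1 h2]|e].
      by case: sy2 => // -[b /sy1]; case: b.
    by split=> -[k [k1 _ k3]]; have := sy0 _ k3 k1; rewrite e.
have e2 : sat o r (match g.2 with
   | None => fNot (headF g (tVar 0) (tVar 1))
   | Some q => if q == ptm_start M then headF g (tVar 0) (tVar 1) else fFalse
   end) <-> (c m).2 = g.2.
  rewrite cm /=; case: g.2 => [q|].
    case: eqP => [->|ne].
      by rewrite hd; split=> [->|]; [rewrite eqxx|case: eqP].
    by split=> [h|]; [case: h|case: eqP => // _ [e]; case: ne].
  by rewrite satNot hd; case: eqP.
rewrite /initF satAnd e1 e2; case: (c m) (g) => [s q] [s' q'] /=.
by split=> [[-> ->]|[-> ->]].
Qed.

Lemma sat_step_cell : W < m <= (sz a n).+1 * W -> sat o r (stepF g (tVar 0) (tVar 1)) <-> c m = g.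
Proof.
move=> /andP[Wm mL].
have W0 : 0 < W by [].
have [i [j [hi jW em]]] : exists i j, [/\ 0 < i <= sz a n, j < W & m = (i * W + j).+1].
  (* The predecessor accounts for the dummy cell. *)
  exists (m.-1 %/ W), (m.-1 %% W); rewrite ltn_mod W0 -divn_eq; split=> //; last by lia.
  apply/andP; split; first by rewrite divn_gt0 //; lia.
  by rewrite -ltnS ltn_divLR //; lia.
have coin : sat o r (coinF (tVar 0) (tVar 1)) <-> o (nseq i true).
  rewrite sat_coin /= rX sizeU -/n -/W em.
  have hg := rank_ltK g.
  have b1 : i * (W * K) + K <= (i * W + j).+1 * K + rank g.
    by rewrite (mulSn (i * W + j)) mulnDl mulnA; lia.
  have b2 : (i * W + j).+1 * K + rank g < i.+1 * (W * K) + K.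
    rewrite (mulSn (i * W + j)) (mulSn i) mulnDl mulnA; have : j.+1 * K <= W * K by rewrite leq_mul2r jW orbT.
    by rewrite (mulSn j); lia.
  split=> [[i' [h1 h2]]|h]; last by exists i.
  suff -> : i' = i by [].
  have WK : 0 < W * K by rewrite muln_gt0 W0 K0.
  have l1 : i' < i.+1 by rewrite -(ltn_pmul2r WK); lia.
  have l2 : i < i'.+1 by rewrite -(ltn_pmul2r WK); lia.
  by lia.
have b2 l : sat o r (backF (offT (tCat (tW (tVar 1)) tOne) g) (rank l) (tVar 0)) <-> c (m - W.+1) = l.
  by apply: sat_back_cell; [rewrite Wm|rewrite /= !szE /= rX].
have b1 l : sat o r (backF (offT (tW (tVar 1)) g) (rank l) (tVar 0)) <-> c (m - W) = l.
  by apply: sat_back_cell; [rewrite W0 ltnW|rewrite /= !szE /= rX].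
have b0 l : sat o r (backF (offT (tW1 (tVar 1)) g) (rank l) (tVar 0)) <-> c (m - wid1 a n) = l.
  apply: sat_back_cell; last by rewrite /= !szE /= rX.
  by rewrite /W /wid in Wm; rewrite /wid1 in Wm *; lia.
have step := tcell_step M o hi jW; rewrite -em -/c -/W in step.
rewrite /stepF sat_bigOr -step; split.
  move=> [[[[l b] q] e] _]; case: eqP => [eg|_ h]; last by case: h.
  rewrite !satAnd b2 b1 b0 => -[-> [-> [->]]]; rewrite -eg.
  by case: e {eg} => [/coin->|]; rewrite ?satNot // coin => /negP/negPf->.
move=> eg; exists (c (m - W.+1), c (m - W), c (m - wid1 a n), o (nseq i true)).
  by rewrite mem_enum.
rewrite eg eqxx !satAnd b2 b1 b0; do 3 split=> //.
by case h: (o _); [apply/coin|move=> /coin; rewrite h].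
Qed.

End Semantics.

Section History.
Variables (o : word -> bool) (X : word).
Let n := size X.
Let W := wid a n.
Let c := tcell M a o X : nat -> cell.
Let bit (k : nat) : bool := rank (c (k %/ K)) == k %% K.
Let L := ((sz a n).+1 * W + 1) * K.
Let bitE m g : bit (m * K + rank g) = (c m == g) := tcell_bitE o X m g.

Lemma next_bit (r : nat -> word) k : k < L -> r 0 = mkseq bit k -> r 1 = X ->
  sat o r nextF <-> bit k.
Proof.
move=> kL r0 r1.
have row m g : k = m * K + rank g -> sat o r (rowF (tVar 0) (tVar 1)) <-> W < m.
  move=> ek; rewrite sat_row /= r1 r0 size_mkseq -/n -/W ek.
  rewrite -[W < m](leq_pmul2r K0); split=> h; last by apply: leq_trans h (leq_addr _ _).
  have : W.+1 * K < m.+1 * K.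
    by apply: leq_ltn_trans h _; rewrite (mulSn m) [K + _]addnC ltn_add2l.
  by rewrite ltn_pmul2r // ltnS leq_pmul2r.
have mL m g : k = m * K + rank g -> m <= (sz a n).+1 * W.
  move=> ek; have : m * K < L by apply: leq_ltn_trans kL; rewrite ek leq_addr.
  by rewrite /L ltn_pmul2r // addn1 ltnS.
have key m g : k = m * K + rank g -> sat o r (fOr (fAnd (fNot (rowF (tVar 0) (tVar 1)))
    (initF g (tVar 0) (tVar 1))) (fAnd (rowF (tVar 0) (tVar 1)) (stepF g (tVar 0) (tVar 1)))) <->
    c m = g.
  move=> ek; rewrite satOr (satAnd _ _ (fNot _)) (satAnd _ _ (rowF _ _)) satNot (row _ _ ek).
  have r0' := r0; rewrite ek in r0'.
  have [Wm|mW] := ltnP W m.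
    have := @sat_step_cell o X r m g r0' r1; rewrite -/n -/W Wm (mL _ _ ek) => /(_ isT) ->.
    by split=> [[[]//|[]]|h] //; right.
  rewrite (@sat_init_cell o X r m g r0' r1 mW).
  by split=> [[[]|[]]|h] //; left.
rewrite /nextF sat_bigOr; split.
  move=> [g _]; rewrite satAnd sat_mod => -[[m]]; rewrite [teval _ _]/= r0 size_mkseq.
  move=> ek /(key _ _ ek) e.
  by rewrite ek bitE e.
move=> bk; have ek : k = (k %/ K) * K + rank (c (k %/ K)) by rewrite (eqP bk) -divn_eq.
exists (c (k %/ K)); first by rewrite mem_enum.
rewrite satAnd sat_mod; split; first by exists (k %/ K); rewrite /= r0 size_mkseq.
exact/(key _ _ ek).
Qed.

Lemma acc_hist (r : nat -> word) : r 0 = mkseq bit L ->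
  sat o r (accF) <-> (conf M a o X (sz a n)).2.1 = ptm_acc M.
Proof.
move=> r0; split.
  move=> /satExE[v]; rewrite satAnd sat_bigOr /= r0 => -[/prefix_nth[_ []]].
  rewrite size_mkseq => vL; rewrite nth_mkseq // => bv [g _].
  case: eqP => [g2|_ h]; last by case: h.
  rewrite sat_mod /= => -[m em]; move: bv vL; rewrite em bitE => /eqP cm.
  rewrite /L => mL; have {}mL : m <= (sz a n).+1 * W.
    have := leq_ltn_trans (leq_addr (rank g) (m * K)) mL.
    by rewrite ltn_pmul2r // addn1 ltnS.
  move: mL cm; rewrite /c; case: (m) => [|m'] mL /=; first by move=> e; rewrite -e in g2.
  move=> e; move: g2; rewrite -e cell_at_state; case: eqP => // _ [].
  by apply: conf_acc; rewrite -ltnS ltn_divLR.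
move=> acc; have [p1 p2] := conf_pos M a o X (sz a n).
have PW : (conf M a o X (sz a n)).1 < W by rewrite /W /wid /wid1 -/n /orig in p2 *; lia.
pose m := (sz a n * W + (conf M a o X (sz a n)).1).+1.
have cm : (c m).2 = Some (ptm_acc M) by rewrite /c /m tcell_row // cell_at_state eqxx acc.
have mL : m * K + rank (c m) < L.
  have := rank_ltK (c m); have : m.+1 * K <= L.
    rewrite /L leq_mul2r addn1 ltnS; apply/orP; right.
    by rewrite /m (mulSn (sz a n)); lia.
  by rewrite (mulSn m); lia.
apply: (@satExI o (take (m * K + rank (c m)) (r 0))); first exact: take_prefix.
have st : size (take (m * K + rank (c m)) (r 0)) = m * K + rank (c m).
  by rewrite size_takel // r0 size_mkseq ltnW.
rewrite satAnd; split.
  by rewrite /=; apply/prefix_nth; rewrite st r0 size_mkseq nth_mkseq // bitE eqxx.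
rewrite sat_bigOr; exists (c m); first by rewrite mem_enum.
by rewrite cm eqxx sat_mod /= st; exists m.
Qed.

(** The word of the cells of the run is a history by [next_bit]. The standard structure being a
    model of the theory, [hist_unique] makes it the only one of its length. *)
Lemma histG_std (r : nat -> word) y :
  sat o (scons y (scons X r)) (histG nextF accF (tLen (tVar 0))) <->
  y = if ptm_accepting (ptm_run M X (mkseq (fun j => o (nseq j.+1 true)) (sz a n)))
      then [::] else [:: false].
Proof.
have Seq (u v : Std o) : s_eq u v = (u = v) by [].
have lenE (u v : Std o) : (len u = len v) <-> size (u : word) = size (v : word).
  rewrite /len /= !wtimes1; split=> [/(congr1 size)|->//]; by rewrite !size_nseq.
pose z0 : Std o := mkseq bit L.
have hz0 : Hist nextF z0 (X : Std o).
  move=> u _.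
  have key b : prefix (u ++ [:: b]) z0 -> b <-> ssat (env2 u (X : Std o)) nextF.
    move=> /prefix_nth[e []]; rewrite size_mkseq => uL; rewrite nth_mkseq // => <-.
    rewrite -(@next_bit (env2 u (X : Std o)) (size (u : word))) //; first by rewrite sat_std.
    change ((u : word) = mkseq bit (size (u : word))).
    rewrite [LHS]e /z0 /mkseq -map_take take_iota.
    by rewrite (minn_idPl (ltnW uL)).
  split=> h; first exact: (iffLR (key true h) isT).
  by move=> h'; have := iffRL (key false h) h'.
have lz0 : len z0 = len (dval (fun=> X : Std o) (tLen (tVar 0))).
  by apply/lenE; rewrite dval_std size_tLen /= size_mkseq.
rewrite sat_std !scons_dcons (ssat_histG nextF Seq).
have accE : ssat (env2 z0 (X : Std o)) accF <->
    ptm_accepting (ptm_run M X (mkseq (fun j => o (nseq j.+1 true)) (sz a n))).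
  rewrite -sat_std acc_hist // conf_run /ptm_accepting.
  by split=> [->|/eqP].
split=> [[z [_ lz hz out]]|->].
  have ez : z = z0 by apply: (hist_unique Seq (@std_model o) hz hz0); rewrite lz lz0.
  rewrite ez in out; case: out => -[/accE h ->]; first by rewrite h.
  by case: ifP.
exists z0; split=> //.
  by rewrite lz0; apply: prefix_refl.
by case: ifP => h; [left|right]; split=> //; [apply/accE|move=> /accE; rewrite h].
Qed.

End History.
End AutomatonFormula.

(** * Cobham's function algebra relative to an oracle *)

Definition env := nat -> word.
Definition ofun := (word -> bool) -> env -> word.

(* recw iterates h along the letters of the last argument; the state is truncated to length n
   and h also receives the letters read so far. *)
Fixpoint recw (h : bool -> word -> word -> word) (n : nat) (s pre x : word) : word :=
  if x is b :: x' then recw h n (take n (h b s pre)) (rcons pre b) x' else s.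

(** In [PRec] the variables 0 and 1 of [h0] and [h1] are the state and the part of the input already
    read. Truncation to the length of [bd] takes the place of the side condition of limited
    recursion, so that every expression is legitimate. *)
Inductive pexp : Type :=
| PVar (n : nat)
| PNil
| PSnoc (b : bool) (p : pexp)
| PCat (p q : pexp)
| PTimes (p q : pexp)
| PAsk (p : pexp)
| PRec (x i h0 h1 bd : pexp).

Fixpoint ev (p : pexp) (o : word -> bool) (e : env) : word :=
  match p with
  | PVar n => e n
  | PNil => [::]
  | PSnoc b p => rcons (ev p o e) b
  | PCat p q => ev p o e ++ ev q o e
  | PTimes p q => wtimes (ev p o e) (ev q o e)
  | PAsk p => [:: o (ev p o e)]
  | PRec x i h0 h1 bd =>
      let n := size (ev bd o e) in
      recw (fun b s pre => ev (if b then h1 else h0) o (dcons s (dcons pre e)))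
        n (take n (ev i o e)) [::] (ev x o e)
  end.

Definition shift2 (f : nat -> nat) (n : nat) : nat :=
  match n with 0 => 0 | 1 => 1 | m.+2 => (f m).+2 end.

Fixpoint pren (f : nat -> nat) (p : pexp) : pexp :=
  match p with
  | PVar n => PVar (f n)
  | PNil => PNil
  | PSnoc b p => PSnoc b (pren f p)
  | PCat p q => PCat (pren f p) (pren f q)
  | PTimes p q => PTimes (pren f p) (pren f q)
  | PAsk p => PAsk (pren f p)
  | PRec x i h0 h1 bd => PRec (pren f x) (pren f i) (pren (shift2 f) h0) (pren (shift2 f) h1)
                           (pren f bd)
  end.

Definition up2 (s : nat -> pexp) (n : nat) : pexp :=
  match n with 0 => PVar 0 | 1 => PVar 1 | m.+2 => pren (fun k => k.+2) (s m) end.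

Fixpoint psubst (s : nat -> pexp) (p : pexp) : pexp :=
  match p with
  | PVar n => s n
  | PNil => PNil
  | PSnoc b p => PSnoc b (psubst s p)
  | PCat p q => PCat (psubst s p) (psubst s q)
  | PTimes p q => PTimes (psubst s p) (psubst s q)
  | PAsk p => PAsk (psubst s p)
  | PRec x i h0 h1 bd => PRec (psubst s x) (psubst s i) (psubst (up2 s) h0)
                           (psubst (up2 s) h1) (psubst s bd)
  end.

Lemma ev_ren p f o e : ev (pren f p) o e = ev p o (fun n => e (f n)).
Proof.
elim: p f e => //= [b p IH|p IHp q IHq|p IHp q IHq|p IH|x IHx i IHi h0 IH0 h1 IH1 bd IHb] f e;
  rewrite ?IH ?IHp ?IHq // IHx IHi IHb.
congr recw; apply: funext => b; apply: funext => s; apply: funext => pre.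
have E : (fun n => dcons s (dcons pre e) (shift2 f n)) = dcons s (dcons pre (fun n => e (f n))).
  by apply: funext => -[|[|n]].
by case: b; rewrite ?IH0 ?IH1 E.
Qed.

Lemma ev_subst p s o e : ev (psubst s p) o e = ev p o (fun n => ev (s n) o e).
Proof.
elim: p s e => //= [b p IH|p IHp q IHq|p IHp q IHq|p IH|x IHx i IHi h0 IH0 h1 IH1 bd IHb] f e;
  rewrite ?IH ?IHp ?IHq // IHx IHi IHb.
congr recw; apply: funext => b; apply: funext => s; apply: funext => pre.
have E : (fun n => ev (up2 f n) o (dcons s (dcons pre e))) =
    dcons s (dcons pre (fun n => ev (f n) o e)).
  by apply: funext => -[|[|n]] //=; rewrite ev_ren.
by case: b; rewrite ?IH0 ?IH1 E.
Qed.

Fixpoint pbound (p : pexp) : nat :=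
  match p with
  | PVar n => n.+1
  | PNil => 0
  | PSnoc _ p | PAsk p => pbound p
  | PCat p q | PTimes p q => maxn (pbound p) (pbound q)
  | PRec x i h0 h1 bd =>
      maxn (pbound x) (maxn (pbound i) (maxn (pbound h0) (maxn (pbound h1) (pbound bd))))
  end.

Lemma ev_ext p k o (e e' : env) : pbound p <= k -> (forall n, n < k -> e n = e' n) ->
  ev p o e = ev p o e'.
Proof.
elim: p k e e' => //= [n|b p IH|p IHp q IHq|p IHp q IHq|p IH|x IHx i IHi h0 IH0 h1 IH1 bd IHb]
  k e e'; rewrite ?geq_max.
- by move=> nk; apply.
- by move=> pk h; rewrite (IH _ _ _ pk h).
- by move=> /andP[pk qk] h; rewrite (IHp _ _ _ pk h) (IHq _ _ _ qk h).
- by move=> /andP[pk qk] h; rewrite (IHp _ _ _ pk h) (IHq _ _ _ qk h).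
- by move=> pk h; rewrite (IH _ _ _ pk h).
- move=> /andP[xk /andP[ik /andP[k0 /andP[k1 bk]]]] h.
  rewrite (IHx _ _ _ xk h) (IHi _ _ _ ik h) (IHb _ _ _ bk h).
  congr recw; apply: funext => b; apply: funext => s; apply: funext => pre.
  have E n : n < k -> dcons s (dcons pre e) n = dcons s (dcons pre e') n.
    by case: n => [|[|n]] //= nk; apply: h; apply: leq_trans nk; rewrite ltnS leqW.
  by case: b; [apply: IH1 k1 E|apply: IH0 k0 E].
Qed.

Fixpoint pcode (p : pexp) : GenTree.tree nat :=
  match p with
  | PVar n => GenTree.Leaf n
  | PNil => GenTree.Node 0 [::]
  | PSnoc b p => GenTree.Node 1 [:: GenTree.Leaf (b : nat); pcode p]
  | PCat p q => GenTree.Node 3 [:: pcode p; pcode q]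
  | PTimes p q => GenTree.Node 4 [:: pcode p; pcode q]
  | PAsk p => GenTree.Node 5 [:: pcode p]
  | PRec x i h0 h1 bd => GenTree.Node 6 [:: pcode x; pcode i; pcode h0; pcode h1; pcode bd]
  end.

Lemma pcode_inj : injective pcode.
Proof.
elim=> [n||b p IH|p IHp q IHq|p IHp q IHq|p IH|x IHx i IHi h0 IH0 h1 IH1 bd IHb]
  [n'||b' p'|p' q'|p' q'|p'|x' i' h0' h1' bd'] //=.
- by case=> ->.
- by case=> eb /IH->; case: b b' eb => -[].
- by case=> /IHp-> /IHq->.
- by case=> /IHp-> /IHq->.
- by case=> /IH->.
- by case=> /IHx-> /IHi-> /IH0-> /IH1-> /IHb->.
Qed.

(** Definability is a property of functions, so that the closure lemmas need no syntax; an
    expression is extracted only where one is wanted. *)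
Definition pf (f : ofun) : Prop := exists p, forall o e, ev p o e = f o e.

Lemma pf_ext f g : pf f -> (forall o e, f o e = g o e) -> pf g.
Proof. by move=> [p hp] h; exists p => o e; rewrite hp h. Qed.

Lemma pf_ev p : pf (ev p).
Proof. by exists p. Qed.

Lemma pf_var n : pf (fun o e => e n).
Proof. by exists (PVar n). Qed.

Lemma pf_nil : pf (fun o e => [::]).
Proof. by exists PNil. Qed.

Lemma pf_snoc b f : pf f -> pf (fun o e => rcons (f o e) b).
Proof. by move=> [p hp]; exists (PSnoc b p) => o e /=; rewrite hp. Qed.

Lemma pf_bit b : pf (fun o e => [:: b]).
Proof. exact: pf_snoc pf_nil. Qed.

Lemma pf_cat f g : pf f -> pf g -> pf (fun o e => f o e ++ g o e).
Proof. by move=> [p hp] [q hq]; exists (PCat p q) => o e /=; rewrite hp hq. Qed.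

Lemma pf_times f g : pf f -> pf g -> pf (fun o e => wtimes (f o e) (g o e)).
Proof. by move=> [p hp] [q hq]; exists (PTimes p q) => o e /=; rewrite hp hq. Qed.

Lemma pf_ask f : pf f -> pf (fun o e => [:: o (f o e)]).
Proof. by move=> [p hp]; exists (PAsk p) => o e /=; rewrite hp. Qed.

Lemma pf_comp f (g : nat -> ofun) : pf f -> (forall i, pf (g i)) ->
  pf (fun o e => f o (fun i => g i o e)).
Proof.
move=> [p hp] /choice[s hs]; exists (psubst s p) => o e.
by rewrite ev_subst hp; congr f; apply: funext => i; rewrite hs.
Qed.

Lemma pf_ren f (g : nat -> nat) : pf f -> pf (fun o e => f o (fun n => e (g n))).
Proof. by move=> hf; apply: (pf_comp hf) => i; apply: pf_var. Qed.

Lemma pf_app f g : pf f -> pf g -> pf (fun o e => f o (dcons (g o e) e)).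
Proof.
move=> hf hg; have h := @pf_comp f (dcons g (fun n o e => e n)) hf _.
apply: (pf_ext (h _)) => [[|n]|o e] //; first exact: pf_var.
by congr f; apply: funext => -[].
Qed.

(** If the values of [F] on the prefixes of the argument respect the bound, truncation never acts
    and the recursion equations determine the result. *)
Lemma pf_rec (F : (word -> bool) -> env -> word -> word) fx fi (h : bool -> ofun) bd :
  pf fx -> pf fi -> (forall b, pf (h b)) -> pf bd ->
  (forall o e, F o e [::] = fi o e) ->
  (forall o e x b, F o e (rcons x b) = h b o (dcons (F o e x) (dcons x e))) ->
  (forall o e x, prefix x (fx o e) -> size (F o e x) <= size (bd o e)) ->
  pf (fun o e => F o e (fx o e)).
Proof.
move=> [px hx] [pi hi] hh [pb hb] F0 FS Fb.
have [p0 h0] := hh false; have [p1 h1] := hh true.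
exists (PRec px pi p0 p1 pb) => o e /=; rewrite hx hi hb.
have -> : take (size (bd o e)) (fi o e) = F o e [::].
  by rewrite F0 take_oversize // -F0; apply: Fb; apply: prefix0s.
suff key y x : prefix (x ++ y) (fx o e) -> recw (fun b s pre => ev (if b then p1 else p0) o
    (dcons s (dcons pre e))) (size (bd o e)) (F o e x) x y = F o e (x ++ y).
  by rewrite key // prefix_refl.
elim: y x => [|b y IH] x; first by rewrite cats0.
rewrite -cat_rcons => pxy /=; have pr : prefix (rcons x b) (fx o e).
  exact: prefix_trans (prefix_prefix _ _) pxy.
rewrite -(IH _ pxy); congr recw; rewrite take_oversize.
  by rewrite FS; case: b {pxy pr}; rewrite ?h0 ?h1.
have -> : ev (if b then p1 else p0) o (dcons (F o e x) (dcons x e)) = F o e (rcons x b).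
  by rewrite FS; case: b {pxy pr}; rewrite ?h0 ?h1.
exact: Fb.
Qed.

Definition ind (Q : (word -> bool) -> env -> Prop) : ofun :=
  fun o e => if `[< Q o e >] then [:: true] else [::].
Definition pfp (Q : (word -> bool) -> env -> Prop) : Prop := pf (ind Q).

Lemma pfp_ext P Q : pfp P -> (forall o e, P o e <-> Q o e) -> pfp Q.
Proof.
by move=> h PQ; apply: (pf_ext h) => o e; rewrite /ind (asbool_equiv_eq (PQ o e)).
Qed.

(** The characteristic word has at most one letter, so a recursion over it makes zero or one
    round. *)
Lemma pf_if Q f g : pfp Q -> pf f -> pf g ->
  pf (fun o e => if `[< Q o e >] then f o e else g o e).
Proof.
move=> hQ hf hg.
pose F (o : word -> bool) (e : env) (x : word) := if x is [::] then g o e else f o e.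
have H : pf (fun o e => F o e (ind Q o e)).
  apply: (@pf_rec F (ind Q) g (fun b o e => f o (fun n => e n.+2))
    (fun o e => f o e ++ g o e)) => //.
  - by move=> _; apply: pf_ren.
  - exact: pf_cat.
  - by move=> o e [].
  - by move=> o e [|b x] _; rewrite size_cat ?leq_addl ?leq_addr.
by apply: (pf_ext H) => o e; rewrite /ind; case: asboolP.
Qed.

Lemma pfp_not Q : pfp Q -> pfp (fun o e => ~ Q o e).
Proof.
move=> h; apply: (pf_ext (pf_if h pf_nil (pf_bit true))) => o e; rewrite /ind.
by do 2 case: asboolP.
Qed.

Lemma pfp_and P Q : pfp P -> pfp Q -> pfp (fun o e => P o e /\ Q o e).
Proof.
move=> hP hQ; apply: (pf_ext (pf_if hP hQ pf_nil)) => o e; rewrite /ind.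
case: (asboolP (P o e)) => p; last by rewrite asboolF //; tauto.
case: (asboolP (Q o e)) => q; first by rewrite asboolT.
by rewrite asboolF //; tauto.
Qed.

Lemma pfp_or P Q : pfp P -> pfp Q -> pfp (fun o e => P o e \/ Q o e).
Proof.
move=> hP hQ; apply: (pfp_ext (pfp_not (pfp_and (pfp_not hP) (pfp_not hQ)))) => o e.
split; last by tauto.
by move=> h; apply: contrapT => h'; apply: h; split=> ?; apply: h'; [left|right].
Qed.

Lemma pfp_imp P Q : pfp P -> pfp Q -> pfp (fun o e => P o e -> Q o e).
Proof.
move=> hP hQ; apply: (pfp_ext (pfp_or (pfp_not hP) hQ)) => o e; split; first by tauto.
by move=> h; case: (pselect (P o e)) => [/h|]; [right|left].
Qed.

Lemma pfp_nonempty f : pf f -> pfp (fun o e => f o e <> [::]).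
Proof.
pose F (o : word -> bool) (e : env) (x : word) := if x is [::] then [::] else [:: true].
move=> hf; have H : pf (fun o e => F o e (f o e)).
  apply: (@pf_rec F f (fun o e => [::]) (fun b o e => [:: true]) (fun o e => [:: true])) => //.
  - exact: pf_nil.
  - by move=> _; apply: pf_bit.
  - exact: pf_bit.
  - by move=> o e [].
  - by move=> o e [].
apply: (pf_ext H) => o e; rewrite /ind; case: (f o e) => [|b x] /=; last by rewrite asboolT.
by rewrite asboolF // => /(_ erefl).
Qed.

Lemma asbool_nonempty (s : word) : `[< s <> [::] >] = (s != [::]).
Proof.
by case: (eqVneq s [::]) => [->|/eqP h]; [rewrite asboolF // => /(_ erefl)|rewrite asboolT].
Qed.

Lemma pfp_last b f : pf f -> pfp (fun o e => exists x, f o e = rcons x b).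
Proof.
pose F (o : word -> bool) (e : env) (x : word) :=
  if `[< exists y, x = rcons y b >] then [:: true] else [::].
move=> hf; apply: (@pf_rec F f (fun o e => [::])
  (fun c o e => if c == b then [:: true] else [::]) (fun o e => [:: true])) => //.
- exact: pf_nil.
- by move=> c; case: eqP => _; [apply: pf_bit|apply: pf_nil].
- exact: pf_bit.
- by move=> o e; rewrite /F; case: asboolP => // -[[]].
- move=> o e x c; rewrite /F; case: asboolP => [[y /rcons_inj[_ ->]]|h]; first by rewrite eqxx.
  by case: eqP => // ec; case: h; exists x; rewrite ec.
- by move=> o e x _; rewrite /F; case: ifP.
Qed.

Lemma pf_pred f : pf f -> pf (fun o e => take (size (f o e)).-1 (f o e)).
Proof.
move=> hf; apply: (@pf_rec (fun o e x => take (size x).-1 x) f (fun o e => [::])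
  (fun c o e => e 1) f) => //.
- exact: pf_nil.
- by move=> _; apply: pf_var.
- by move=> o e x b; rewrite size_rcons /= -cats1 take_size_cat.
- by move=> o e x /size_prefix h; apply: leq_trans h; rewrite size_takel leq_pred.
Qed.

(** Each letter of [g] removes the last letter of [f]. This is subtraction of lengths: emptiness of
    the result compares two lengths, and applying it twice gives [take]. *)
Lemma pf_chop f g : pf f -> pf g -> pf (fun o e => take (size (f o e) - size (g o e)) (f o e)).
Proof.
move=> hf hg; apply: (@pf_rec (fun o e x => take (size (f o e) - size x) (f o e)) g f
  (fun c o e => take (size (e 0)).-1 (e 0)) f) => //.
- by move=> _; apply: pf_pred (pf_var 0).
- by move=> o e; rewrite subn0 take_size.
- move=> o e x b; rewrite size_rcons subnS /= size_takel ?leq_subr // take_takel //.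
  exact: leq_pred.
- by move=> o e x _; rewrite size_takel ?leq_subr.
Qed.

Lemma pfp_size_le f g : pf f -> pf g -> pfp (fun o e => size (f o e) <= size (g o e)).
Proof.
move=> hf hg; apply: (pfp_ext (pfp_not (pfp_nonempty (pf_chop hf hg)))) => o e.
rewrite -subn_eq0; split=> [h|/eqP->]; last by rewrite take0.
have : take (size (f o e) - size (g o e)) (f o e) = [::] by apply: contrapT.
by move/(congr1 size); rewrite size_takel ?leq_subr // => ->.
Qed.

Lemma pf_take f g : pf f -> pf g -> pf (fun o e => take (size (g o e)) (f o e)).
Proof.
move=> hf hg; apply: (pf_ext (pf_chop hf (pf_chop hf hg))) => o e.
rewrite size_takel ?leq_subr //.
have [h|h] := leqP (size (f o e)) (size (g o e)); last by congr take; lia.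
by rewrite [RHS]take_oversize // take_oversize //; lia.
Qed.

Lemma pf_drop f g : pf f -> pf g -> pf (fun o e => drop (size (g o e)) (f o e)).
Proof.
move=> hf hg; apply: (@pf_rec (fun o e x => drop (size (g o e)) x) f (fun o e => [::])
  (fun c o e => if `[< size (g o (fun n => e n.+2)) <= size (e 1) >] then rcons (e 0) c else [::])
  f) => //.
- exact: pf_nil.
- move=> c; apply: pf_if; [|exact: pf_snoc (pf_var 0)|exact: pf_nil].
  exact: pfp_size_le (pf_ren _ hg) (pf_var 1).
- move=> o e x b /=; case: asboolP => h; first by rewrite drop_rcons.
  by rewrite drop_oversize // size_rcons ltnNge; apply/negP.
- by move=> o e x /size_prefix h; rewrite size_drop; apply: leq_trans (leq_subr _ _) h.
Qed.

Lemma pfp_prefix f g : pf f -> pf g -> pfp (fun o e => prefix (f o e) (g o e)).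
Proof.
move=> hf hg; apply: (@pf_rec (fun o e x => if `[< prefix x (g o e) >] then [:: true] else [::])
  f (fun o e => [:: true]) (fun c o e => if `[< e 0 <> [::] >] then
     ind (fun o e => exists y, take (size [:: true]) (drop (size (e 1)) (g o (fun n => e n.+2)))
        = rcons y c) o e else [::]) (fun o e => [:: true])) => //.
- exact: pf_bit.
- move=> c; apply: pf_if; [exact: pfp_nonempty (pf_var 0)| |exact: pf_nil].
  by apply: pfp_last; apply: pf_take (pf_bit _); apply: pf_drop (pf_var 1); apply: pf_ren.
- exact: pf_bit.
- by move=> o e; case: asboolP => //; rewrite prefix0s.
- move=> o e x b; rewrite -cats1.
  change ((if `[< prefix (x ++ [:: b]) (g o e) >] then [:: true] else [::]) =
    if `[< (if `[< prefix x (g o e) >] then [:: true] else [::]) <> [::] >] then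
      (if `[< exists y, take 1 (drop (size x) (g o e)) = rcons y b >] then [:: true] else [::])
    else [::]).
  have n1 : `[< ([::] : word) <> [::] >] = false by apply: asboolF => /(_ erefl).
  have n2 : `[< [:: true] <> [::] >] = true by apply: asboolT.
  set G := g o e; case: (asboolP (prefix x G)) => px; last first.
    rewrite n1.
    case: asboolP => // h; case: px; exact: prefix_trans (prefix_prefix _ _) h.
  rewrite n2; have [t ->] := prefixP px; rewrite drop_size_cat //.
  have key : prefix (x ++ [:: b]) (x ++ t) <-> exists y, take 1 t = rcons y b.
    rewrite prefix_nth take_size_cat // size_cat nth_cat ltnn subnn.
    case: t => [|d t] /=; first by rewrite addn0 ltnn; split=> [[_ []]|[[]]].
    rewrite take0 addnS ltnS leq_addr; split=> [[_ [_ <-]]|[[|c [|c' y]] // [<-]] //].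
    by exists [::].
  by rewrite (asbool_equiv_eq key).
- by move=> o e x _; case: ifP.
Qed.

Lemma pfp_eq f g : pf f -> pf g -> pfp (fun o e => f o e = g o e).
Proof.
move=> hf hg; apply: (pfp_ext (pfp_and (pfp_prefix hf hg) (pfp_prefix hg hf))) => o e.
split=> [[/prefixP[s es] /size_prefix]|->]; last by rewrite prefix_refl.
by rewrite es size_cat; case: s {es} => [|b s] /=; [rewrite cats0|lia].
Qed.

Lemma pfp_flip f : pf f -> pfp (fun o e => o (f o e) = true).
Proof.
move=> hf; apply: (pfp_ext (pfp_last true (pf_ask hf))) => o e; split=> [[x]|->]; last by exists [::].
by case: x => [|? []] //= [].
Qed.

(** * Search for witnesses of subword quantifiers *)

Section Search.
Variables (Q : (word -> bool) -> env -> Prop) (t : ofun).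
Hypotheses (hQ : pfp Q) (ht : pf t).

(** Finds the shortest prefix of [rev y] with the property. The leading [true] tells the empty
    prefix from failure, and the reversal lets structural recursion drop the last letter of the word
    searched. *)
Fixpoint searchr (o : word -> bool) (e : env) (y : word) : word :=
  let here := if `[< Q o (dcons (rev y) e) >] then true :: rev y else [::] in
  if y is b :: y' then let s := searchr o e y' in if s is [::] then here else s else here.

Lemma pf_search : exists2 s, pf s & forall o e w, prefix w (t o e) -> Q o (dcons w e) ->
  prefix (s o e) (t o e) /\ Q o (dcons (s o e) e).
Proof.
exists (fun o e => drop (size [:: true]) (searchr o e (rev (t o e)))).
  apply: pf_drop (pf_bit _); apply: (@pf_rec (fun o e x => searchr o e (rev x)) t
    (fun o e => if `[< Q o (dcons [::] e) >] then [:: true] else [::])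
    (fun b o e => if `[< e 0 <> [::] >] then e 0 else
      if `[< Q o (dcons (rcons (e 1) b) (fun n => e n.+2)) >] then [:: true] ++ rcons (e 1) b
      else [::]) (fun o e => [:: true] ++ t o e)) => //.
  - exact: (pf_app hQ pf_nil).
  - have hr b : pf (fun o e => rcons (e 1) b) by exact: pf_snoc (pf_var 1).
    move=> b; apply: pf_if; [exact: pfp_nonempty (pf_var 0)|exact: pf_var|].
    apply: pf_if; [|exact: pf_cat (pf_bit _) (hr b)|exact: pf_nil].
    pose g i : ofun := if i is j.+1 then fun o e => e j.+2 else fun o e => rcons (e 1) b.
    have H := @pf_comp _ g hQ _; apply: (pf_ext (H _)); first by case=> [|i]; [exact: hr|exact: pf_var].
    by move=> o e; congr ind; apply: funext => -[].
  - exact: pf_cat (pf_bit _) ht.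
  - move=> o e x b; rewrite rev_rcons /= rev_cons revK.
    by rewrite asbool_nonempty; case: (searchr o e (rev x)).
  - move=> o e x /size_prefix; rewrite size_cat /= => h.
    suff k : size (searchr o e (rev x)) <= (size x).+1 by apply: leq_trans k _.
    rewrite -(size_rev x); elim: (rev x) => [|b y IH] /=; first by case: ifP.
    case: (searchr o e y) IH => [_|c s] /=; last by lia.
    by case: ifP => //= _; rewrite size_rev.
have P1 o e y : forall c s, searchr o e y = c :: s -> prefix s (rev y) /\ Q o (dcons s e).
  elim: y => [|b y IH] c s /=; first by case: asboolP => // h [_ <-].
  case: (searchr o e y) IH => [_|c' s' IH [_ <-]].
    by case: asboolP => // h [_ <-]; split=> //; apply: prefix_refl.
  have [h1 h2] := IH _ _ erefl; split=> //; rewrite rev_cons -cats1.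
  exact: prefix_trans h1 (prefix_prefix _ _).
have P2 o e y w : searchr o e y = [::] -> prefix w (rev y) -> ~ Q o (dcons w e).
  elim: y => [|b y IH] /=; first by case: asboolP => // h _; case: w.
  case: (searchr o e y) IH => [IH|//]; case: asboolP => // h _.
  by rewrite rev_cons -cats1 prefix_cat1 => /orP[/IH|/eqP->]; [apply|rewrite cats1 -rev_cons].
move=> o e w pw qw; case E: (searchr o e (rev (t o e))) => [|c s].
  by have := P2 _ _ _ w E; rewrite revK => /(_ pw).
by have := P1 _ _ _ _ _ E; rewrite revK /= drop0.
Qed.

End Search.

(** A subword is what remains of a prefix wx after a prefix w of it: one search runs over the
    prefixes of [t], and its test is itself a search. *)
Lemma pf_search_subword Q t : pfp Q -> pf t -> exists sx sw,
  [/\ pf sx, pf sw & forall o e x w, prefix w (t o e) -> prefix (w ++ x) (t o e) ->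
   Q o (dcons x e) -> [/\ prefix (sw o e) (t o e), prefix (sw o e ++ sx o e) (t o e) &
     Q o (dcons (sx o e) e)]].
Proof.
move=> hQ ht.
pose Q1 o (e : env) := Q o (dcons (drop (size (e 0)) (e 1)) (fun n => e n.+2)).
have hQ1 : pfp Q1.
  pose g i : ofun := if i is j.+1 then fun o e => e j.+2 else fun o e => drop (size (e 0)) (e 1).
  have H := @pf_comp _ g hQ _; apply: (pf_ext (H _)).
    by case=> [|i]; [exact: pf_drop (pf_var 1) (pf_var 0)|exact: pf_var].
  by move=> o e; congr ind; apply: funext => -[].
have [s1 hs1 s1P] := pf_search hQ1 (pf_var 0).
pose Q2 o (e : env) := prefix (s1 o e) (e 0) /\ Q1 o (dcons (s1 o e) e).
have hQ2 : pfp Q2 by apply: pfp_and (pf_app hQ1 hs1); apply: pfp_prefix hs1 (pf_var 0).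
have [s2 hs2 s2P] := pf_search hQ2 ht.
pose sw o e := s1 o (dcons (s2 o e) e); pose sx o e := drop (size (sw o e)) (s2 o e).
have hsw : pf sw by exact: pf_app hs1 hs2.
exists sx, sw; split=> //; first exact: pf_drop.
move=> o e x w pw pwx qx.
have q1 : Q1 o (dcons w (dcons (w ++ x) e)) by rewrite /Q1 /= drop_size_cat.
have [||h1 [h2 h3]] := s2P o e (w ++ x) => //.
  by apply: s1P q1; apply: prefix_prefix.
have e2 : sw o e ++ sx o e = s2 o e.
  rewrite /sx; have /prefixP[z ez] := h2; rewrite /= in ez.
  by rewrite ez -/(sw o e) drop_size_cat.
by split; [apply: prefix_trans h2 h1|rewrite e2|].
Qed.

Lemma pf_term t : pf (fun o e => teval e t).
Proof.
elim: t => [n||||t1 h1 t2 h2|t1 h1 t2 h2] /=;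
  [exact: pf_var|exact: pf_nil|exact: pf_bit|exact: pf_bit|exact: pf_cat|exact: pf_times].
Qed.

Lemma sat_ExSWP o r t F : sat o r (fExSW t F) <-> exists x w,
  [/\ prefix w (teval r t), prefix (w ++ x) (teval r t) & sat o (dcons x r) F].
Proof.
rewrite sat_std ssat_ExSW dval_std.
by split=> -[x [w [h1 h2 h3]]]; exists x, w; split=> //; move: h3; rewrite -sat_std.
Qed.

Lemma sat_AllSWP o r t F : sat o r (fAllSW t F) <-> ~ sat o r (fExSW t (fNot F)).
Proof.
rewrite sat_std ssat_AllSW sat_ExSWP dval_std; split=> [h [x [w [h1 h2 h3]]]|h x [w [h1 h2]]].
  have := h x (ex_intro _ w (conj h1 h2)); rewrite -sat_std => h4; exact: (h3 h4).
apply: contrapT => h3; apply: h; exists x, w; split=> // h4; apply: h3.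
by rewrite -sat_std.
Qed.

Lemma pf_subword F : subword_formula F -> pfp (fun o e => sat o e F).
Proof.
elim=> {F} [t|t s|t s|F _ IH|F G _ IHF _ IHG|F G _ IHF _ IHG|t F _ IH|t F _ IH].
- exact: pfp_flip (pf_term t).
- exact: pfp_eq (pf_term t) (pf_term s).
- exact: pfp_prefix (pf_term t) (pf_term s).
- exact: pfp_not IH.
- exact: pfp_and IHF IHG.
- exact: pfp_or IHF IHG.
- have H G : pfp (fun o e => sat o e G) -> pfp (fun o e => sat o e (fExSW t G)).
    move=> hG; have [sx [sw [hx hw hP]]] := pf_search_subword hG (pf_term t).
    apply: (@pfp_ext (fun o e => (prefix (sw o e) (teval e t) /\
      prefix (sw o e ++ sx o e) (teval e t)) /\ sat o (dcons (sx o e) e) G)).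
      apply: pfp_and (pf_app hG hx); apply: pfp_and; first exact: pfp_prefix hw (pf_term t).
      exact: pfp_prefix (pf_cat hw hx) (pf_term t).
    move=> o e; rewrite sat_ExSWP; split=> [[[h1 h2] h3]|[x [w [h1 h2 h3]]]].
      by exists (sx o e), (sw o e).
    by have [] := hP o e x w h1 h2 h3.
  exact: H.
- have H G : pfp (fun o e => sat o e G) -> pfp (fun o e => sat o e (fExSW t G)).
    move=> hG; have [sx [sw [hx hw hP]]] := pf_search_subword hG (pf_term t).
    apply: (@pfp_ext (fun o e => (prefix (sw o e) (teval e t) /\
      prefix (sw o e ++ sx o e) (teval e t)) /\ sat o (dcons (sx o e) e) G)).
      apply: pfp_and (pf_app hG hx); apply: pfp_and; first exact: pfp_prefix hw (pf_term t).
      exact: pfp_prefix (pf_cat hw hx) (pf_term t).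
    move=> o e; rewrite sat_ExSWP; split=> [[[h1 h2] h3]|[x [w [h1 h2 h3]]]].
      by exists (sx o e), (sw o e).
    by have [] := hP o e x w h1 h2 h3.
  apply: (pfp_ext (pfp_not (H (fNot F) (pfp_not IH)))) => o e.
  by rewrite sat_AllSWP.
Qed.

(* Pairs: the length of the first component is written in unary, followed by a zero. *)
Definition pair2 (u v : word) : word := wtimes [:: true] u ++ [:: false] ++ u ++ v.
Definition lead (p : word) : word := nseq (find negb p) true.
Definition fst2 (p : word) : word := take (size (lead p)) (drop (size (rcons (lead p) true)) p).
Definition snd2 (p : word) : word := drop (size (lead p)) (drop (size (rcons (lead p) true)) p).

Lemma lead_pair u v : lead (pair2 u v) = nseq (size u) true.
Proof.
by rewrite /lead /pair2 wtimes1 find_cat has_nseq andbF size_nseq /= addn0.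
Qed.

Lemma fst_pair u v : fst2 (pair2 u v) = u.
Proof.
rewrite /fst2 lead_pair size_rcons size_nseq /pair2 wtimes1 -cat_rcons.
by rewrite drop_size_cat ?size_rcons ?size_nseq // take_size_cat.
Qed.

Lemma snd_pair u v : snd2 (pair2 u v) = v.
Proof.
rewrite /snd2 lead_pair size_rcons size_nseq /pair2 wtimes1 -cat_rcons.
by rewrite drop_size_cat ?size_rcons ?size_nseq // drop_size_cat.
Qed.

Lemma size_pair2 u v : size (pair2 u v) = (size u + size u + size v).+1.
Proof. by rewrite /pair2 wtimes1 !size_cat size_nseq /=; lia. Qed.

Lemma pf_pair f g : pf f -> pf g -> pf (fun o e => pair2 (f o e) (g o e)).
Proof.
move=> hf hg; apply: pf_cat (pf_times (pf_bit _) hf) _.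
exact: pf_cat (pf_bit _) (pf_cat hf hg).
Qed.

Lemma pf_lead f : pf f -> pf (fun o e => lead (f o e)).
Proof.
move=> hf; apply: (@pf_rec (fun o e x => lead x) f (fun o e => [::])
  (* The state is as long as the part read exactly when all the letters so far were ones. *)
  (fun b o e => if `[< size (e 1) <= size (e 0) >] then (if b then rcons (e 0) true else e 0) else e 0)
  f) => //.
- exact: pf_nil.
- move=> b; apply: pf_if; [exact: pfp_size_le (pf_var 1) (pf_var 0)| |exact: pf_var].
  by case: b; [apply: pf_snoc (pf_var 0)|apply: pf_var].
- move=> o e x b /=; rewrite /lead -cats1 find_cat size_nseq.
  case: (boolP (has negb x)) => hx; last first.
    rewrite (hasNfind hx) asboolT //=; case: b => /=; last by rewrite addn0.
    by rewrite addn1 -[RHS]cats1 -[[:: true]]/(nseq 1 true) -nseqD addn1.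
  by rewrite has_find in hx; rewrite asboolF // => h; move: hx; rewrite ltnNge h.
- move=> o e x /size_prefix h; rewrite size_nseq; exact: leq_trans (find_size _ _) h.
Qed.

Lemma pf_fst f : pf f -> pf (fun o e => fst2 (f o e)).
Proof.
move=> hf; have hl := pf_lead hf.
exact: pf_take (pf_drop hf (pf_snoc true hl)) hl.
Qed.

Lemma pf_snd f : pf f -> pf (fun o e => snd2 (f o e)).
Proof.
move=> hf; have hl := pf_lead hf.
exact: pf_drop (pf_drop hf (pf_snoc true hl)) hl.
Qed.

(** * Conditional probabilities of events on finitely many coins *)

Section CoinEvents.
Local Open Scope classical_set_scope.
Local Open Scope ring_scope.
Variable R : realType.
Let mu := coin_measure R.
Definition log := seq (word * bool).

Definition ext (l : log) : set oracle := [set o : oracle | all (fun qb => o qb.1 == qb.2) l].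

(** Openness in the product topology. *)
Definition continuous_event (A : set oracle) := forall o : oracle, A o ->
  exists S : seq word, forall o' : oracle, (forall s, s \in S -> o' s = o s) -> A o'.

Lemma measurable_bit q b : measurable [set o : oracle | o q = b].
Proof. by apply: sub_sigma_algebra; exists q, b. Qed.

Lemma measurable_ext l : measurable (ext l).
Proof.
elim: l => [|[q b] l IH].
  by rewrite (_ : ext [::] = setT) //; apply/seteqP; split.
rewrite (_ : ext _ = [set o : oracle | o q = b] `&` ext l).
  by apply: measurableI => //; apply: measurable_bit.
by apply/seteqP; split=> o /=; [move=> /andP[/eqP]|move=> [<- h]; apply/andP].
Qed.

(** There are countably many logs, and an open event is the union of the events [ext l] that it
    contains. *)
Lemma measurable_continuous A : continuous_event A -> measurable A.
Proof.
move=> cA; pose F n : set oracle := if unpickle n is Some l then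
  (if `[< ext l `<=` A >] then ext l else set0) else set0.
rewrite (_ : A = \bigcup_n F n).
  apply: bigcupT_measurable => n; rewrite /F; case: unpickle => [l|] //.
  by case: ifP => // _; apply: measurable_ext.
apply/seteqP; split=> o.
  move=> Ao; have [S hS] := cA o Ao.
  pose l : log := [seq (s, o s) | s <- S].
  exists (pickle l) => //; rewrite /F pickleK asboolT; first by apply/allP => _ /mapP[s sS ->] /=.
  move=> o' /allP h; apply: hS => s sS.
  by have /eqP := h (s, o s) (map_f (fun s => (s, o s)) sS).
move=> [n _]; rewrite /F; case: unpickle => [l|] //.
by case: asboolP => // h /h.
Qed.

(** The conditional probability of [A] given the log: [ext l] has measure 2^-|l| when the queries of
    [l] are distinct. *)
Definition cp (l : log) (A : set oracle) : R := fine (mu (ext l `&` A)) * 2 ^+ size l.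

Lemma mu_fin A : measurable A -> mu A \is a fin_num.
Proof. by move=> mA; apply: fin_num_measure. Qed.

Lemma cp_split l q A : measurable A ->
  cp l A = (cp ((q, false) :: l) A + cp ((q, true) :: l) A) / 2.
Proof.
have s2 b : 2 ^+ size ((q, b) :: l) = 2 * 2 ^+ size l :> R by rewrite -exprS.
move=> mA; rewrite /cp !s2; set B := ext l `&` A.
have mB : measurable B by apply: measurableI => //; apply: measurable_ext.
have E b : ext ((q, b) :: l) `&` A = B `&` [set o : oracle | o q = b].
  apply/seteqP; split=> o; rewrite /B /=; first by case=> /andP[/eqP].
  by move=> [[lo ao] e]; split=> //; apply/andP; split=> //; apply/eqP.
rewrite !E; have mb b : measurable (B `&` [set o : oracle | o q = b]).
  by apply: measurableI => //; apply: measurable_bit.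
have -> : mu B = (mu (B `&` [set o : oracle | o q = false]) +
    mu (B `&` [set o : oracle | o q = true]))%E.
  rewrite -measureU //.
    congr (mu _); rewrite -setIUr; apply/seteqP; split=> o; last by case.
    by move=> Bo; split=> //=; case: (o q); [right|left].
  by apply/seteqP; split=> o //= [[_ ->] []].
by rewrite fineD ?mu_fin //; field.
Qed.

Lemma log_inj (l : log) q b c : uniq (map fst l) -> (q, b) \in l -> (q, c) \in l -> b = c.
Proof.
elim: l => //= -[q' b'] l IH /andP[ql ul]; rewrite !inE.
have nl d : (q', d) \in l -> False by move=> h; move/negP: ql; apply; apply/mapP; exists (q', d).
move=> /orP[/eqP[e1 e2]|h1] /orP[/eqP[e3 e4]|h2].
- by rewrite e2 e4.
- by rewrite e1 in h2; case: (nl _ h2).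
- by rewrite e3 in h1; case: (nl _ h1).
- exact: IH.
Qed.

Lemma mu_ext l : uniq (map fst l) -> mu (ext l) = (2 ^- size l)%:E.
Proof.
move=> ul; rewrite -(size_map fst) -(coin_measure_cylinder R (fun s => (s, true) \in l) ul).
congr (mu _); apply/seteqP; split=> o /=.
  move=> /allP h s /mapP[[q b] ql ->] /=; have /eqP /= -> := h _ ql.
  by case: b ql => ql; [rewrite ql|apply/esym/negP => /(log_inj ul ql)].
move=> h; apply/allP => -[q b] ql /=; rewrite h; last by apply/mapP; exists (q, b).
by case: b ql => ql; [rewrite ql|apply/eqP/negP => /(log_inj ul ql)].
Qed.

Lemma cp_sure l A : uniq (map fst l) -> ext l `<=` A -> cp l A = 1.
Proof.
move=> ul lA; rewrite /cp (_ : ext l `&` A = ext l); last exact/setIidPl.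
by rewrite mu_ext //= mulVf // expf_neq0.
Qed.

Lemma cp_null l A : (forall o, ext l o -> ~ A o) -> cp l A = 0.
Proof.
move=> lA; rewrite /cp (_ : ext l `&` A = set0) ?measure0 ?mul0r //.
by apply/seteqP; split=> o // [] /lA.
Qed.

Lemma cp_eq l A B : (forall o, ext l o -> A o <-> B o) -> cp l A = cp l B.
Proof.
move=> h; rewrite /cp; congr (fine (mu _) * _).
by apply/seteqP; split=> o [lo]; move=> /(h o lo).
Qed.

Lemma cp_nil A : cp [::] A = fine (mu A).
Proof.
rewrite /cp expr0 mulr1; congr (fine (mu _)).
by apply/seteqP; split=> o // [].
Qed.

(** The uniform probability on [n] bits, in a recursive form that follows a run coin by coin. *)
Fixpoint bits_prob (n : nat) (phi : seq bool -> bool) : R :=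
  if n is m.+1 then
    (bits_prob m (fun s => phi (false :: s)) + bits_prob m (fun s => phi (true :: s))) / 2
  else (phi [::])%:R.

Lemma bits_prob_count n (phi : seq bool -> bool) :
  #|[pred s : n.-tuple bool | phi s]|%:R = bits_prob n phi * 2 ^+ n.
Proof.
elim: n phi => [|n IH] phi.
  rewrite expr0 mulr1 /=; case h: (phi [::]).
    rewrite (eq_card (B := predT)); first by rewrite card_tuple.
    by move=> s; rewrite !inE (tuple0 s) /= h.
  by rewrite eq_card0 // => s; rewrite !inE (tuple0 s) /= h.
have -> : #|[pred s : n.+1.-tuple bool | phi s]| =
    (#|[pred s : n.-tuple bool | phi (false :: s)]| +
     #|[pred s : n.-tuple bool | phi (true :: s)]|)%N.
  rewrite -!sum1_card.
  rewrite (reindex (fun p : bool * n.-tuple bool => [tuple of p.1 :: p.2])) /=; last first.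
    exists (fun s : n.+1.-tuple bool => (thead s, [tuple of behead s])) => [[b s] _|s _] /=.
      by rewrite theadE; congr pair; apply: val_inj.
    by rewrite [RHS]tuple_eta.
  rewrite (eq_bigl (fun p : bool * n.-tuple bool => true && phi (p.1 :: p.2))) //.
  rewrite -(pair_big_dep xpredT (fun b (s : n.-tuple bool) => phi (b :: s)) (fun _ _ => 1%N)) /=.
  by rewrite big_bool addnC.
rewrite natrD (IH (fun s => phi (false :: s))) (IH (fun s => phi (true :: s))) /= exprS.
by field.
Qed.

Lemma mu_bits (S : seq word) (phi : seq bool -> bool) : uniq S ->
  fine (mu [set o : oracle | phi (map o S)]) = bits_prob (size S) phi.
Proof.
move=> uS; rewrite -cp_nil.
have meas (T : seq word) (psi : seq bool -> bool) : measurable [set o : oracle | psi (map o T)].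
  apply: measurable_continuous => o /= h; exists T => o' ho'.
  by rewrite (_ : map o' T = map o T) //; apply/eq_in_map => s /ho'.
(* The induction needs an arbitrary log in place of the empty one: the words of [S] move into the
   log one after the other, and the conditional probability splits each time. *)
have : uniq (S ++ map fst ([::] : log)) by rewrite cats0.
elim: S {uS} [::] phi => [|s S IH] l phi ul /=.
  case h: (phi [::]); first by apply: cp_sure.
  exact: cp_null.
rewrite (cp_split l s (meas (s :: S) phi)).
have E b : cp ((s, b) :: l) [set o : oracle | phi (map o (s :: S))] =
    bits_prob (size S) (fun t => phi (b :: t)).
  rewrite -(IH ((s, b) :: l)); last first.
    have -> : S ++ map fst ((s, b) :: l) = S ++ [:: s] ++ map fst l by [].
    by rewrite uniq_catCA.
  by apply: cp_eq => o /= /andP[/eqP-> _].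
by rewrite !E.
Qed.

End CoinEvents.

(** * Stack programs *)

Definition store := nat -> seq bool.
Definition upd (st : store) (r : nat) (v : seq bool) : store :=
  fun s => if s == r then v else st s.

Inductive cmd : Type :=
| CSkip
| CPush (r : nat) (b : bool)
| CPop (r : nat)
| CSeq (c d : cmd)
| CIf (r : nat) (c1 c0 cE : cmd)
| CFor (r : nat) (c : cmd)
| CAsk (r d : nat)
| CFlip (r : nat).

Definition opush (B : nat) (st : store) (r : nat) (b : bool) : option store :=
  if size (st r) < B then Some (upd st r (b :: st r)) else None.

Definition loop (f : store -> option store) (r : nat) :=
  fix go (n : nat) (st : store) : option store :=
    if n is m.+1 then obind (fun s => go m (upd s r (behead (s r)))) (f st) else Some st.

(* The execution fails when a stack would exceed the height B.  The head of a stack is its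
   top; a stack s represents the word rev s.  For r c executes c and pops r until r is
   empty. *)
Fixpoint exec (o : word -> bool) (B : nat) (c : cmd) (st : store) : option store :=
  match c with
  | CSkip => Some st
  | CPush r b => opush B st r b
  | CPop r => Some (upd st r (behead (st r)))
  | CSeq c d => obind (exec o B d) (exec o B c st)
  | CIf r c1 c0 cE =>
      match st r with
      | true :: _ => exec o B c1 st
      | false :: _ => exec o B c0 st
      | [::] => exec o B cE st
      end
  | CFor r c => if size (st r) <= B then loop (exec o B c) r (size (st r)) st else None
  | CAsk r d => if size (st r) <= B then opush B st d (o (rev (st r))) else None
  | CFlip r => None
  end.

Fixpoint writes (c : cmd) (r : nat) : bool :=
  match c with
  | CSkip => false
  | CPush s _ | CPop s | CAsk _ s | CFlip s => r == s
  | CSeq c d => writes c r || writes d r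
  | CIf _ c1 c0 cE => [|| writes c1 r, writes c0 r | writes cE r]
  | CFor s c => (r == s) || writes c r
  end.

(** A loop body must leave its counter alone, so that the number of rounds is the initial height of
    the counter. *)
Fixpoint wf (c : cmd) : bool :=
  match c with
  | CSeq c d => wf c && wf d
  | CIf _ c1 c0 cE => [&& wf c1, wf c0 & wf cE]
  | CFor r c => ~~ writes c r && wf c
  | _ => true
  end.

Fixpoint regs (c : cmd) : nat :=
  match c with
  | CSkip => 0
  | CPush r _ | CPop r | CFlip r => r.+1
  | CSeq c d => maxn (regs c) (regs d)
  | CIf r c1 c0 cE => maxn r.+1 (maxn (regs c1) (maxn (regs c0) (regs cE)))
  | CFor r c => maxn r.+1 (regs c)
  | CAsk r d => maxn r.+1 d.+1
  end.

Lemma updE st r v : upd st r v r = v.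
Proof. by rewrite /upd eqxx. Qed.

Lemma upd_neq st r v s : s <> r -> upd st r v s = st s.
Proof. by rewrite /upd; case: eqP. Qed.

Lemma exec_writes o B c st st' r : exec o B c st = Some st' -> ~~ writes c r -> st' r = st r.
Proof.
elim: c st st' => [|s b|s|c IHc d IHd|s c1 IH1 c0 IH0 cE IHE|s c IH|s d|s] st st' /=.
- by case=> ->.
- by rewrite /opush; case: ifP => // _ [<-] /eqP /upd_neq.
- by move=> [<-] /eqP /upd_neq.
- case e: (exec o B c st) => [s1|] //= h; rewrite negb_or => /andP[w1 w2].
  by rewrite (IHd _ _ h w2) (IHc _ _ e w1).
- rewrite !negb_or; case: (st s) => [|[] ?] h /and3P[w1 w0 wE].
  + exact: IHE h wE.
  + exact: IH1 h w1.
  + exact: IH0 h w0.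
- rewrite negb_or; case: ifP => // _ h /andP[/eqP rs w]; move: (size (st s)) h => n.
  elim: n st => [|n IHn] st /=; first by case=> ->.
  case e: (exec o B c st) => [s1|] //= /IHn ->.
  by rewrite upd_neq // (IH _ _ e w).
- by case: ifP => // _; rewrite /opush; case: ifP => // _ [<-] /eqP /upd_neq.
- by [].
Qed.

Definition runs (o : word -> bool) (B : nat) (c : cmd) (st st' : store) :=
  exec o B c st = Some st'.

Lemma runs_seq o B c d st s1 s2 : runs o B c st s1 -> runs o B d s1 s2 -> runs o B (CSeq c d) st s2.
Proof. by rewrite /runs /= => ->. Qed.

Lemma runs_for o B r c (n : nat) (S : nat -> store) : ~~ writes c r -> n <= B ->
  size (S 0 r) = n ->
  (forall i, i < n -> exists2 s, runs o B c (S i) s & upd s r (behead (s r)) = S i.+1) ->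
  runs o B (CFor r c) (S 0) (S n).
Proof.
move=> w nB sz h; rewrite /runs /= sz nB.
elim: n S {nB sz} h => [|n IH] S h //=.
have [s hs e] := h 0 (ltn0Sn _); rewrite [exec _ _ _ _]hs /= e.
by apply: (IH (fun i => S i.+1)) => i ni; apply: h.
Qed.

Definition CMove (r s : nat) := CFor r (CIf r (CPush s true) (CPush s false) CSkip).
Definition CClear (r : nat) := CFor r CSkip.
(* Appends the word in r to that in s, using the empty register t. *)
Definition CCopy (r s t : nat) := CSeq (CMove r t)
  (CFor t (CIf t (CSeq (CPush r true) (CPush s true)) (CSeq (CPush r false) (CPush s false)) CSkip)).

Lemma behead_drop (T : Type) n (s : seq T) : behead (drop n s) = drop n.+1 s.
Proof. by elim: n s => [|n IH] [|x s] //=; rewrite ?drop0. Qed.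

Lemma runs_clear o B r st : size (st r) <= B -> runs o B (CClear r) st (upd st r [::]).
Proof.
move=> sB; have := @runs_for o B r CSkip (size (st r)) (fun i => upd st r (drop i (st r))).
rewrite drop0 drop_size updE (_ : upd st r (st r) = st); last first.
  by apply: funext => s; rewrite /upd; case: eqP => // ->.
apply=> // i _; exists (upd st r (drop i (st r))) => //.
by rewrite updE behead_drop; apply: funext => s; rewrite /upd; case: eqP.
Qed.

Lemma runs_move o B r s st : r <> s -> size (st r) + size (st s) <= B ->
  runs o B (CMove r s) st (upd (upd st r [::]) s (rev (st r) ++ st s)).
Proof.
move=> rs sB.
have := @runs_for o B r (CIf r (CPush s true) (CPush s false) CSkip) (size (st r))
  (fun i => upd (upd st r (drop i (st r))) s (rev (take i (st r)) ++ st s)).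
rewrite drop0 drop_size take0 take_size upd_neq // updE (_ : upd (upd st r (st r)) s _ = st); last first.
  by apply: funext => k; rewrite /upd /=; case: eqP => [->//|_]; case: eqP => // ->.
apply=> //; [by rewrite /= !(negPf (introN eqP rs))|by lia|] => i ir.
set S := upd _ _ _; have Sr : S r = drop i (st r) by rewrite /S upd_neq // updE.
have Ss : S s = rev (take i (st r)) ++ st s by rewrite /S updE.
exists (upd S s (nth false (st r) i :: S s)).
  rewrite /runs /= Sr (drop_nth false) //.
  have sz : size (S s) < B by rewrite Ss size_cat size_rev size_takel ?(ltnW ir) //; lia.
  by case: (nth _ _ _); rewrite /opush sz.
apply: funext => k; rewrite /upd; case: (eqVneq k r) => [->|kr].
  by rewrite !(negPf (introN eqP rs)) ?eqxx Sr behead_drop.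
case: (eqVneq k s) => [_|ks]; last by rewrite /S /upd (negPf ks) (negPf kr).
by rewrite Ss (take_nth false) // rev_rcons.
Qed.

Lemma runs_copy o B r s t st : r <> s -> r <> t -> s <> t -> st t = [::] ->
  size (st r) + size (st s) <= B ->
  runs o B (CCopy r s t) st (upd st s (st r ++ st s)).
Proof.
move=> rs rt ts st0 sB.
apply: runs_seq (runs_move _ rt _) _; first by rewrite st0 /= addn0; lia.
rewrite st0 cats0; set S0 := upd _ _ _; pose w := rev (st r).
have sw : size w = size (st r) by rewrite size_rev.
have := @runs_for o B t (CIf t (CSeq (CPush r true) (CPush s true))
  (CSeq (CPush r false) (CPush s false)) CSkip) (size w)
  (fun i => upd (upd (upd st r (rev (take i w))) s (rev (take i w) ++ st s)) t (drop i w)).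
rewrite drop0 drop_size take0 take_size updE.
rewrite (_ : upd (upd (upd st r _) s _) t w = S0); last first.
  apply: funext => k; rewrite /S0 /upd; case: (k =P t) => // kt.
  case: (k =P s) => [ks|ks]; last by case: (k =P r).
  by rewrite ks (negPf (introN eqP (nesym rs))).
rewrite (_ : upd (upd (upd st r _) s _) t [::] = upd st s (st r ++ st s)); last first.
  apply: funext => k; rewrite /w revK /upd; case: (k =P t) => [kt|_].
    by rewrite kt (negPf (introN eqP (nesym ts))) st0.
  by case: (k =P s) => // _; case: (k =P r) => // kr; rewrite kr.
apply=> //.
- by rewrite /= !(negPf (introN eqP (nesym rt))) !(negPf (introN eqP (nesym ts))).
- by rewrite sw; lia.
move=> i iw; set S := upd _ _ _.
have St : S t = drop i w by rewrite /S updE.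
have Sr : S r = rev (take i w) by rewrite /S upd_neq // upd_neq // updE.
have Ss : S s = rev (take i w) ++ st s by rewrite /S upd_neq // updE.
pose b := nth false w i.
exists (upd (upd S r (b :: S r)) s (b :: S s)).
  have z1 : size (S r) < B by rewrite Sr size_rev size_takel ?(ltnW iw) //; lia.
  have z2 : size (S s) < B by rewrite Ss size_cat size_rev size_takel ?(ltnW iw) //; lia.
  have us v : upd S r v s = S s by rewrite upd_neq //; apply: nesym.
  rewrite /runs /= St (drop_nth false) // -/b.
  by case: b; rewrite /= /opush z1 /= us z2.
apply: funext => k; rewrite /upd; case: (eqVneq k t) => [_|kt].
  by rewrite !(negPf (introN eqP (nesym ts))) !(negPf (introN eqP (nesym rt))) St behead_drop.
case: (eqVneq k s) => [_|ks]; first by rewrite Ss (take_nth false) // rev_rcons.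
case: (eqVneq k r) => [_|kr]; first by rewrite Sr (take_nth false) // rev_rcons.
by rewrite /S /upd (negPf kt) (negPf ks) (negPf kr).
Qed.

(** * Witnessing by a Herbrand-saturated model *)

Definition opred := (word -> bool) -> env -> Prop.

(* A condition P stands for the sentence "for all z, P(z, c)" about the constants c: in P,
   variable 0 is z and variable i.+1 is the constant c_i.  The formula Q(c) is a consequence
   of S if it follows from finitely many instances of the conditions in S. *)
Definition ent (S : seq pexp) (Q : opred) : Prop :=
  exists zs : seq pexp, forall o c,
    (forall P z, List.In P S -> List.In z zs -> ev P o (dcons (ev z o c) c) <> [::]) -> Q o c.

Lemma ent_imp S P Q : ent S P -> (forall o c, P o c -> Q o c) -> ent S Q.
Proof. by move=> [zs h] PQ; exists zs => o c /h /PQ. Qed.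

Lemma ent_and S P Q : ent S P -> ent S Q -> ent S (fun o c => P o c /\ Q o c).
Proof.
move=> [zs h] [zs' h']; exists (zs ++ zs') => o c H; split.
  by apply: h => R z RS zz; apply: H => //; apply: List.in_or_app; left.
by apply: h' => R z RS zz; apply: H => //; apply: List.in_or_app; right.
Qed.

Lemma ent_weak S S' Q : List.incl S S' -> ent S Q -> ent S' Q.
Proof. by move=> i [zs h]; exists zs => o c H; apply: h => P z /i; apply: H. Qed.

(** Makes one function out of a finite Herbrand disjunction, by trying the candidates in order. *)
Lemma pf_first (Q : opred) (zs : seq pexp) (k : pexp -> ofun) : pfp Q ->
  (forall z, pf (k z)) -> exists2 f, pf f &
  forall o e, (exists2 z, List.In z zs & Q o (dcons (k z o e) e)) -> Q o (dcons (f o e) e).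
Proof.
move=> hQ hk; elim: zs => [|z zs [f hf IH]]; first by exists (fun _ _ => [::]) => [|o e [z []]]; exact: pf_nil.
exists (fun o e => if `[< Q o (dcons (k z o e) e) >] then k z o e else f o e).
  exact: pf_if (pf_app hQ (hk z)) (hk z) hf.
move=> o e [z' hz q]; case: asboolP => // nq; apply: IH; exists z' => //.
by case: hz => // ez; case: nq; rewrite ez.
Qed.

(** * The saturated model and its truth lemma *)

Section Saturation.
Variables (P0 : pexp) (en : nat -> pexp).
Hypothesis en_onto : forall p, exists n, en n = p.
Hypothesis P0_con : ~ ent [:: P0] (fun _ _ => False).

(* In psi, variable 0 is z, variable 1 is x and variable i.+2 is c_i; x becomes the fresh
   constant c_m. *)
Definition at_const (m : nat) (psi : pexp) : pexp :=
  pren (fun n => match n with 0 => 0 | 1 => m.+1 | i.+2 => i.+1 end) psi.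

Lemma ev_at_const m psi o z c :
  ev (at_const m psi) o (dcons z c) = ev psi o (dcons z (dcons (c m) c)).
Proof. by rewrite ev_ren; congr ev; apply: funext => -[|[|n]]. Qed.

Definition freshc (S : seq pexp) (p : pexp) := maxn (pbound p) (\max_(q <- S) pbound q).

(** A condition is added, at a fresh constant, whenever this is consistent. A rejected one is
    refuted by finitely many instances, and these finitely many candidates are what saturation
    exploits. *)
Fixpoint wstage (n : nat) : seq pexp :=
  if n is m.+1 then
    let p := at_const (freshc (wstage m) (en m)) (en m) in
    if `[< ent (p :: wstage m) (fun _ _ => False) >] then wstage m else p :: wstage m
  else [:: P0].

Lemma wstage_con n : ~ ent (wstage n) (fun _ _ => False).
Proof. by elim: n => //= n IH; case: asboolP. Qed.

Lemma wstage_incl m n : m <= n -> List.incl (wstage m) (wstage n).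
Proof.
move=> /subnKC <-; elim: (n - m) => [|k IH]; first by rewrite addn0.
by rewrite addnS /=; case: asboolP => _ // A /IH; right.
Qed.

Definition entW (Q : opred) := exists n, ent (wstage n) Q.

Lemma entW_imp (P Q : opred) : entW P -> (forall o c, P o c -> Q o c) -> entW Q.
Proof. by move=> [n h] PQ; exists n; apply: ent_imp h PQ. Qed.

Lemma entW_true (Q : opred) : (forall o c, Q o c) -> entW Q.
Proof. by move=> h; exists 0, [::]. Qed.

Lemma entW_and (P Q : opred) : entW P -> entW Q -> entW (fun o c => P o c /\ Q o c).
Proof.
move=> [m h] [n h']; exists (maxn m n); apply: ent_and; apply: ent_weak; first last.
- exact: h'.
- by apply: wstage_incl; apply: leq_maxr.
- exact: h.
- by apply: wstage_incl; apply: leq_maxl.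
Qed.

Lemma entW_imp2 (P P' Q : opred) : entW P -> entW P' ->
  (forall o c, P o c -> P' o c -> Q o c) -> entW Q.
Proof. by move=> h h' H; apply: entW_imp (entW_and h h') _ => o c []; apply: H. Qed.

Lemma entW_con (Q : opred) : entW Q -> entW (fun o c => ~ Q o c) -> False.
Proof.
move=> h h'; have [n] : entW (fun _ _ => False) by apply: entW_imp2 h h' _ => o c.
exact: wstage_con.
Qed.

Lemma entW_dec (Q : opred) : pfp Q -> entW Q \/ entW (fun o c => ~ Q o c).
Proof.
(* A condition that mentions neither z nor x amounts to [Q] itself, so that the enumeration decides
   it. *)
move=> [q hq]; have [n enq] := en_onto (pren (fun k => k.+2) q).
set p := at_const (freshc (wstage n) (en n)) (en n).
have pE o z c : ev p o (dcons z c) <> [::] <-> Q o c.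
  rewrite /p ev_at_const enq ev_ren /= hq /ind.
  by case: asboolP => // h; split=> // /(_ erefl).
have := erefl (wstage n.+1); rewrite [RHS]/= -/p; case: asboolP => [[zs h] _|h hs].
  right; exists n, zs => o c H q'; apply: (h o c) => P z [<-|i] iz; last exact: H.
  by apply/pE.
left; exists n.+1, [:: PNil] => o c; rewrite hs => /(_ p PNil).
by move=> H; apply/(pE o (ev PNil o c) c); apply: H; left.
Qed.

(** Consider psi at a fresh constant c. Had it been added as a condition, the hypothesis for [g] = c
    would contradict it. So finitely many instances refute it; c being fresh, any [g] may take its
    place, and the first instance at which psi fails is a uniform choice of [H]. *)
Lemma herbrand_witness (psi : pexp) :
  (forall g, exists h, entW (fun o c =>
     ev psi o (dcons (ev h o c) (dcons (ev g o c) c)) = [::])) ->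
  exists H, forall g, entW (fun o c =>
     ev psi o (dcons (ev H o (dcons (ev g o c) c)) (dcons (ev g o c) c)) = [::]).
Proof.
move=> hyp; have [n enq] := en_onto psi; set m := freshc (wstage n) psi.
have mpsi : pbound psi <= m by rewrite leq_maxl.
have mS p : List.In p (wstage n) -> pbound p <= m.
  rewrite /m /freshc; set G := wstage n => i; apply: leq_trans (leq_maxr _ _).
  elim: G i => //= q G IH; rewrite big_cons => -[->|/IH h]; first exact: leq_maxl.
  by apply: leq_trans h (leq_maxr _ _).
pose p := at_const m psi; have := erefl (wstage n.+1); rewrite [RHS]/= enq -/m -/p.
case: asboolP => [[zs h] _|h hs]; last first.
  have [k hk] := hyp (PVar m); case: (entW_con hk).
  exists n.+1, [:: k] => o c; rewrite hs => /(_ p k (or_introl erefl) (or_introl erefl)).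
  by rewrite /p ev_at_const.
pose repl (x : word) (c : env) : env := fun i => if i == m then x else c i.
pose k (z : pexp) : ofun := fun o e => ev z o (repl (e 0) (fun i => e i.+1)).
have hk z : pf (k z).
  apply: (pf_ext (@pf_comp (ev z) (fun i o e => if i == m then e 0 else e i.+1) (pf_ev z) _)) => //.
  by move=> i; case: eqP => _; apply: pf_var.
have hQ : pfp (fun o e => ev psi o e = [::]) by apply: pfp_eq (pf_ev _) pf_nil.
have [f [H hH] fP] := pf_first zs hQ hk.
exists H => g; exists n, [seq psubst (fun i => if i == m then g else PVar i) z | z <- zs] => o c hyps.
rewrite hH; set x := ev g o c; apply: fP.
pose c' := repl x c.
have ez z : ev (psubst (fun i => if i == m then g else PVar i) z) o c = ev z o c'.
  by rewrite ev_subst; congr ev; apply: funext => i; rewrite /c' /repl; case: eqP.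
(* With c read as [x], some instance fails. It does not belong to the stage, whose conditions are
   assumed and do not mention c, so it is an instance of psi. *)
have [P [z [PS zs1 e0]]] : exists P z, [/\ List.In P (p :: wstage n), List.In z zs &
    ev P o (dcons (ev z o c') c') = [::]].
  apply: contrapT => hn; apply: (h o c') => P z PS zz e0; apply: hn.
  by exists P, z.
exists z => //; rewrite /k /= -/c'.
case: PS => [eP|PS].
  move: e0; rewrite -eP /p ev_at_const (_ : c' m = x); last by rewrite /c' /repl eqxx.
  move=> <-; apply: (ev_ext (k := m)) => // -[|[|i]] //= im.
  by rewrite /c' /repl; case: eqP => // e; move: im; rewrite e ltnNge leqW // leqnSn.
case: (hyps P (psubst (fun i => if i == m then g else PVar i) z)) => //.
  by apply/List.in_map_iff; exists z.
rewrite ez -[RHS]e0; apply: (ev_ext (k := m)); first exact: mS.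
case=> [|i] //= im; rewrite /c' /repl; case: eqP => // e.
by move: im; rewrite e ltnNge leqnSn.
Qed.

Definition satm : structure :=
  @Structure pexp PNil (fun b => PSnoc b PNil) PCat PTimes
   (fun p q => entW (fun o c => ev p o c = ev q o c))
   (fun p q => entW (fun o c => prefix (ev p o c) (ev q o c)))
   (fun p => entW (fun o c => o (ev p o c) = true)).

Definition evs (r : nat -> pexp) (o : word -> bool) (c : env) : env := fun n => ev (r n) o c.

Lemma evs_dcons p r o c : evs (dcons p r) o c = dcons (ev p o c) (evs r o c).
Proof. by apply: funext => -[]. Qed.

Lemma ev_dval (r : nat -> satm) t o c : ev (dval r t) o c = teval (evs r o c) t.
Proof. by elim: t => //= t1 -> t2 ->. Qed.

Lemma satm_congruent : congruent satm.
Proof.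
split=> /=.
- by move=> x; apply: entW_true.
- by move=> x y h; apply: entW_imp h _.
- by move=> x y z h h'; apply: entW_imp2 h h' _ => o c -> ->.
- by move=> x x' y y' h h'; apply: entW_imp2 h h' _ => o c -> ->.
- by move=> x x' y y' h h'; apply: entW_imp2 h h' _ => o c -> ->.
- move=> x x' y y' h h' k; apply: entW_imp2 (entW_and h h') k _ => o c [-> ->] //.
- by move=> x x' h k; apply: entW_imp2 h k _ => o c ->.
Qed.

Lemma pfp_evs Q (r : nat -> pexp) : pfp Q -> pfp (fun o c => Q o (evs r o c)).
Proof. by move=> hQ; apply: (@pf_comp _ (fun n => ev (r n)) hQ) => n; apply: pf_ev. Qed.

Lemma pf_evs f (r : nat -> pexp) : pf f -> pf (fun o c => f o (evs r o c)).
Proof. by move=> hf; apply: (@pf_comp _ (fun n => ev (r n)) hf) => n; apply: pf_ev. Qed.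

(** Truth is entailment. A witness must be a single expression for all oracles and constants, which
    the search functions provide. *)
Lemma satm_subword F (r : nat -> satm) : subword_formula F ->
  ssat r F <-> entW (fun o c => sat o (evs r o c) F).
Proof.
have neg G (r' : nat -> satm) : subword_formula G ->
    entW (fun o c => ~ sat o (evs r' o c) G) <-> ~ entW (fun o c => sat o (evs r' o c) G).
  move=> hG; split=> [h h'|h]; first exact: entW_con h' h.
  by case: (entW_dec (pfp_evs r' (pf_subword hG))).
have exs t G (r' : nat -> satm) : subword_formula G ->
    (forall r'' : nat -> satm, ssat r'' G <-> entW (fun o c => sat o (evs r'' o c) G)) ->
    ssat r' (fExSW t G) <-> entW (fun o c => sat o (evs r' o c) (fExSW t G)).
  move=> hG IH; rewrite ssat_ExSW; split.
    move=> [x [w [/= h1 h2 /IH h3]]].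
    apply: entW_imp2 (entW_and h1 h2) h3 _ => o c [k1 k2] k3; apply/sat_ExSWP.
    by exists (ev x o c), (ev w o c); rewrite -evs_dcons -ev_dval.
  move=> h; have [sx [sw [hx hw hP]]] := pf_search_subword (pf_subword hG) (pf_term t).
  have [x ex] := pf_evs r' hx; have [w ew] := pf_evs r' hw.
  have {}h : entW (fun o c => [/\ prefix (ev w o c) (ev (dval r' t) o c),
      prefix (ev w o c ++ ev x o c) (ev (dval r' t) o c) &
      sat o (evs (dcons x r') o c) G]).
    apply: entW_imp h _ => o c /sat_ExSWP[x' [w' [k1 k2 k3]]].
    by rewrite evs_dcons ex ew ev_dval; apply: hP k1 k2 k3.
  exists x, w; split; first by apply: entW_imp h _ => o c [].
    by apply: entW_imp h _ => o c [].
  by apply/IH; apply: entW_imp h _ => o c [].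
move=> hF; elim: hF r => {F} [t|t s|t s|F hF IH|F G hF IHF hG IHG|F G hF IHF hG IHG|t F hF IH|t F hF IH] r.
- by rewrite /=; split=> h; apply: entW_imp h _ => o c; rewrite ev_dval.
- by rewrite /=; split=> h; apply: entW_imp h _ => o c; rewrite !ev_dval.
- by rewrite /=; split=> h; apply: entW_imp h _ => o c; rewrite !ev_dval.
- by rewrite /= IH (neg F r hF).
- rewrite /= IHF IHG; split=> [[h h']|h]; first exact: entW_and.
  by split; apply: entW_imp h _ => o c [].
- rewrite /= IHF IHG; split=> [[h|h]|h]; first by apply: entW_imp h _ => o c; left.
    by apply: entW_imp h _ => o c; right.
  case: (entW_dec (pfp_evs r (pf_subword hF))) => h'; first by left.
  by right; apply: entW_imp2 h h' _ => o c [].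
- exact: exs.
- have nF : forall r : nat -> satm, ssat r (fNot F) <-> entW (fun o c => sat o (evs r o c) (fNot F)).
    by move=> r'; rewrite /= IH (neg F r' hF).
  have E := exs t (fNot F) r (SW_Not hF) nF.
  have -> : ssat r (fAllSW t F) <-> ~ ssat r (fExSW t (fNot F)).
    rewrite ssat_AllSW ssat_ExSW; split=> [h [x [w [h1 h2 h3]]]|h x [w [h1 h2]]].
      by apply: h3; apply: h; exists w.
    by apply: contrapT => h3; apply: h; exists x, w.
  rewrite E -(neg (fExSW t (fNot F))); last exact: SW_Ex (SW_Not hF).
  split=> h; apply: entW_imp h _ => o c h'; first exact: (iffRL (sat_AllSWP _ _ _ _) h').
  exact: (iffLR (sat_AllSWP _ _ _ _) h').
Qed.

Lemma size_teval_mono (e e' : env) t : (forall n, size (e n) <= size (e' n)) ->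
  size (teval e t) <= size (teval e' t).
Proof.
move=> h; elim: t => //= t1 IH1 t2 IH2; first by rewrite !size_cat leq_add.
by rewrite !size_wtimes leq_mul.
Qed.

Lemma dconsS (u : word) (e : env) : (fun n => dcons u e n.+1) = e.
Proof. by apply: funext. Qed.

Lemma satm_le (r : nat -> satm) x t : ssat (dcons x r) (fLe (tVar 0) (tshift t)) <->
  entW (fun o c => size (ev x o c) <= size (teval (evs r o c) t)).
Proof.
rewrite [ssat _ _]/= dval_shift.
have E o c : prefix (ev (PTimes (PSnoc true PNil) x) o c)
    (ev (PTimes (PSnoc true PNil) (dval r t)) o c) = (size (ev x o c) <= size (teval (evs r o c) t)).
  by rewrite /= !wtimes1 prefix_nseq ev_dval.
by split=> h; apply: entW_imp h _ => o c; rewrite -E.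
Qed.

Lemma sat_fExB o e t F : sat o e (fExB t F) <->
  exists x, size x <= size (teval e t) /\ sat o (dcons x e) F.
Proof.
have E x : sat o (scons x e) (fAnd (fLe (tVar 0) (tshift t)) F) <->
    size x <= size (teval e t) /\ sat o (dcons x e) F.
  rewrite -(teval_tshift o e x t) -(satLe o (scons x e) (tVar 0)) -scons_dcons; exact: iff_refl.
by split=> -[x /E h]; exists x.
Qed.

End Saturation.

(** The block of bounded quantifiers is folded into one witness and a test [M] of the algebra, the
    same for the standard structures and the saturated models. The bound on the witness will bound
    the recursion in [satm_ind]. *)
Lemma satm_Sigma1b F : Sigma1b F -> exists (M : opred) (bt : term),
  [/\ pfp M, forall o u e, M o (dcons u e) -> size u <= size (teval e bt),
      forall o e, sat o e F <-> exists u, M o (dcons u e) &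
      forall P0 en, (forall p, exists n, en n = p) -> ~ ent [:: P0] (fun _ _ => False) ->
      forall r : nat -> satm P0 en, ssat r F <->
        exists u, entW P0 en (fun o c => M o (dcons (ev u o c) (evs r o c)))].
Proof.
elim=> {F} [F hF|t F _ [M [bt [hM Mb sM nM]]]].
  exists (fun o e => e 0 = [::] /\ sat o (fun n => e n.+1) F), tEps; split.
  - apply: pfp_and (pfp_eq (pf_var 0) pf_nil) _.
    exact: (@pf_ren (ind (fun o e => sat o e F)) (fun n => n.+1)) (pf_subword hF).
  - by move=> o u e [/= ->].
  - by move=> o e; split=> [h|[u []]] //; exists [::].
  - move=> P0 en e1 e2 r; rewrite (satm_subword e1 e2) //; split=> [h|[u h]].
      by exists PNil; apply: entW_imp h _.
    by apply: entW_imp h _ => o c [].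
pose sh (e : env) : env := fun n => e n.+1.
(* The witness is the pair of the outer and the inner one. Requiring a genuine pair bounds its
   length by 1 + 2|x| + |u|; in the bounding term the outer witness x is replaced by its own bound
   [t]. *)
exists (fun o e => [/\ size (fst2 (e 0)) <= size (teval (sh e) t),
    M o (dcons (snd2 (e 0)) (dcons (fst2 (e 0)) (sh e))) & e 0 = pair2 (fst2 (e 0)) (snd2 (e 0))]),
  (tCat tOne (tCat (tCat t t) (tsubst (fun n => if n is m.+1 then tVar m else t) bt))).
split.
- apply: (@pfp_ext (fun o e => (size (fst2 (e 0)) <= size (teval (sh e) t) /\
    M o (dcons (snd2 (e 0)) (dcons (fst2 (e 0)) (sh e)))) /\ e 0 = pair2 (fst2 (e 0)) (snd2 (e 0)))).
    have h1 := pf_fst (pf_var 0); have h2 := pf_snd (pf_var 0).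
    apply: pfp_and; last exact: pfp_eq (pf_var 0) (pf_pair h1 h2).
    apply: pfp_and.
      exact: pfp_size_le h1 (@pf_ren (fun o e => teval e t) S (pf_term t)).
    pose g i : ofun := match i with 0 => fun o e => snd2 (e 0) | 1 => fun o e => fst2 (e 0)
      | j.+2 => fun o e => e j.+1 end.
    apply: (pf_ext (@pf_comp _ g hM _)); first by case=> [|[|i]] //; apply: pf_var.
    by move=> o e; congr ind; apply: funext => -[|[|i]].
  by move=> o e; split=> [[[]]|[]].
- move=> o u e [/=]; rewrite /sh dconsS => h1 /Mb h2 ->.
  rewrite size_pair2 /= !size_cat ltnS; apply: leq_add; first exact: leq_add.
  apply: leq_trans h2 _; have := @dval_subst (Std o) e (fun n => if n is m.+1 then tVar m else t) bt.
  rewrite !dval_std => ->; apply: size_teval_mono => -[|n] //=; rewrite dval_std; exact: h1.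
- move=> o e; rewrite sat_fExB; split=> [[x [h1 /sM[u hu]]]|[u [h1 h2 _]]].
    by exists (pair2 x u); rewrite /= fst_pair snd_pair /sh dconsS.
  by exists (fst2 u); split=> //; apply/sM; exists (snd2 u).
- move=> P0 en en1 en2 r; rewrite /fExB ssat_ex; split.
    move=> [x]; rewrite ssat_and => -[/satm_le h1 /(nM _ _ en1 en2)[u h2]].
    have [p hp] := pf_pair (pf_ev x) (pf_ev u); exists p.
    apply: entW_imp2 h1 h2 _ => o c k1 k2; rewrite /sh dconsS /= hp fst_pair snd_pair.
    by rewrite -evs_dcons.
  move=> [u h]; have [x hx] := pf_fst (pf_ev u); have [v hv] := pf_snd (pf_ev u).
  exists x; rewrite ssat_and; split.
    by apply/satm_le; apply: entW_imp h _ => o c []; rewrite /sh dconsS /= hx.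
  apply/(nM _ _ en1 en2); exists v; apply: entW_imp h _ => o c [_ h2 _].
  by move: h2; rewrite evs_dcons /sh dconsS /= hx hv.
Qed.

Section SatModel.
Variables (P0 : pexp) (en : nat -> pexp).
Hypothesis en_onto : forall p, exists n, en n = p.
Hypothesis P0_con : ~ ent [:: P0] (fun _ _ => False).
Notation entW := (entW P0 en).
Notation satm := (satm P0 en).

(* The induction is the limited recursion whose state is the last prefix of x for which a
   witness has been found, together with this witness. *)
Lemma satm_ind B (r : nat -> satm) : Sigma1b B -> ssat (dcons s_eps r) B ->
  (forall x, ssat (dcons x r) B -> forall b, ssat (dcons (s_cat x (s_bit b)) r) B) ->
  forall x, ssat (dcons x r) B.
Proof.
move=> sB h0 hS x; have [M [bt [hM Mb _ nM']]] := satm_Sigma1b sB; have nM := nM' _ _ en_onto P0_con.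
have [u0 hu0] := iffLR (nM _) h0.
pose Mx o c (u y : word) := M o (dcons u (dcons y (evs r o c))).
have hMx (kappa : nat -> nat) fu fx : pf fu -> pf fx ->
    pfp (fun o e => Mx o (fun n => e (kappa n)) (fu o e) (fx o e)).
  move=> hu hx; pose g i : ofun := match i with 0 => fu | 1 => fx
    | j.+2 => fun o e => ev (r j) o (fun n => e (kappa n)) end.
  apply: (pf_ext (@pf_comp _ g hM _)).
    by case=> [|[|i]] //; exact: (pf_ren kappa (pf_ev (r i))).
  by move=> o e; congr ind; apply: funext => -[|[|i]].
(* Saturation makes the induction step uniform: one expression takes any pair of a witness and a
   word y to a witness for y b. *)
have H b : exists Hb : pexp, forall g, entW (fun o c =>
    Mx o c (fst2 (ev g o c)) (snd2 (ev g o c)) ->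
    Mx o c (ev Hb o (dcons (ev g o c) c)) (rcons (snd2 (ev g o c)) b)).
  have [psi hpsi] : pfp (fun o e => ~ (Mx o (fun n => e n.+2) (fst2 (e 1)) (snd2 (e 1)) ->
      Mx o (fun n => e n.+2) (e 0) (rcons (snd2 (e 1)) b))).
    apply: pfp_not; apply: pfp_imp; apply: hMx; [exact: pf_fst (pf_var 1)|exact: pf_snd (pf_var 1)|
      exact: pf_var|exact: pf_snoc (pf_snd (pf_var 1))].
  have psiE o z p c : ev psi o (dcons z (dcons p c)) = [::] <->
      (Mx o c (fst2 p) (snd2 p) -> Mx o c z (rcons (snd2 p) b)).
    rewrite hpsi /ind; case: asboolP => h; split=> //.
    by move=> _; apply: contrapT.
  have hyp g : exists h, entW (fun o c => ev psi o (dcons (ev h o c) (dcons (ev g o c) c)) = [::]).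
    have [u hu] := pf_fst (pf_ev g); have [y hy] := pf_snd (pf_ev g).
    (* If the premise is refuted any value will do; if it is entailed the induction step of the
       model applies. *)
    have := @entW_dec P0 en en_onto _ (hMx id _ _ (pf_fst (pf_ev g)) (pf_snd (pf_ev g))).
    case=> h; last by exists PNil; apply: entW_imp h _ => o c h'; apply/psiE => /h'.
    have sx : ssat (dcons (y : satm) r) B.
      by apply/nM; exists u; apply: entW_imp h _ => o c; rewrite /Mx evs_dcons hu hy.
    have [v hv] := iffLR (nM _) (hS y sx b).
    exists v; apply: entW_imp hv _ => o c hv'; apply/psiE => _; move: hv'.
    by rewrite evs_dcons /Mx /= hy cats1.
  have [Hb hHb] := @herbrand_witness P0 en en_onto P0_con psi hyp.
  by exists Hb => g; apply: entW_imp (hHb g) _ => o c /psiE.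
have [H0 hH0] := H false; have [H1 hH1] := H true; pose Hb (b : bool) := if b then H1 else H0.
have hHb b g : entW (fun o c => Mx o c (fst2 (ev g o c)) (snd2 (ev g o c)) ->
    Mx o c (ev (Hb b) o (dcons (ev g o c) c)) (rcons (snd2 (ev g o c)) b)) by case: b.
(* The state moves on only if it concerns the prefix just read and the new witness passes the test;
   otherwise it stays frozen to the end. *)
pose step o c b (s y : word) :=
  if `[< snd2 s = y /\ Mx o c (ev (Hb b) o (dcons s c)) (rcons y b) >]
  then pair2 (ev (Hb b) o (dcons s c)) (rcons y b) else s.
pose init o c := if `[< Mx o c (ev u0 o c) [::] >] then pair2 (ev u0 o c) [::] else [::].
pose fr o c := fix fr (y : word) := if y is b :: y' then step o c b (fr y') (rev y') else init o c.
pose F o c y := fr o c (rev y).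
have F0 o c : F o c [::] = init o c by [].
have FS o c y b : F o c (rcons y b) = step o c b (F o c y) y by rewrite /F rev_rcons /= revK.
have inv o c y : F o c y = [::] \/
    exists u y', [/\ F o c y = pair2 u y', Mx o c u y' & prefix y' y].
  elim/last_ind: y => [|y b IH].
    rewrite F0 /init; case: asboolP => h; last by left.
    by right; exists (ev u0 o c), [::].
  rewrite FS /step; case: asboolP => [[_ h]|_].
    by right; exists (ev (Hb b) o (dcons (F o c y) c)), (rcons y b); split=> //; apply: prefix_refl.
  case: IH => [|[u [y' [e1 e2 e3]]]]; [by left|right; exists u, y'; split=> //].
  by rewrite -cats1; apply: prefix_trans e3 (prefix_prefix _ _).
have pfF : pf (fun o c => F o c (ev x o c)).
  pose T o (c : env) := teval (evs (dcons x r) o c) bt.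
  have hT : pf T by apply: pf_evs (pf_term bt).
  apply: (@pf_rec F (ev x) init (fun b o e => step o (fun n => e n.+2) b (e 0) (e 1))
    (fun o c => [:: true] ++ (T o c ++ T o c) ++ ev x o c)) => //.
  - exact: pf_ev.
  - apply: pf_if; [exact: (hMx id _ _ (pf_ev u0) pf_nil)|exact: pf_pair (pf_ev u0) pf_nil|exact: pf_nil].
  - move=> b; have hH : pf (fun o e => ev (Hb b) o (dcons (e 0) (fun n => e n.+2))).
      apply: (pf_ext (pf_ren (fun n => if n is k.+1 then k.+2 else 0) (pf_ev (Hb b)))) => o e.
      by congr ev; apply: funext => -[].
    apply: pf_if; [|exact: pf_pair hH (pf_snoc b (pf_var 1))|exact: pf_var].
    apply: pfp_and; first exact: pfp_eq (pf_snd (pf_var 0)) (pf_var 1).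
    exact: (hMx (fun n => n.+2) _ _ hH (pf_snoc b (pf_var 1))).
  - exact: pf_cat (pf_bit true) (pf_cat (pf_cat hT hT) (pf_ev x)).
  - move=> o c y py; case: (inv o c y) => [->|[u [y' [-> hu hy]]]] //.
    have yx : size y' <= size (ev x o c) by apply: leq_trans (size_prefix hy) (size_prefix py).
    have ub : size u <= size (T o c).
      apply: leq_trans (Mb _ _ _ hu) _; rewrite /T evs_dcons.
      by apply: size_teval_mono => -[|n].
    by rewrite size_pair2 /= !size_cat ltnS; apply: leq_add => //; apply: leq_add.
have key o c y : Mx o c (ev u0 o c) [::] ->
    (exists u, F o c y = pair2 u y /\ Mx o c u y) \/
    (exists u y' b, [/\ F o c y = pair2 u y', Mx o c u y', size y' < size y &
       ~ Mx o c (ev (Hb b) o (dcons (F o c y) c)) (rcons y' b)]).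
  move=> k; elim/last_ind: y => [|y b IH].
    by left; exists (ev u0 o c); rewrite F0 /init asboolT.
  case: IH => [[u [e1 e2]]|[u [y' [b' [e1 e2 e3 e4]]]]].
    rewrite FS /step; case: asboolP => [[_ h]|nh].
      by left; exists (ev (Hb b) o (dcons (F o c y) c)).
    right; exists u, y, b; split=> //; first by rewrite size_rcons.
    by move=> h; apply: nh; split=> //; rewrite e1 snd_pair.
  have E : F o c (rcons y b) = F o c y.
    rewrite FS /step asboolF // => -[]; rewrite e1 snd_pair => ey _.
    by move: e3; rewrite ey ltnn.
  by right; exists u, y', b'; rewrite E size_rcons; split=> //; apply: ltnW.
have [G hG] := pfF; have [w hw] := pf_fst (pf_ev G).
apply/nM; exists w.
(* The final state is the value of an expression [G], so the uniform step may be applied to it. A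
   recursion that stopped early would have failed the test exactly at this state, against the
   instance at [G]. *)
apply: entW_imp2 (entW_and (hHb false G) (hHb true G)) hu0 _ => o c [k0 k1] k.
rewrite evs_dcons hw; rewrite evs_dcons in k; rewrite !hG in k0 k1 *.
case: (key o c (ev x o c) k) => [[u [-> h]]|[u [y' [b [e1 e2 _ e4]]]]]; first by rewrite fst_pair.
case: e4; rewrite e1 fst_pair snd_pair in k0 k1 *.
by case: b; [apply: k1|apply: k0].
Qed.

Fixpoint qf (F : formula) : bool :=
  match F with
  | fFlip _ | fEq _ _ | fSub _ _ => true
  | fNot A => qf A
  | fAnd A B | fOr A B => qf A && qf B
  | fEx _ | fAll _ => false
  end.

Lemma qf_subword F : qf F -> subword_formula F.
Proof.
elim: F => //= [t|t u|t u|A IH|A IHA B IHB|A IHA B IHB].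
- by move=> _; apply: SW_Flip.
- by move=> _; apply: SW_Eq.
- by move=> _; apply: SW_Sub.
- by move=> /IH; apply: SW_Not.
- by move=> /andP[/IHA hA /IHB hB]; apply: SW_And.
- by move=> /andP[/IHA hA /IHB hB]; apply: SW_Or.
Qed.

(** The quantifier-free axioms hold in the standard structure for every oracle and assignment, hence
    are entailed outright; induction is the case that needs saturation. *)
Lemma satm_model : is_model RSigma1bNIA satm.
Proof.
move=> F ax r; have [q|nq] := boolP (qf F).
  apply/(satm_subword en_onto P0_con r (qf_subword q)); apply: entW_true => o c.
  by rewrite sat_std; apply: std_model ax _.
case: ax nq => // B sB _; apply/ssat_imp; rewrite ssat_and ssat_inst !ssat_all => -[h0 hS].
have E y t : ssat (dcons y r) (fsubst0 t B) = ssat (dcons (dval (dcons y r) t) r) B.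
  by rewrite /fsubst0 ssat_subst; congr ssat; apply: funext => -[].
apply: satm_ind => // y hy b; move/ssat_imp: (hS y) => /(_ hy).
by rewrite ssat_and !E; case: b => -[].
Qed.

End SatModel.

Lemma witnessing (G : formula) : Sigma1b G -> RSigma1bNIA_proves (fAllExUnique G) ->
  exists f : pexp, forall o x,
    sat o (dcons (ev f o (dcons x (fun=> [::]))) (dcons x (fun=> [::]))) G.
Proof.
move=> sG pG; have [en en_onto] := enum_of_inj PNil pcode_inj.
apply: contrapT => nof.
have [M [bt [hM _ sM nM]]] := satm_Sigma1b sG.
pose Q : opred := fun o e => M o (dcons (snd2 (e 0)) (dcons (fst2 (e 0)) (dcons (e 1) (fun=> [::])))).
have hQ : pfp Q.
  pose g i : ofun := match i with 0 => fun o e => snd2 (e 0) | 1 => fun o e => fst2 (e 0)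
    | 2 => fun o e => e 1 | _ => fun o e => [::] end.
  apply: (pf_ext (@pf_comp _ g hM _)).
    by case=> [|[|[|i]]]; [exact: pf_snd (pf_var 0)|exact: pf_fst (pf_var 0)|exact: pf_var|exact: pf_nil].
  by move=> o e; congr ind; apply: funext => -[|[|[|i]]].
have [P0 hP0] := pfp_not hQ.
have P0E o z c : ev P0 o (dcons z c) <> [::] <-> ~ Q o (dcons z c).
  by rewrite hP0 /ind; case: asboolP => h; split=> // /(_ erefl).
(* An inconsistency would be a finite list of candidates one of which always works, and [pf_first]
   would make of it the expression sought. *)
have con : ~ ent [:: P0] (fun _ _ => False).
  move=> [zs h]; apply: nof; have [f hf fP] := pf_first zs hQ pf_ev; have [g hg] := pf_fst hf.
  exists g => o x; rewrite hg; set c := dcons x (fun=> [::]); apply/sM; exists (snd2 (f o c)).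
  apply: (fP o c); apply: contrapT => hn; apply: (h o c) => P z [<-|[]] iz.
  by apply/P0E => q; apply: hn; exists z.
(* At the constant c_0 the theorem yields an output and a witness for it, which the condition [P0]
   denies. *)
have := soundness (satm_congruent P0 en) (satm_model en_onto con) pG (r := fun=> PNil).
rewrite /fAllExUnique ssat_all => /(_ _ (PVar 0)); rewrite ssat_ex => -[//|y]; rewrite ssat_and.
move=> [/(nM _ _ en_onto con)[u hu] _].
have [z hz] := pf_pair (pf_ev y) (pf_ev u).
apply: (entW_con con hu); exists 0, [:: z] => o c H.
have := H P0 z (or_introl erefl) (or_introl erefl) => /P0E.
by rewrite hz /Q /= fst_pair snd_pair !evs_dcons.
Qed.

(** * Compiling the function algebra to stack programs *)

Ltac upd_tac := rewrite /upd; repeat (case: eqP => ?); subst; try done; try (exfalso; lia).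

Ltac store_eq hst := apply: funext => k; rewrite /upd; repeat (case: eqP => ?);
  try (exfalso; lia); subst; try done; try (by rewrite hst //; lia).

Definition CApp (r s t : nat) := CSeq (CMove r t) (CMove t s).

(* Moves the first |n| letters of the word in r to the empty register s, where |n| is the
   height of register n, and clears r; t, t.+1 and t.+2 are empty registers. *)
Definition CTrunc (r s n t : nat) :=
  CSeq (CMove r t) (CSeq (CCopy n t.+1 t.+2)
   (CSeq (CFor t.+1 (CIf t (CSeq (CPush s true) (CPop t)) (CSeq (CPush s false) (CPop t)) CSkip))
         (CClear t))).

Lemma runs_app o B r s t st : r <> s -> r <> t -> s <> t -> st t = [::] ->
  size (st r) + size (st s) <= B ->
  runs o B (CApp r s t) st (upd (upd st r [::]) s (st r ++ st s)).
Proof.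
move=> rs rt ts t0 sB; apply: runs_seq (runs_move _ rt _) _; first by rewrite t0 /= addn0; lia.
rewrite t0 cats0; set S := upd _ _ _.
have e1 : S t = rev (st r) by rewrite /S updE.
have e2 : S s = st s by rewrite /S !upd_neq //; apply: nesym.
have := @runs_move o B t s S (nesym ts); rewrite e1 e2 size_rev revK => /(_ sB).
congr runs; apply: funext => k; rewrite /S /upd.
case: (k =P s) => // ks; case: (k =P t) => [->|//].
by rewrite (negPf (introN eqP (nesym rt))) t0.
Qed.

Lemma runs_trunc o B r s n t st : uniq [:: r; s; n; t; t.+1; t.+2] ->
  st s = [::] -> st t = [::] -> st t.+1 = [::] -> st t.+2 = [::] ->
  size (st r) <= B -> size (st n) <= B ->
  runs o B (CTrunc r s n t) st
    (upd (upd st r [::]) s (rev (take (size (st n)) (rev (st r))))).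
Proof.
move=> u s0 t0 t1 t2 sr sn; pose w := rev (st r).
have neqs i j : i < 6 -> j < 6 -> i != j ->
    nth 0 [:: r; s; n; t; t.+1; t.+2] i <> nth 0 [:: r; s; n; t; t.+1; t.+2] j.
  by move=> i6 j6 ij /eqP; rewrite nth_uniq // (negPf ij).
have rs : r <> s := neqs 0 1 isT isT isT.
have rn : r <> n := neqs 0 2 isT isT isT.
have rt : r <> t := neqs 0 3 isT isT isT.
have rt1 : r <> t.+1 := neqs 0 4 isT isT isT.
have rt2 : r <> t.+2 := neqs 0 5 isT isT isT.
have ns : s <> n := neqs 1 2 isT isT isT.
have ts : s <> t := neqs 1 3 isT isT isT.
have ts1 : s <> t.+1 := neqs 1 4 isT isT isT.
have ts2 : s <> t.+2 := neqs 1 5 isT isT isT.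
have tn : n <> t := neqs 2 3 isT isT isT.
have tn1 : n <> t.+1 := neqs 2 4 isT isT isT.
have tn2 : n <> t.+2 := neqs 2 5 isT isT isT.
apply: runs_seq (runs_move _ rt _) _; first by rewrite t0 /= addn0.
rewrite t0 cats0; set S1 := upd _ _ _.
have S1n : S1 n = st n by rewrite /S1; upd_tac.
have S1t1 : S1 t.+1 = [::] by rewrite /S1; upd_tac.
have S1t2 : S1 t.+2 = [::] by rewrite /S1; upd_tac.
apply: runs_seq (@runs_copy o B n t.+1 t.+2 S1 _ _ _ _ _) _ => //; try lia.
  by rewrite S1n S1t1 addn0.
rewrite S1n S1t1 cats0; set S2 := upd S1 _ _.
pose T i := upd (upd (upd (upd S2 s (rev (take i w))) t (drop i w)) t.+1 (drop i (st n))) r [::].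
apply: (@runs_seq _ _ _ _ _ (T (size (st n)))).
  have E0 : S2 = T 0.
    rewrite /T take0 !drop0 /S2 /S1 -/w; apply: funext => k; rewrite /upd.
    by repeat (case: eqP => ?); subst; try done; try (exfalso; lia).
  rewrite E0; apply: runs_for => //.
  - rewrite /= !(negPf (introN eqP (nesym ts1))) /=.
    by have -> : (t.+1 == t) = false by lia.
  - by rewrite /T; upd_tac; rewrite drop0.
  move=> i isn; have Tt : T i t = drop i w by rewrite /T; upd_tac.
  have Ts : T i s = rev (take i w) by rewrite /T; upd_tac.
  have [iw|wi] := ltnP i (size w).
    exists (upd (upd (T i) s (nth false w i :: T i s)) t (drop i.+1 w)).
      have z : size (T i s) < B.
        by rewrite Ts size_rev size_takel ?(ltnW iw) //; rewrite size_rev in iw; lia.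
      rewrite /runs /= Tt (drop_nth false) //.
      have ut v : upd (T i) s v t = drop i w by rewrite upd_neq ?Tt //; apply: nesym.
      by case: (nth _ _ _); rewrite /= /opush z /= ut behead_drop.
    have Tt1 : T i t.+1 = drop i (st n) by rewrite /T; upd_tac.
    have -> : upd (upd (T i) s (nth false w i :: T i s)) t (drop i.+1 w) t.+1 = drop i (st n).
      by rewrite -Tt1 /upd; do 2 (case: eqP => ?; [exfalso; lia|]).
    rewrite behead_drop Ts /T (take_nth false) // rev_rcons; apply: funext => k; rewrite /upd.
    by repeat (case: eqP => ?); subst; try done; try (exfalso; lia).
  exists (T i); first by rewrite /runs /= Tt drop_oversize.
  have Tt1 : T i t.+1 = drop i (st n) by rewrite /T; upd_tac.
  rewrite Tt1 behead_drop /T (take_oversize wi) (take_oversize (leqW wi)) (drop_oversize wi).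
  rewrite (drop_oversize (leqW wi)).
  apply: funext => k; rewrite /upd.
  by repeat (case: eqP => ?); subst; try done; try (exfalso; lia).
have Tn : T (size (st n)) t = drop (size (st n)) w by rewrite /T; upd_tac.
have := @runs_clear o B t (T (size (st n))); rewrite Tn size_drop size_rev => H.
have {}H := H (leq_trans (leq_subr _ _) sr).
apply: (eq_ind _ (runs o B (CClear t) (T (size (st n)))) H).
rewrite /T drop_size -/w /S2 /S1; apply: funext => k; rewrite /upd.
by repeat (case: eqP => ?); subst; try done; try (exfalso; lia).
Qed.

(** The result goes to the empty register [b], the registers above are scratch, and [rho] places the
    variables below [b]. In [PRec], [b] holds the state, [b.+1] the bound, [b.+2] the letters read
    and [b.+3] the letters to come, the next one on top. *)
Fixpoint comp (p : pexp) (rho : nat -> nat) (b : nat) : cmd :=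
  match p with
  | PVar i => CCopy (rho i) b b.+1
  | PNil => CSkip
  | PSnoc c p => CSeq (comp p rho b) (CPush b c)
  | PCat p q => CSeq (comp p rho b) (CSeq (comp q rho b.+1) (CApp b.+1 b b.+2))
  | PTimes p q => CSeq (comp p rho b.+1) (CSeq (comp q rho b.+2)
      (CSeq (CFor b.+2 (CCopy b.+1 b b.+3)) (CClear b.+1)))
  | PAsk p => CSeq (comp p rho b.+1) (CSeq (CAsk b.+1 b) (CClear b.+1))
  | PRec x i h0 h1 bd =>
      let rho' := dcons b (dcons b.+2 rho) in
      CSeq (comp bd rho b.+1) (CSeq (comp x rho b.+2) (CSeq (CMove b.+2 b.+3)
     (CSeq (comp i rho b.+4) (CSeq (CTrunc b.+4 b b.+1 b.+4.+1)
     (CSeq (CFor b.+3 (CIf b.+3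
        (CSeq (comp h1 rho' b.+4)
          (CSeq (CClear b) (CSeq (CTrunc b.+4 b b.+1 b.+4.+1) (CPush b.+2 true))))
        (CSeq (comp h0 rho' b.+4)
          (CSeq (CClear b) (CSeq (CTrunc b.+4 b b.+1 b.+4.+1) (CPush b.+2 false)))) CSkip))
     (CSeq (CClear b.+1) (CClear b.+2)))))))
  end.

(** The registers of the variables count as written, because copying empties and refills them. Loop
    counters lie outside this set, which gives [wf_comp]. *)
Lemma writes_comp p rho b r : writes (comp p rho b) r -> b <= r \/ exists2 i, i < pbound p & r = rho i.
Proof.
elim: p rho b => /= [n|//|c p IH|p IHp q IHq|p IHp q IHq|p IH|x IHx i IHi h0 IH0 h1 IH1 bd IHb] rho b.
- move=> h; have [|h'] := eqVneq r (rho n); first by move=> ->; right; exists n.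
  by left; lia.
- by move=> /orP[/IH //|/eqP->]; left.
- case/orP=> [/IHp[|[i ip ->]]|/orP[/IHq[|[i ip ->]]|]]; try by left; lia.
  + by right; exists i => //; rewrite leq_max ip.
  + by right; exists i => //; rewrite leq_max ip orbT.
- case/orP=> [/IHp[|[i ip ->]]|/orP[/IHq[|[i ip ->]]|]]; try by left; lia.
  + by right; exists i => //; rewrite leq_max ip.
  + by right; exists i => //; rewrite leq_max ip orbT.
- by case/orP=> [/IH[|[i ip ->]]|]; [left; lia|right; exists i|left; lia].
- set m := maxn _ _ => h.
  have key q : (forall rho b, writes (comp q rho b) r -> b <= r \/ exists2 i, i < pbound q & r = rho i) ->
      pbound q <= m -> writes (comp q (dcons b (dcons b.+2 rho)) b.+4) r ->
      b <= r \/ exists2 i, i < m & r = rho i.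
    move=> IH qm /IH[|[[|[|j]] jq /= ->]]; try by left; lia.
    by right; exists j => //; lia.
  have key' q b' : (forall rho b, writes (comp q rho b) r -> b <= r \/ exists2 i, i < pbound q & r = rho i) ->
      pbound q <= m -> b <= b' -> writes (comp q rho b') r ->
      b <= r \/ exists2 i, i < m & r = rho i.
    move=> IH qm bb /IH[|[j jq ->]]; first by left; lia.
    by right; exists j => //; apply: leq_trans jq qm.
  have [bx bi b0 b1 bb] : [/\ pbound x <= m, pbound i <= m, pbound h0 <= m, pbound h1 <= m & pbound bd <= m].
    by rewrite /m; split; lia.
  case/orP: h => [h|h]; first by apply: (key' _ _ IHb bb _ h).
  case/orP: h => [h|h]; first by apply: (key' _ _ IHx bx _ h); lia.
  case/orP: h => [h|h]; first by left; lia.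
  case/orP: h => [h|h]; first by apply: (key' _ _ IHi bi _ h); lia.
  case/orP: h => [h|h]; first by left; lia.
  case/orP: h => [h|h]; last by left; lia.
  case/orP: h => [h|h]; first by left; lia.
  case/orP: h => [/orP[h|h]|/orP[/orP[h|h]|//]].
  + exact: (key _ IH1 b1 h).
  + by left; lia.
  + exact: (key _ IH0 b0 h).
  + by left; lia.
Qed.

Lemma wf_comp p rho b : (forall i, i < pbound p -> rho i < b) -> wf (comp p rho b).
Proof.
elim: p rho b => /= [n|//|c p IH|p IHp q IHq|p IHp q IHq|p IH|x IHx i IHi h0 IH0 h1 IH1 bd IHb] rho b h.
- by have := h n (ltnSn _); lia.
- by rewrite IH.
- rewrite IHp ?IHq /=; [lia|move=> i iq|move=> i ip].
    by have := h i; rewrite leq_max iq orbT => /(_ isT); lia.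
  by apply: h; rewrite leq_max ip.
- rewrite IHp ?IHq /=; [lia|move=> i iq|move=> i ip].
    by have := h i; rewrite leq_max iq orbT => /(_ isT); lia.
  by have := h i; rewrite leq_max ip => /(_ isT); lia.
- by rewrite IH ?andbT // => i ip; have := h i ip; lia.
- set m := maxn _ _ in h.
  have [bx bi b0 b1 bb] : [/\ pbound x <= m, pbound i <= m, pbound h0 <= m, pbound h1 <= m & pbound bd <= m].
    by rewrite /m; split; lia.
  have key q b' : pbound q <= m -> b <= b' -> forall j, j < pbound q -> rho j < b'.
    by move=> qm bb' j jq; have := h j (leq_trans jq qm); lia.
  have key' q : pbound q <= m -> forall j, j < pbound q -> dcons b (dcons b.+2 rho) j < b.+4.
    move=> qm [|[|j]] jq /=; try lia.
    have rj : rho j < b by apply: h; lia.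
    by lia.
  have w q : pbound q <= m -> writes (comp q (dcons b (dcons b.+2 rho)) b.+4) b.+3 = false.
    move=> qm; apply/negP => /writes_comp[|[[|[|j]] jq /= e]]; try lia.
    have rj : rho j < b by apply: h; lia.
    by lia.
  rewrite IHb ?IHx ?IHi ?IH0 ?IH1 ?w //; try (by apply: key'); try (by apply: key => //; lia).
  by lia.
Qed.

Lemma pw_le n a b : 2 <= n -> a <= b -> n ^ a <= n ^ b.
Proof. by move=> n2 ab; apply: leq_pexp2l => //; apply: leq_trans n2. Qed.

(** As n is at least 2, a sum costs one more than the larger exponent, and polynomial bounds need no
    coefficients. *)
Lemma pw_add n a b c x y : 2 <= n -> x <= n ^ a -> y <= n ^ b -> a < c -> b < c -> x + y <= n ^ c.
Proof.
move=> n2 xa yb; case: c => // c; rewrite !ltnS => ac bc; rewrite expnS.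
have h1 : x <= n ^ c by apply: leq_trans xa (pw_le n2 ac).
have h2 : y <= n ^ c by apply: leq_trans yb (pw_le n2 bc).
by apply: leq_trans (leq_mul n2 (leqnn (n ^ c))); rewrite mul2n -addnn leq_add.
Qed.

Lemma size_recw h m s pre x : size s <= m -> size (recw h m s pre x) <= m.
Proof.
elim: x s pre => [|b x IH] s pre //= _; apply: IH.
by rewrite size_take_min geq_minl.
Qed.

Lemma recw_rcons h m s pre x b :
  recw h m s pre (rcons x b) = take m (h b (recw h m s pre x) (pre ++ x)).
Proof.
elim: x s pre => [|c x IH] s pre /=; first by rewrite cats0.
by rewrite IH cat_rcons.
Qed.

Lemma ev_size p : exists a, forall o e n, 2 <= n ->
  (forall i, i < pbound p -> size (e i) <= n) -> size (ev p o e) <= n ^ a.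
Proof.
elim: p => /= [i||b p [a IH]|p [a IHp] q [b IHq]|p [a IHp] q [b IHq]|p _|x _ i _ h0 _ h1 _ bd [a IH]].
- by exists 1 => o e n _ h; rewrite expn1; apply: h.
- by exists 0.
- exists a.+1 => o e n n2 h; rewrite size_rcons -addn1.
  by apply: (pw_add (a := a) (b := 0)) => //; apply: IH.
- exists (a + b).+1 => o e n n2 h; rewrite size_cat.
  apply: (pw_add (a := a) (b := b)) => //; try lia.
    by apply: IHp => // i ip; apply: h; lia.
  by apply: IHq => // i ip; apply: h; lia.
- exists (a + b) => o e n n2 h; rewrite size_wtimes expnD; apply: leq_mul.
    by apply: IHp => // i ip; apply: h; lia.
  by apply: IHq => // i ip; apply: h; lia.
- by exists 0.
- exists a => o e n n2 h; apply: (@leq_trans (size (ev bd o e))).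
    by apply: size_recw; rewrite size_take_min geq_minl.
  by apply: IH => // j jp; apply: h; lia.
Qed.

Lemma ev_agree q o rho b (st st' : store) : (forall i, i < pbound q -> rho i < b) ->
  (forall r, r < b -> st' r = st r) ->
  ev q o (fun i => rev (st' (rho i))) = ev q o (fun i => rev (st (rho i))).
Proof. by move=> h1 h2; apply: (@ev_ext q (pbound q) o _ _ (leqnn _)) => i iq; rewrite h2 // h1. Qed.

Definition compiles (p : pexp) (a : nat) := forall rho b (st : store) o n B,
  (forall i, i < pbound p -> rho i < b) -> (forall r, b <= r -> st r = [::]) -> 2 <= n ->
  (forall i, i < pbound p -> size (st (rho i)) <= n) -> n ^ a <= B ->
  runs o B (comp p rho b) st (upd st b (rev (ev p o (fun i => rev (st (rho i)))))).

Lemma compiles_in p a rho b b' (st st' : store) o n B : compiles p a ->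
  b <= b' -> (forall i, i < pbound p -> rho i < b) -> (forall r, r < b -> st' r = st r) ->
  (forall r, b' <= r -> st' r = [::]) -> 2 <= n ->
  (forall i, i < pbound p -> size (st (rho i)) <= n) -> n ^ a <= B ->
  runs o B (comp p rho b') st' (upd st' b' (rev (ev p o (fun i => rev (st (rho i)))))).
Proof.
move=> hp bb h1 h2 h3 n2 h4 aB; rewrite -(ev_agree o h1 h2); apply: (hp _ _ _ _ n) => //.
  by move=> i ip; apply: leq_trans (h1 i ip) bb.
by move=> i ip; rewrite h2 ?h4 ?h1.
Qed.

Lemma compP p : exists a, compiles p a.
Proof.
elim: p => [i||c p [a IH]|p [a IHp] q [a' IHq]|p [a IHp] q [a' IHq]|p [a IH]|
  x [cx IHx] i [ci IHi] h0 [c0 IH0] h1 [c1 IH1] bd [cb IHb]].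
- exists 1 => rho b st o n B hr hst n2 hn aB /=; rewrite revK.
  have rb := hr i (ltnSn _); have sb := hst b (leqnn _).
  rewrite -[st (rho i)]cats0 -sb; apply: runs_copy; try lia.
    by apply: hst.
  by rewrite sb addn0; apply: leq_trans aB; rewrite expn1; apply: hn.
- exists 0 => rho b st o n B hr hst n2 hn aB /=; rewrite /runs /=; congr Some.
  by store_eq hst; rewrite hst.
- have [s hs] := ev_size p; exists (a + s).+1 => rho b st o n B hr hst n2 hn aB.
  rewrite [comp _ _ _]/=; apply: (runs_seq (s1 := upd st b (rev (ev p o (fun i => rev (st (rho i))))))).
    by apply: (IH _ _ _ _ n) => //; apply: leq_trans aB; apply: pw_le => //; lia.
  rewrite /runs /= /opush updE ifT.
    by congr Some; rewrite rev_rcons; store_eq hst.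
  rewrite size_rev; apply: leq_trans aB.
  rewrite -addn1; apply: (pw_add (a := s) (b := 0)) => //; try lia.
  by apply: hs => // i ip; rewrite size_rev; apply: hn.
- have [s hs] := ev_size p; have [s' hs'] := ev_size q.
  exists (a + a' + s + s').+1 => rho b st o n B hr hst n2 hn aB.
  have hrp i : i < pbound p -> rho i < b by move=> ip; apply: hr => /=; lia.
  have hrq i : i < pbound q -> rho i < b by move=> ip; apply: hr => /=; lia.
  have hnp i : i < pbound p -> size (st (rho i)) <= n by move=> ip; apply: hn => /=; lia.
  have hnq i : i < pbound q -> size (st (rho i)) <= n by move=> ip; apply: hn => /=; lia.
  set e := fun i => rev (st (rho i)).
  have bp : size (ev p o e) <= n ^ s by apply: hs => // i ip; rewrite size_rev; apply: hnp.
  have bq : size (ev q o e) <= n ^ s' by apply: hs' => // i ip; rewrite size_rev; apply: hnq.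
  rewrite [comp _ _ _]/=; apply: (runs_seq (s1 := upd st b (rev (ev p o e)))).
    by apply: (IHp _ _ _ _ n) => //; apply: leq_trans aB; apply: pw_le => //; lia.
  apply: (runs_seq (s1 := upd (upd st b (rev (ev p o e))) b.+1 (rev (ev q o e)))).
    apply: (@compiles_in _ _ rho b _ st _ o n B IHq) => //.
    - by move=> r rb; rewrite upd_neq //; lia.
    - by move=> r rb; rewrite upd_neq ?hst //; lia.
    - by apply: leq_trans aB; apply: pw_le => //; lia.
  set S := upd _ _ _; have S1 : S b.+1 = rev (ev q o e) by rewrite /S updE.
  have S0 : S b = rev (ev p o e) by rewrite /S; upd_tac.
  have := @runs_app o B b.+1 b b.+2 S; rewrite S1 S0.
  rewrite (_ : upd (upd S b.+1 [::]) b _ = upd st b (rev (ev (PCat p q) o e))); last first.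
    by rewrite /= rev_cat /S; store_eq hst.
  apply=> //; try lia; first by rewrite /S; upd_tac; rewrite hst //; lia.
  rewrite !size_rev; apply: leq_trans aB; rewrite addnC.
  by apply: pw_add n2 bp bq _ _; lia.
- have [s hs] := ev_size p; have [s' hs'] := ev_size q.
  exists (a + a' + s + s').+1 => rho b st o n B hr hst n2 hn aB.
  have hrp i : i < pbound p -> rho i < b by move=> ip; apply: hr => /=; lia.
  have hrq i : i < pbound q -> rho i < b by move=> ip; apply: hr => /=; lia.
  have hnp i : i < pbound p -> size (st (rho i)) <= n by move=> ip; apply: hn => /=; lia.
  have hnq i : i < pbound q -> size (st (rho i)) <= n by move=> ip; apply: hn => /=; lia.
  set e := fun i => rev (st (rho i)).
  set v := ev p o e; set w := ev q o e.
  have bp : size v <= n ^ s by apply: hs => // i ip; rewrite size_rev; apply: hnp.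
  have bq : size w <= n ^ s' by apply: hs' => // i ip; rewrite size_rev; apply: hnq.
  have BpB : n ^ s * n ^ s' <= B by rewrite -expnD; apply: leq_trans aB; apply: pw_le => //; lia.
  have n1 z : 0 < n ^ z by rewrite expn_gt0 (leq_trans _ n2).
  have vB : size v <= B by apply: leq_trans bp (leq_trans (leq_pmulr _ (n1 s')) BpB).
  have wB : size w <= B by apply: leq_trans bq (leq_trans (leq_pmull _ (n1 s)) BpB).
  rewrite [comp _ _ _]/=; apply: (runs_seq (s1 := upd st b.+1 (rev v))).
    apply: (@compiles_in _ _ rho b _ st _ o n B IHp) => //.
    - by move=> r rb; apply: hst; lia.
    - by apply: leq_trans aB; apply: pw_le => //; lia.
  apply: (runs_seq (s1 := upd (upd st b.+1 (rev v)) b.+2 (rev w))).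
    apply: (@compiles_in _ _ rho b _ st _ o n B IHq) => //; first by lia.
    - by move=> r rb; rewrite upd_neq //; lia.
    - by move=> r rb; rewrite upd_neq ?hst //; lia.
    - by apply: leq_trans aB; apply: pw_le => //; lia.
  pose S j := upd (upd (upd st b.+1 (rev v)) b.+2 (drop j (rev w))) b (flatten (nseq j (rev v))).
  apply: (runs_seq (s1 := S (size w))).
    rewrite (_ : upd (upd st b.+1 (rev v)) b.+2 (rev w) = S 0); last first.
      by rewrite /S drop0; store_eq hst; rewrite hst.
    apply: runs_for => //=; try lia.
    + by rewrite /S; upd_tac; rewrite drop0 size_rev.
    + move=> j jw.
      have Sv : S j b.+1 = rev v by rewrite /S; upd_tac.
      have Sb : S j b = flatten (nseq j (rev v)) by rewrite /S; upd_tac.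
      have := @runs_copy o B b.+1 b b.+3 (S j); rewrite Sv Sb => H.
      eexists; first by apply: H; try lia; [rewrite /S; upd_tac; rewrite hst //; lia|
        rewrite size_flatten /shape map_nseq sumn_nseq size_rev -mulnS;
        exact: (leq_trans (leq_mul bp (leq_trans jw bq)) BpB)].
      rewrite (_ : upd (S j) b _ b.+2 = drop j (rev w)); last by rewrite /S; upd_tac.
      by rewrite behead_drop /S; store_eq hst.
  have Sv : S (size w) b.+1 = rev v by rewrite /S; upd_tac.
  have := @runs_clear o B b.+1 (S (size w)); rewrite Sv size_rev => /(_ vB).
  rewrite (_ : upd (S (size w)) b.+1 [::] = upd st b (rev (ev (PTimes p q) o e))) //.
  have revt : rev (wtimes v w) = flatten (nseq (size w) (rev v)).
    by rewrite /wtimes rev_flatten map_nseq rev_nseq.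
  by rewrite /= -/v -/w revt /S drop_oversize ?size_rev //; store_eq hst; rewrite hst //; lia.
- have [s hs] := ev_size p; exists (a + s).+1 => rho b st o n B hr hst n2 hn aB.
  set e := fun i => rev (st (rho i)); set v := ev p o e.
  have bv : size v <= B.
    apply: (@leq_trans (n ^ s)); first by apply: hs => // i ip; rewrite size_rev; apply: hn.
    by apply: leq_trans aB; apply: pw_le => //; lia.
  have B0 : 0 < B by apply: leq_trans aB; rewrite expn_gt0 (leq_trans _ n2).
  rewrite [comp _ _ _]/=; apply: (runs_seq (s1 := upd st b.+1 (rev v))).
    apply: (@compiles_in _ _ rho b _ st _ o n B IH) => //.
    - by move=> r rb; apply: hst; lia.
    - by apply: leq_trans aB; apply: pw_le => //; lia.
  apply: (runs_seq (s1 := upd (upd st b.+1 (rev v)) b [:: o v])).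
    rewrite /runs /= updE size_rev bv /opush (_ : upd st _ _ b = [::]) ?B0 /= ?revK //.
    by upd_tac; rewrite hst.
  set S := upd _ _ _; have Sv : S b.+1 = rev v by rewrite /S; upd_tac.
  have := @runs_clear o B b.+1 S; rewrite Sv size_rev => /(_ bv).
  rewrite (_ : upd S b.+1 [::] = upd st b (rev (ev (PAsk p) o e))) //.
  by rewrite /= -/v /S; store_eq hst; rewrite hst //; lia.
- have [ax hx] := ev_size x; have [ai hi] := ev_size i; have [a0 hs0] := ev_size h0.
  have [a1 hs1] := ev_size h1; have [ab hb] := ev_size bd.
  (* The loop body works on the state, of size at most n^ab, and the part read, of size at most
     n^ax; [n ^ kk] bounds both and takes the place of [n] for [h0] and [h1]. *)
  pose kk := (ax + ab).+1.
  exists (cx + ci + cb + ax + ai + ab + (kk * c0 + kk * c1 + kk * a0 + kk * a1)).+2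
    => rho b st o n B hr hst n2 hn aB.
  have bnd z : z <= (cx + ci + cb + ax + ai + ab + (kk * c0 + kk * c1 + kk * a0 + kk * a1)).+2 ->
    n ^ z <= B by move=> hz; apply: leq_trans aB; apply: pw_le.
  rewrite /= in hr hn.
  set e := fun j => rev (st (rho j)).
  set X := ev x o e; set I0 := ev i o e; set Bd := ev bd o e.
  have sX : size X <= n ^ ax by apply: hx => // j jx; rewrite size_rev; apply: hn; lia.
  have sI : size I0 <= n ^ ai by apply: hi => // j jx; rewrite size_rev; apply: hn; lia.
  have sB : size Bd <= n ^ ab by apply: hb => // j jx; rewrite size_rev; apply: hn; lia.
  have XB : size X <= B by apply: leq_trans sX (bnd _ _); lia.
  have IB : size I0 <= B by apply: leq_trans sI (bnd _ _); lia.
  have BB : size Bd <= B by apply: leq_trans sB (bnd _ _); lia.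
  pose nb := size Bd.
  pose h (c : bool) (s pre : word) := ev (if c then h1 else h0) o (dcons s (dcons pre e)).
  pose sj j := recw h nb (take nb I0) [::] (take j X).
  have ssj j : size (sj j) <= nb by apply: size_recw; rewrite size_take_min geq_minl.
  have sjS j : j < size X -> sj j.+1 = take nb (h (nth false X j) (sj j) (take j X)).
    by move=> jX; rewrite /sj (take_nth false) // recw_rcons.
  rewrite [comp _ _ _]/=; apply: (runs_seq (s1 := upd st b.+1 (rev Bd))).
    apply: (@compiles_in _ _ rho b _ st _ o n B IHb) => //; try (by move=> j jp; apply: hr; lia);
      try (by move=> j jp; apply: hn; lia).
    - by move=> r rb; apply: hst; lia.
    - by apply: bnd; lia.
  apply: (runs_seq (s1 := upd (upd st b.+1 (rev Bd)) b.+2 (rev X))).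
    apply: (@compiles_in _ _ rho b _ st _ o n B IHx) => //; try (by lia); try (by move=> j jp; apply: hr; lia);
      try (by move=> j jp; apply: hn; lia).
    - by move=> r rb; rewrite upd_neq //; lia.
    - by move=> r rb; rewrite upd_neq ?hst //; lia.
    - by apply: bnd; lia.
  apply: (runs_seq (s1 := upd (upd st b.+1 (rev Bd)) b.+3 X)).
    set S := upd _ b.+2 _; have S2 : S b.+2 = rev X by rewrite /S updE.
    have S3 : S b.+3 = [::] by rewrite /S; upd_tac; rewrite hst //; lia.
    have := @runs_move o B b.+2 b.+3 S; rewrite S2 S3 cats0 revK size_rev addn0.
    rewrite (_ : upd (upd S b.+2 [::]) b.+3 X = upd (upd st b.+1 (rev Bd)) b.+3 X); last first.
      by rewrite /S; store_eq hst; rewrite hst //; lia.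
    by apply=> //; lia.
  apply: (runs_seq (s1 := upd (upd (upd st b.+1 (rev Bd)) b.+3 X) b.+4 (rev I0))).
    apply: (@compiles_in _ _ rho b _ st _ o n B IHi) => //; try (by lia); try (by move=> j jp; apply: hr; lia);
      try (by move=> j jp; apply: hn; lia).
    - by move=> r rb; rewrite !upd_neq //; lia.
    - by move=> r rb; rewrite !upd_neq ?hst //; lia.
    - by apply: bnd; lia.
  pose S j := upd (upd (upd (upd st b.+1 (rev Bd)) b.+2 (rev (take j X))) b.+3 (drop j X)) b
    (rev (sj j)).
  have un : uniq [:: b.+4; b; b.+1; b.+4.+1; b.+4.+2; b.+4.+3].
    by rewrite /= !inE; lia.
  apply: (runs_seq (s1 := S 0)).
    set S' := upd _ b.+4 _; have S4 : S' b.+4 = rev I0 by rewrite /S' updE.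
    have S1 : S' b.+1 = rev Bd by rewrite /S'; upd_tac.
    have := @runs_trunc o B b.+4 b b.+1 b.+4.+1 S' un; rewrite S4 S1 !size_rev revK.
    rewrite (_ : upd (upd S' b.+4 [::]) b _ = S 0); last first.
      by rewrite /S /S' drop0 /sj take0 /=; store_eq hst; rewrite hst //; lia.
    by apply=> //; rewrite /S'; upd_tac; rewrite hst //; lia.
  apply: (runs_seq (s1 := S (size X))).
    have wr q : (q = h0) \/ (q = h1) -> writes (comp q (dcons b (dcons b.+2 rho)) b.+4) b.+3 = false.
      move=> hq; apply/negP => /writes_comp[|[[|[|j]] jq /= ej]]; try lia.
      have rj : rho j < b by apply: hr; case: hq jq => ->; lia.
      by lia.
    apply: runs_for => //.
    + rewrite /= (wr h0) ?(wr h1); [lia|by right|by left].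
    + by rewrite /S; upd_tac; rewrite drop0.
    move=> j jX; set c := nth false X j.
    have Sb : S j b = rev (sj j) by rewrite /S; upd_tac.
    have S1 : S j b.+1 = rev Bd by rewrite /S; upd_tac.
    have S2 : S j b.+2 = rev (take j X) by rewrite /S; upd_tac.
    have S3 : S j b.+3 = drop j X by rewrite /S; upd_tac.
    set v := h c (sj j) (take j X).
    have nk : forall z, (n ^ kk) ^ z = n ^ (kk * z) by move=> z; rewrite expnM.
    have n1 z : 0 < n ^ z by rewrite expn_gt0 (leq_trans _ n2).
    have nk2 : 2 <= n ^ kk by rewrite -[X in X <= _](expn1 2) (leq_trans _ (pw_le n2 (isT : 1 <= kk))) ?expn1.
    have small (q : pexp) j' : (q = h0) \/ (q = h1) -> j' < pbound q ->
        size (rev (S j (dcons b (dcons b.+2 rho) j'))) <= n ^ kk.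
      move=> hq; case: j' => [|[|j']] jq /=; rewrite size_rev ?Sb ?S2 ?size_rev.
      - by apply: leq_trans (ssj j) (leq_trans sB _); apply: pw_le => //; rewrite /kk; lia.
      - rewrite size_takel ?(ltnW jX) //; apply: leq_trans (ltnW jX) (leq_trans sX _).
        by apply: pw_le => //; rewrite /kk; lia.
      - have rj : rho j' < b by apply: hr; case: hq jq => ->; lia.
        rewrite /S !upd_neq; try lia.
        apply: (@leq_trans n); first by apply: hn; case: hq jq => ->; lia.
        by rewrite -{1}(expn1 n); apply: pw_le.
    have evh (q : pexp) : (q = h0) \/ (q = h1) ->
        ev q o (fun j' => rev (S j (dcons b (dcons b.+2 rho) j'))) =
        ev q o (dcons (sj j) (dcons (take j X) e)).
      move=> hq; apply: (@ev_ext q (pbound q) o _ _ (leqnn _)); case=> [|[|j']] jq /=; rewrite ?Sb ?S2 ?revK //.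
      have rj : rho j' < b by apply: hr; case: hq jq => ->; lia.
      by rewrite /S !upd_neq //; lia.
    have run1 (q : pexp) z : (q = h0) \/ (q = h1) -> compiles q z -> n ^ (kk * z) <= B ->
        runs o B (comp q (dcons b (dcons b.+2 rho)) b.+4) (S j)
          (upd (S j) b.+4 (rev (ev q o (dcons (sj j) (dcons (take j X) e))))).
      move=> hq cq zB; rewrite -(evh q hq); apply: (cq _ _ _ _ (n ^ kk)) => //.
      - case=> [|[|j']] jq /=; try lia.
        have rj : rho j' < b by apply: hr; case: hq jq => ->; lia.
        by lia.
      - by move=> r rb; rewrite /S !upd_neq ?hst //; lia.
      - by move=> j' jq; rewrite -size_rev; apply: (small q).
      - by rewrite nk.
    have runc : runs o B (comp (if c then h1 else h0) (dcons b (dcons b.+2 rho)) b.+4) (S j)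
        (upd (S j) b.+4 (rev v)).
      rewrite /v /h; case: (c).
        by apply: (run1 h1 c1) => //; [right|apply: bnd; lia].
      by apply: (run1 h0 c0) => //; [left|apply: bnd; lia].
    have vB : size v <= B.
      rewrite /v /h; case: (c).
        rewrite -(evh h1 (or_intror erefl)); apply: (@leq_trans ((n ^ kk) ^ a1)).
          by apply: hs1 => // j' jq; apply: (small h1) => //; right.
        by rewrite nk; apply: bnd; lia.
      rewrite -(evh h0 (or_introl erefl)); apply: (@leq_trans ((n ^ kk) ^ a0)).
        by apply: hs0 => // j' jq; apply: (small h0) => //; left.
      by rewrite nk; apply: bnd; lia.
    exists (upd (upd (S j) b (rev (take nb v))) b.+2 (c :: rev (take j X))); last first.
      rewrite (_ : upd _ b.+2 _ b.+3 = drop j X); last by rewrite -S3; upd_tac.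
      by rewrite behead_drop /S sjS // (take_nth false) // rev_rcons; store_eq hst.
    have tail : runs o B (CSeq (CClear b) (CSeq (CTrunc b.+4 b b.+1 b.+4.+1) (CPush b.+2 c)))
        (upd (S j) b.+4 (rev v)) (upd (upd (S j) b (rev (take nb v))) b.+2 (c :: rev (take j X))).
      have C1 := @runs_clear o B b (upd (S j) b.+4 (rev v)).
      rewrite (_ : upd (S j) b.+4 (rev v) b = rev (sj j)) ?size_rev in C1; last by rewrite -Sb; upd_tac.
      apply: runs_seq (C1 (leq_trans (ssj j) BB)) _.
      set S' := upd _ b [::]; have S'4 : S' b.+4 = rev v by rewrite /S'; upd_tac.
      have S'1 : S' b.+1 = rev Bd by rewrite -S1 /S'; upd_tac.
      have S'0 r : b.+4 < r -> S' r = [::].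
        by move=> rb; rewrite /S' /S !upd_neq ?hst //; lia.
      have C2 := @runs_trunc o B b.+4 b b.+1 b.+4.+1 S' un.
      rewrite S'4 S'1 !size_rev revK in C2.
      apply: runs_seq (C2 _ _ _ _ vB BB) _; try (by apply: S'0; lia); first by rewrite /S' updE.
      rewrite /runs /= /opush (_ : upd _ b _ b.+2 = rev (take j X)); last by rewrite -S2 /S'; upd_tac.
      rewrite size_rev size_takel ?(ltnW jX) // (leq_trans jX XB); congr Some.
      rewrite /S' /S; store_eq hst; rewrite hst //; lia.
    rewrite /runs /= S3 (drop_nth false) // -/c.
    by case: (c) runc tail => runc tail; [exact: (runs_seq runc tail)|exact: (runs_seq runc tail)].
  have S1 : S (size X) b.+1 = rev Bd by rewrite /S; upd_tac.
  have C1 := @runs_clear o B b.+1 (S (size X)); rewrite S1 size_rev in C1.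
  apply: runs_seq (C1 BB) _; set S' := upd _ b.+1 [::].
  have S2 : S' b.+2 = rev X by rewrite /S' /S take_size; upd_tac.
  have C2 := @runs_clear o B b.+2 S'; rewrite S2 size_rev in C2.
  have := C2 XB; rewrite (_ : upd S' b.+2 [::] = upd st b (rev (ev (PRec x i h0 h1 bd) o e))) //.
  have -> : ev (PRec x i h0 h1 bd) o e = sj (size X) by rewrite /sj take_size.
  by rewrite /S' /S drop_size; store_eq hst; rewrite hst //; lia.
Qed.

(** * A single-tape machine running stack programs *)

Inductive instr : Type :=
| IPush (r : nat) (b : bool) (n : nat)
| IFlip (r n : nat)
| IPop (r n : nat)
| IBr (r n1 n0 nE : nat)
| IHalt (b : bool).

Section Machine.
Variables (K1 : nat) (code : seq instr).
Let K := K1.+1.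
Let N := size code.
Notation track := {ffun 'I_K -> option bool}.
Notation sym := (option (bool + track)).
Notation state := ('I_7 * 'I_N.+1 * 'I_K * option bool)%type.

(* Cell j of the tape stores the j-th element of every stack; a plain bit, as in the input,
   is a cell in which only stack 0 is nonempty. *)
Definition dec (s : sym) (r : 'I_K) : option bool :=
  match s with
  | None => None
  | Some (inl b) => if r == ord0 then Some b else None
  | Some (inr f) => f r
  end.

Definition setc (s : sym) (r : 'I_K) (v : option bool) : sym :=
  Some (inr [ffun k => if k == r then v else dec s k]).

(** The phases are: run, push, return, pop rightwards, pop leftwards, accept, reject. A push shifts
    a track one cell to the right, carrying the displaced bit in the state, and then returns; a pop
    goes to the right end and shifts the track on its way back. The phase run always scans cell 0,
    the blank on its left being the marker for the return. *)
Definition mk (ph : 'I_7) (pc r : nat) (c : option bool) : state := (ph, inord pc, inord r, c).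
Definition qRun (pc : nat) : state := mk (@Ordinal 7 0 isT) pc 0 None.
Definition qPush pc r c : state := mk (@Ordinal 7 1 isT) pc r c.
Definition qRet pc : state := mk (@Ordinal 7 2 isT) pc 0 None.
Definition qPopR pc r : state := mk (@Ordinal 7 3 isT) pc r None.
Definition qPopL pc r c : state := mk (@Ordinal 7 4 isT) pc r c.
Definition qAcc : state := mk (@Ordinal 7 5 isT) 0 0 None.
Definition qRej : state := mk (@Ordinal 7 6 isT) 0 0 None.

Definition delta (coin : bool) (q : state) (s : sym) : state * sym * move :=
  let: (ph, pc, r, c) := q in
  match (ph : nat) with
  | 0 => match nth (IHalt false) code pc with
         | IPush r' b n => (qPush n r' (Some b), s, MoveStay)
         | IFlip r' n => (qPush n r' (Some coin), s, MoveStay)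
         | IPop r' n => (qPopR n r', s, MoveStay)
         | IBr r' n1 n0 nE => (qRun (match dec s (inord r') with
             | Some true => n1 | Some false => n0 | None => nE end), s, MoveStay)
         | IHalt b => (if b then qAcc else qRej, s, MoveStay)
         end
  | 1 => if s is None then (qRet pc, if c is None then None else setc None r c, MoveLeft)
         else (qPush pc r (dec s r), setc s r c, MoveRight)
  | 2 => if s is None then (qRun pc, None, MoveRight) else (q, s, MoveLeft)
  | 3 => if s is None then (qPopL pc r None, None, MoveLeft) else (q, s, MoveRight)
  | 4 => if s is None then (qRun pc, None, MoveRight)
         else (qPopL pc r (dec s r), setc s r c, MoveLeft)
  | _ => (q, s, MoveStay)
  end.

Lemma acc_rej : qAcc != qRej.
Proof. by rewrite !xpair_eqE. Qed.

Definition stack_ptm : PTM := @Build_PTM state track (qRun 0) qAcc qRej acc_rej delta.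
Let step := @ptm_step stack_ptm.

Lemma inord_id n (i : 'I_n.+1) : inord i = i.
Proof. exact: inord_val. Qed.

Lemma not_halted (ph : 'I_7) pc r c tp : ph < 5 -> @ptm_halted stack_ptm ((ph, pc, r, c), tp) = false.
Proof.
move=> h; rewrite /ptm_halted /= !xpair_eqE -!andbA -!val_eqE /=.
have -> : (ph == 5 :> nat) = false by lia.
by have -> : (ph == 6 :> nat) = false by lia.
Qed.

Lemma stepE (ph : 'I_7) pc r c l s rr coin : ph < 5 ->
  step ((ph, pc, r, c), (l, s :: rr)) coin =
  let: (q', a, d) := delta coin (ph, pc, r, c) s in (q', @tape_move stack_ptm d (l, a :: rr)).
Proof. by move=> h; rewrite /step /ptm_step not_halted. Qed.

Lemma stepE0 (ph : 'I_7) pc r c l coin : ph < 5 ->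
  step ((ph, pc, r, c), (l, [::])) coin =
  let: (q', a, d) := delta coin (ph, pc, r, c) None in (q', @tape_move stack_ptm d (l, [:: a])).
Proof. by move=> h; rewrite /step /ptm_step not_halted. Qed.

Ltac mstep := rewrite /qRun /qPush /qRet /qPopR /qPopL /mk ?inord_id ?stepE ?stepE0 //=
  /qRun /qPush /qRet /qPopR /qPopL /mk ?inord_id //.

Variable R : realType.
Local Open Scope ring_scope.

(** Asking for every number of coins from T on makes the bound monotone in T and lets steps be
    composed. *)
Definition tmv (c : ptm_config stack_ptm) (v : R) (T : nat) : Prop := forall n, (T <= n)%N ->
  (forall s : seq bool, size s = n -> ptm_halted (foldl step c s)) /\
  bits_prob R n (fun s => ptm_accepting (foldl step c s)) = v.

Lemma tmv_coin c (v : bool -> R) T : (forall b, tmv (step c b) (v b) T) ->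
  tmv c ((v false + v true) / 2) T.+1.
Proof.
move=> h [|n] // Tn; split.
  by case=> // b s [sn]; have [h1 _] := h b n Tn; apply: h1.
by rewrite /=; have [_ ->] := h false n Tn; have [_ ->] := h true n Tn.
Qed.

(** A step that ignores its coin is a flip between two equal values. *)
Lemma tmv_det c c' v T : (forall b, step c b = c') -> tmv c' v T -> tmv c v T.+1.
Proof.
move=> e h; have -> : v = (v + v) / 2 by field.
by apply: (@tmv_coin _ (fun=> v)) => b; rewrite e.
Qed.

Lemma tmv_mono c v T T' : (T <= T')%N -> tmv c v T -> tmv c v T'.
Proof. by move=> TT h n Tn; apply: h; apply: leq_trans Tn. Qed.

Lemma bits_prob_const n b : bits_prob R n (fun=> b) = b%:R.
Proof. by elim: n => //= n ->; field. Qed.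

Lemma tmv_halt c : ptm_halted c -> tmv c (ptm_accepting c)%:R 0.
Proof.
move=> hc n _; have e s : foldl step c s = c.
  elim: s => //= b s IH; have -> : step c b = c by rewrite /step /ptm_step hc.
  by [].
split=> [s _|]; first by rewrite e.
rewrite -(bits_prob_const n); congr bits_prob.
by apply: funext => s; rewrite e.
Qed.

Local Close Scope ring_scope.

Definition blank (l : seq sym) := all (fun s => ~~ isSome s) l.

Lemma blank_head l : blank l -> head None l = None /\ blank (behead l).
Proof. by case: l => [|[s|] l] //= /andP[]. Qed.

Lemma ret_sweep pc ls bl rr v T : all isSome ls -> blank bl ->
  tmv (qRun pc, (None :: behead bl, rev ls ++ rr)) v T ->
  tmv (qRet pc, @tape_move stack_ptm MoveLeft (ls ++ bl, rr)) v (T + size ls).+1.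
Proof.
elim: ls rr => [|x ls IH] rr /=.
  move=> _ /blank_head[-> bb] h; rewrite addn0; apply: tmv_det h => b.
  by mstep.
case: x => // s /= lsS hb h; rewrite addnS; apply: tmv_det (IH _ lsS hb _).
  by move=> b; rewrite stepE.
by move: h; rewrite rev_cons cat_rcons.
Qed.

Fixpoint popl (r : 'I_K) (c : option bool) (ls rr : seq sym) : seq sym :=
  if ls is x :: ls' then popl r (dec x r) ls' (setc x r c :: rr) else rr.

Lemma popl_sweep pc (r : 'I_K) c ls bl rr v T : all isSome ls -> blank bl ->
  tmv (qRun pc, (None :: behead bl, popl r c ls rr)) v T ->
  tmv (qPopL pc r c, @tape_move stack_ptm MoveLeft (ls ++ bl, rr)) v (T + size ls).+1.
Proof.
elim: ls c rr => [|x ls IH] c rr /=.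
  move=> _ /blank_head[-> bb] h; rewrite addn0; apply: tmv_det h => b.
  by mstep.
case: x => // s /= lsS hb h; rewrite addnS; apply: tmv_det (IH (dec (Some s) r) _ lsS hb h).
by move=> b; mstep.
Qed.

Fixpoint shr (r : 'I_K) (c : option bool) (cells : seq sym) : seq sym :=
  if cells is x :: cs then setc x r c :: shr r (dec x r) cs else [::].
Fixpoint shr_out (r : 'I_K) (c : option bool) (cells : seq sym) : option bool :=
  if cells is x :: cs then shr_out r (dec x r) cs else c.

Lemma push_sweep pc (r : 'I_K) c cells bl l v T : all isSome cells -> blank bl ->
  tmv (qRet pc, @tape_move stack_ptm MoveLeft (rev (shr r c cells) ++ l,
     (if shr_out r c cells is None then None else setc None r (shr_out r c cells)) :: behead bl)) v T ->
  tmv (qPush pc r c, (l, cells ++ bl)) v (T + size cells).+1.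
Proof.
elim: cells c l => [|x cs IH] c l /=.
  move=> _; rewrite addn0; case: bl => [|[s|] bl] //= _ h; apply: tmv_det h => b.
    by mstep; case: c.
  by mstep; case: c.
case: x => // s /= csS hb h; rewrite addnS; apply: tmv_det (IH (dec (Some s) r) (setc (Some s) r c :: l) csS hb _).
  by move=> b; mstep.
by move: h; rewrite rev_cons cat_rcons.
Qed.

Lemma popr_sweep pc (r : 'I_K) cells bl l v T : all isSome cells -> blank bl ->
  tmv (qPopL pc r None, @tape_move stack_ptm MoveLeft (rev cells ++ l, None :: behead bl)) v T ->
  tmv (qPopR pc r, (l, cells ++ bl)) v (T + size cells).+1.
Proof.
elim: cells l => [|x cs IH] l /=.
  move=> _; rewrite addn0; case: bl => [|[s|] bl] //= _ h; apply: tmv_det h => b.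
    by mstep.
  by mstep.
case: x => // s /= csS hb h; rewrite addnS; apply: tmv_det (IH _ csS hb _).
  by move=> b; rewrite stepE.
by move: h; rewrite rev_cons cat_rcons.
Qed.

Lemma size_shr r c cells : size (shr r c cells) = size cells.
Proof. by elim: cells c => //= x cs IH c; rewrite IH. Qed.

Lemma shr_some r c cells : all isSome (shr r c cells).
Proof. by elim: cells c => //= x cs IH c. Qed.

Definition pushed r c cells :=
  shr r c cells ++ (if shr_out r c cells is None then [::] else [:: setc None r (shr_out r c cells)]).

Lemma dec_pushed r c cells k j : dec (nth None (pushed r c cells) j) k =
  if k == r then (if j is i.+1 then dec (nth None cells i) r else c) else dec (nth None cells j) k.
Proof.
rewrite /pushed; elim: cells c j => [|x cs IH] c j /=.
  case: c => [b|]; last by rewrite !nth_nil /=; case: eqP; case: j => // *; rewrite nth_nil.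
  by case: j => [|j] /=; rewrite ?ffunE ?nth_nil //=; case: eqP.
case: j => [|j] /=; first by rewrite ffunE.
by rewrite IH; case: eqP => // _; case: j.
Qed.

Fixpoint shl (r : 'I_K) (c : option bool) (cells : seq sym) : seq sym :=
  if cells is x :: cs then setc x r (if cs is y :: _ then dec y r else c) :: shl r c cs else [::].

Lemma popl_rev r c cells rr : popl r c (rev cells) rr = shl r c cells ++ rr.
Proof.
elim/last_ind: cells c rr => [|cs x IH] c rr //; rewrite rev_rcons /= IH.
suff -> : shl r c (rcons cs x) = rcons (shl r (dec x r) cs) (setc x r c) by rewrite cat_rcons.
by elim: cs {IH} => //= y [|z cs] //= ->.
Qed.

Lemma dec_shl r cells k j : dec (nth None (shl r None cells) j) k =
  if k == r then dec (nth None cells j.+1) r else dec (nth None cells j) k.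
Proof.
elim: cells j => [|x cs IH] j /=; first by rewrite !nth_nil; case: eqP.
case: j => [|j] /=; first by rewrite ffunE; case: cs {IH} => [|y cs] //=; case: eqP.
by rewrite IH.
Qed.

Lemma size_shl r c cells : size (shl r c cells) = size cells.
Proof. by elim: cells => //= x cs ->. Qed.

Lemma shl_some r c cells : all isSome (shl r c cells).
Proof. by elim: cells => //= x cs IH. Qed.

Definition encodes (A i : nat) (st : store) (cfg : ptm_config stack_ptm) : Prop :=
  exists l cells bl, [/\ cfg = (qRun i, (l, cells ++ bl)), blank l /\ blank bl, all isSome cells,
    size cells <= A & forall (r : 'I_K) j, dec (nth None cells j) r = nth None (map Some (st r)) j].

Definition fv (A i : nat) (st : store) (v : R) (T : nat) : Prop :=
  forall cfg, encodes A i st cfg -> tmv cfg v T.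

(** Two sweeps over at most [A] cells, and a constant for the turns at the ends. *)
Definition stepcost (A : nat) := 2 * A + 6.

Lemma fv_mono A i st v T T' : T <= T' -> fv A i st v T -> fv A i st v T'.
Proof. by move=> TT h cfg /h; apply: tmv_mono. Qed.

Lemma push_cost T s A : s <= A -> ((T + s).+1 + s).+1 <= (T + stepcost A).-1.
Proof. by rewrite /stepcost; lia. Qed.

Lemma pop_cost T s A : s <= A -> ((T + s).+1 + s).+2 <= T + stepcost A.
Proof. by rewrite /stepcost; lia. Qed.

Lemma stepcostK T A : T + stepcost A = (T + stepcost A).-1.+1.
Proof. by rewrite /stepcost; lia. Qed.

Section Instructions.
Variables (A i : nat) (st : store).
Hypothesis iN : i < N.
Let iE : (inord i : 'I_N.+1) = i :> nat := inordK (leqW iN).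

Lemma enc_push cells r b n (v : R) T : r < K -> all isSome cells -> size cells <= A -> size (st r) < A ->
  (forall (k : 'I_K) j, dec (nth None cells j) k = nth None (map Some (st k)) j) ->
  fv A n (upd st r (b :: st r)) v T -> forall l bl, blank l -> blank bl ->
  tmv (qPush n r (Some b), (l, cells ++ bl)) v (T + stepcost A).-1.
Proof.
move=> rK cS cA sA hd h l bl hl hb.
have rE : (inord r : 'I_K) = r :> nat by rewrite inordK.
pose r' : 'I_K := inord r.
have -> : qPush n r (Some b) = qPush n r' (Some b) by rewrite /qPush /mk inord_id.
have hp : all isSome (pushed r' (Some b) cells).
  by rewrite /pushed all_cat shr_some; case: shr_out.
(* The tape grows only if the bottom of stack r moves into a new cell, and the height of this stack
   was below A before the push. *)
have sp : size (pushed r' (Some b) cells) <= A.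
  rewrite leqNgt; apply/negP => hA.
  have [x ex] : exists x, dec (nth None (pushed r' (Some b) cells) A) r' = Some x.
    have : isSome (nth None (pushed r' (Some b) cells) A) by move/all_nthP: hp; apply.
    have := hA; rewrite /pushed size_cat size_shr nth_cat size_shr.
    case e: (shr_out r' (Some b) cells) => [x|] /=; last by rewrite addn0; lia.
    rewrite addn1 ltnS => hA' _; have eA : A = size cells by apply/eqP; rewrite eqn_leq hA' cA.
    rewrite eA ltnn subnn.
    by exists x; rewrite /= ffunE eqxx.
  move: ex; rewrite dec_pushed eqxx; case: (A) sA => // A' sA; rewrite hd nth_default //.
  by rewrite size_map rE; lia.
have rs := ret_sweep (pc := n) (ls := rev (shr r' (Some b) cells)) (bl := l)
  (rr := (if shr_out r' (Some b) cells is None then None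
          else setc None r' (shr_out r' (Some b) cells)) :: behead bl) (v := v) (T := T).
rewrite all_rev shr_some size_rev size_shr revK in rs.
have ps := @push_sweep n r' (Some b) cells bl l v _ cS hb (rs isT hl _).
apply: tmv_mono (ps _); first exact: push_cost.
apply: h; exists (None :: behead l).
have [_ hl'] := blank_head hl; have [_ hb'] := blank_head hb.
have dp (k : 'I_K) j : dec (nth None (pushed r' (Some b) cells) j) k =
    nth None (map Some (upd st r (b :: st r) k)) j.
  rewrite dec_pushed /upd -rE; case: (eqVneq k r') => [->|kr]; last first.
    by rewrite ifF ?hd //; apply/negP => /eqP/ord_inj/eqP; rewrite (negPf kr).
  by rewrite eqxx; case: j => [|j] //=; rewrite hd rE.
exists (pushed r' (Some b) cells).
case e: (shr_out r' (Some b) cells) => [x|].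
  exists (behead bl); split=> //; rewrite /pushed e -catA //.
exists (None :: behead bl); split=> //; by rewrite /pushed e cats0.
Qed.

(** Scanning beyond the end of the list writes an explicit blank, which is why [bl] may change. *)
Lemma run_stay l cells bl : blank bl -> exists2 bl', blank bl' & forall coin,
  step (qRun i, (l, cells ++ bl)) coin =
  ((delta coin (qRun i) (head None (cells ++ bl))).1.1, (l, cells ++ bl')).
Proof.
have sE a rr coin : step (qRun i, (l, a :: rr)) coin = ((delta coin (qRun i) a).1.1, (l, a :: rr)).
  by rewrite /qRun /mk stepE //= iE; case: (nth _ _ _).
case: cells => [|x cs] hb; last by exists bl => // coin; rewrite /= sE.
case: bl hb => [|y bl] hb; last by exists (y :: bl) => // coin; rewrite /= sE.
by exists [:: None] => // coin; rewrite /= -sE /qRun /mk stepE0 ?stepE.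
Qed.

Lemma deltaRun coin s : (delta coin (qRun i) s).1.1 =
  match nth (IHalt false) code i with
  | IPush r' b n => qPush n r' (Some b)
  | IFlip r' n => qPush n r' (Some coin)
  | IPop r' n => qPopR n r'
  | IBr r' n1 n0 nE => qRun (match dec s (inord r') with
      | Some true => n1 | Some false => n0 | None => nE end)
  | IHalt b => if b then qAcc else qRej
  end.
Proof. by rewrite /= iE; case: (nth _ _ _). Qed.

Lemma fv_push r b n v T : nth (IHalt false) code i = IPush r b n -> r < K -> size (st r) < A ->
  fv A n (upd st r (b :: st r)) v T -> fv A i st v (T + stepcost A).
Proof.
move=> ci rK sA h _ [l [cells [bl [-> [hl hb] cS cA hd]]]].
have [bl' hb' hs] := run_stay l cells hb.
have h1 := enc_push rK cS cA sA hd h hl hb'; rewrite stepcostK.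
by apply: tmv_det h1 => coin; rewrite hs deltaRun ci.
Qed.

Lemma fv_flip r n (v : bool -> R) T : nth (IHalt false) code i = IFlip r n -> r < K ->
  size (st r) < A -> (forall b, fv A n (upd st r (b :: st r)) (v b) T) ->
  fv A i st ((v false + v true) / 2)%R (T + stepcost A).
Proof.
move=> ci rK sA h _ [l [cells [bl [-> [hl hb] cS cA hd]]]].
have [bl' hb' hs] := run_stay l cells hb.
have h1 b := enc_push rK cS cA sA hd (h b) hl hb'.
rewrite stepcostK.
by apply: tmv_coin => coin; rewrite hs deltaRun ci.
Qed.

Lemma fv_pop r n v T : nth (IHalt false) code i = IPop r n -> r < K ->
  fv A n (upd st r (behead (st r))) v T -> fv A i st v (T + stepcost A).
Proof.
move=> ci rK h _ [l [cells [bl [-> [hl hb] cS cA hd]]]].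
have [bl' hb' hs] := run_stay l cells hb.
have rE : (inord r : 'I_K) = r :> nat by rewrite inordK.
pose r' : 'I_K := inord r.
have ps := @popl_sweep n r' None (rev cells) l (None :: behead bl') v T.
rewrite all_rev size_rev popl_rev in ps.
have pr := @popr_sweep n r' cells bl' l v _ cS hb' (ps cS hl _).
have h1 : tmv (qPopR n r', (l, cells ++ bl')) v ((T + size cells).+1 + size cells).+1.
  apply: pr.
  apply: h; exists (None :: behead l), (shl r' None cells), (None :: behead bl').
  have [_ hl'] := blank_head hl; have [_ hb''] := blank_head hb'.
  split=> //; rewrite ?size_shl ?shl_some // => k j.
  rewrite dec_shl /upd; case: (eqVneq k r') => [->|kr].
    have r'E : r' = r :> nat by [].
    by rewrite hd r'E eqxx; case: (st r) => //=; rewrite nth_nil.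
  have -> : (k == r :> nat) = false; last by rewrite hd.
  by apply/negP => /eqP kr'; move/eqP: kr; apply; apply: ord_inj; rewrite kr' rE.
apply: tmv_mono (pop_cost T cA) _.
apply: (tmv_det (c' := (qPopR n r', (l, cells ++ bl')))) => [coin|].
  by rewrite hs deltaRun ci /qPopR /mk inord_id.
exact: h1.
Qed.

Lemma fv_br r n1 n0 nE v T : nth (IHalt false) code i = IBr r n1 n0 nE -> r < K ->
  fv A (match st r with true :: _ => n1 | false :: _ => n0 | [::] => nE end) st v T ->
  fv A i st v (T + stepcost A).
Proof.
move=> ci rK h _ [l [cells [bl [-> [hl hb] cS cA hd]]]].
have [bl' hb' hs] := run_stay l cells hb.
have rE : (inord r : 'I_K) = r :> nat by rewrite inordK.
apply: (@tmv_mono _ _ T.+1); first by rewrite /stepcost; lia.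
have e : dec (head None (cells ++ bl)) (inord r) = nth None (map Some (st r)) 0.
  rewrite -{2}rE -hd; case: (cells) => [|x cs] //=; by have [->] := blank_head hb.
apply: tmv_det (h _ _) => [coin|]; first by rewrite hs deltaRun ci e.
by exists l, cells, bl'; split=> //; case: (st r) => [|[] ?].
Qed.

Lemma fv_halt b : nth (IHalt false) code i = IHalt b -> fv A i st b%:R (stepcost A).
Proof.
move=> ci _ [l [cells [bl [-> [hl hb] cS cA hd]]]].
have [bl' hb' hs] := run_stay l cells hb.
apply: (@tmv_mono _ _ 1); first by rewrite /stepcost; lia.
apply: (tmv_det (c' := (if b then qAcc else qRej, (l, cells ++ bl')))) => [coin|].
  by rewrite hs deltaRun ci.
have := @tmv_halt (if b then qAcc else qRej, (l, cells ++ bl')).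
rewrite /ptm_halted /ptm_accepting /=; case: b {ci}; rewrite eqxx ?orbT; first exact.
by rewrite eq_sym (negPf acc_rej); exact.
Qed.

End Instructions.
End Machine.

(** * Predicate transformers and machine code *)

Section Transformer.
Variables (R : realType) (A : nat).

Fixpoint wl (W : (store -> R -> Prop) -> store -> R -> Prop) (r : nat) (Q : store -> R -> Prop)
    (n : nat) (st : store) (v : R) : Prop :=
  if st r is [::] then Q st v else
  if n is m.+1 then W (fun s u => wl W r Q m (upd s r (behead (s r))) u) st v else False.

(* wp c Q st v: on stacks of height at most A, the expected value v at st is obtained by
   running c and then reading the value at the resulting store off Q; a flip averages. The
   queries of c are answered by true. *)
Fixpoint wp (c : cmd) (Q : store -> R -> Prop) : store -> R -> Prop :=
  match c with
  | CSkip => Q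
  | CPush r b => fun st v => size (st r) < A /\ Q (upd st r (b :: st r)) v
  | CPop r => fun st v => Q (upd st r (behead (st r))) v
  | CSeq c d => wp c (wp d Q)
  | CIf r c1 c0 cE => fun st v =>
      match st r with
      | true :: _ => wp c1 Q st v
      | false :: _ => wp c0 Q st v
      | [::] => wp cE Q st v
      end
  | CFor r c => wl (wp c) r Q A
  | CAsk r d => fun st v => size (st d) < A /\ Q (upd st d (true :: st d)) v
  | CFlip r => fun st v => size (st r) < A /\
      exists2 u : bool -> R, v = ((u false + u true) / 2)%R &
        forall b, Q (upd st r (b :: st r)) (u b)
  end.

(** Brings the deterministic routines, verified with [runs], into the probabilistic semantics. Flips
    are excluded since [exec] fails on them, and the constant oracle matches the treatment of [CAsk]
    in [wp]. *)
Lemma wp_exec c Q st st' v : wf c -> exec (fun=> true) A c st = Some st' -> Q st' v ->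
  wp c Q st v.
Proof.
elim: c Q st st' v => [|r b|r|c IHc d IHd|r c1 IH1 c0 IH0 cE IHE|r c IH|r d|r] Q st st' v /=.
- by move=> _ [->].
- by move=> _; rewrite /opush; case: ifP => // h [<-].
- by move=> _ [<-].
- move=> /andP[wc wd]; case e: (exec _ _ c st) => [s|] //= h q.
  by apply: (IHc _ _ s) => //; apply: IHd h q.
- by move=> /and3P[w1 w0 wE]; case: (st r) => [|[] w] h q;
    [exact: IHE h q|exact: IH1 h q|exact: IH0 h q].
- move=> /andP[wr wc]; case: ifP => // sA h q.
  suff H n : forall m s, size (s r) = n -> n <= m ->
      loop (exec (fun=> true) A c) r n s = Some st' -> wl (wp c) r Q m s v.
    exact: (H (size (st r))).
  elim: n => [|n IHn] m s sn nm /=.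
    by move=> [es]; move: q; rewrite -es => q; case: m {nm} => [|m] /=; rewrite (size0nil sn).
  case e: (exec _ _ c s) => [s1|] //= hl; case: m nm => // m nm /=.
  case es: (s r) sn => [|b w] // sn; apply: (IH _ _ s1) => //.
  apply: IHn => //; rewrite updE size_behead (exec_writes e wr) es; by rewrite sn.
- by move=> _; case: ifP => // _; rewrite /opush; case: ifP => // h [<-].
- by [].
Qed.

Fixpoint cost (c : cmd) : nat :=
  match c with
  | CSkip => 0
  | CPush _ _ | CPop _ | CAsk _ _ | CFlip _ => 1
  | CSeq c d => cost c + cost d
  | CIf _ c1 c0 cE => cost c1 + cost c0 + cost cE + 2
  | CFor _ c => A * (cost c + 2) + 1
  end.

End Transformer.

Fixpoint clen (c : cmd) : nat :=
  match c with
  | CSkip => 0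
  | CPush _ _ | CPop _ | CAsk _ _ | CFlip _ => 1
  | CSeq c d => clen c + clen d
  | CIf _ c1 c0 cE => clen c1 + clen c0 + clen cE + 3
  | CFor _ c => clen c + 2
  end.

(** [IBr 0 e e e] is an unconditional jump. *)
Fixpoint flat (c : cmd) (i : nat) : seq instr :=
  match c with
  | CSkip => [::]
  | CPush r b => [:: IPush r b i.+1]
  | CPop r => [:: IPop r i.+1]
  | CAsk r d => [:: IPush d true i.+1]
  | CFlip r => [:: IFlip r i.+1]
  | CSeq c d => flat c i ++ flat d (i + clen c)
  | CIf r c1 c0 cE =>
      let i0 := (i.+1 + clen c1).+1 in
      let iE := (i0 + clen c0).+1 in
      let e := iE + clen cE in
      IBr r i.+1 i0 iE :: flat c1 i.+1 ++ IBr 0 e e e :: flat c0 i0 ++ IBr 0 e e e :: flat cE iE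
  | CFor r c => IBr r i.+1 i.+1 (i + (clen c + 2)) :: flat c i.+1 ++ [:: IPop r i]
  end.

Lemma size_flat c i : size (flat c i) = clen c.
Proof.
elim: c i => //= [c IHc d IHd|r c1 IH1 c0 IH0 cE IHE|r c IH] i.
- by rewrite size_cat IHc IHd.
- by rewrite !(size_cat, size_rcons) /= size_cat /= IH1 IH0 IHE; lia.
- by rewrite size_cat /= IH; lia.
Qed.

Definition occurs_at (code : seq instr) (i : nat) (l : seq instr) :=
  exists pre post, code = pre ++ l ++ post /\ size pre = i.

Lemma at_cat code i l1 l2 : occurs_at code i (l1 ++ l2) ->
  occurs_at code i l1 /\ occurs_at code (i + size l1) l2.
Proof.
move=> [pre [post [-> <-]]]; split; first by exists pre, (l2 ++ post); rewrite !catA.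
by exists (pre ++ l1), post; rewrite !catA size_cat.
Qed.

Lemma at_cons code i x l : occurs_at code i (x :: l) ->
  [/\ nth (IHalt false) code i = x, i < size code & occurs_at code i.+1 l].
Proof.
move=> [pre [post [-> <-]]]; split; first by rewrite nth_cat ltnn subnn.
  by rewrite size_cat /= -addn1 leq_add2l.
by exists (rcons pre x), post; rewrite cat_rcons size_rcons.
Qed.

Lemma flat_ok (R : realType) A K1 code c i (Q : store -> R -> Prop) st v T :
  occurs_at code i (flat c i) -> regs c <= K1.+1 -> wp A c Q st v ->
  (forall st v, Q st v -> fv K1 code A (i + clen c) st v T) ->
  fv K1 code A i st v (T + cost A c * stepcost A).
Proof.
set s := stepcost A.
elim: c i Q st v T => [|r b|r|c IHc d IHd|r c1 IH1 c0 IH0 cE IHE|r c IH|r d|r] i Q st v T /= ha hr.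
- by move=> h hQ; move: (hQ _ _ h); rewrite mul0n !addn0.
- move=> [sA h] hQ; have [ci iN _] := at_cons ha; rewrite mul1n.
  by apply: (fv_push iN ci hr sA); move: (hQ _ _ h); rewrite addn1.
- move=> h hQ; have [ci iN _] := at_cons ha; rewrite mul1n.
  by apply: (fv_pop iN ci hr); move: (hQ _ _ h); rewrite addn1.
- move=> h hQ; have [a1 a2] := at_cat ha; rewrite size_flat in a2.
  move: hr; rewrite geq_max => /andP[h1 h2].
  rewrite mulnDl addnA [T + _ + _]addnAC; apply: (IHc _ _ _ _ _ a1 h1 h) => st' v' h'.
  by apply: (IHd _ _ _ _ _ a2 h2 h') => st'' v'' h''; rewrite -addnA; apply: hQ.
- move=> h hQ; have [ci iN ha1] := at_cons ha.
  have [a1 ha2] := at_cat ha1; rewrite size_flat in ha2.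
  have [cj1 j1N ha3] := at_cons ha2; have [a0 ha4] := at_cat ha3; rewrite size_flat in ha4.
  have [cj0 j0N aE] := at_cons ha4.
  move: hr; rewrite !geq_max => /and4P[hr h1 h0 hE].
  set i0 := (i.+1 + clen c1).+1 in ci cj1 j1N a0 ha4 cj0 j0N aE *.
  set iE := (i0 + clen c0).+1 in ci cj1 cj0 j0N aE *.
  set e := iE + clen cE in cj1 cj0.
  have ee : i + (clen c1 + clen c0 + clen cE + 3) = e by rewrite /e /iE /i0; lia.
  have {}hQ st' v' : Q st' v' -> fv K1 code A e st' v' T by rewrite -ee; apply: hQ.
  have jmp j : nth (IHalt false) code j = IBr 0 e e e -> j < size code ->
      forall st v, Q st v -> fv K1 code A j st v (T + s).
    move=> cj jN st' v' h'; apply: (fv_br jN cj (ltn0Sn _)).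
    by case: (st' 0) => [|[] ?]; apply: hQ.
  rewrite addn2 mulSnr addnA; apply: (fv_br iN ci hr).
  have bd x y : x <= y -> T + x * s <= T + y * s.
    by move=> xy; rewrite leq_add2l leq_mul2r xy orbT.
  case: (st r) h => [|[] w] h.
  + by apply: fv_mono (IHE _ _ _ _ _ aE hE h hQ); apply: bd; lia.
  + apply: fv_mono (IH1 _ _ _ _ _ a1 h1 h (jmp _ cj1 j1N)).
    by rewrite -addnA -mulSn; apply: bd; lia.
  + apply: fv_mono (IH0 _ _ _ _ _ a0 h0 h (jmp _ cj0 j0N)).
    by rewrite -addnA -mulSn; apply: bd; lia.
- move=> h hQ; have [ci iN ha1] := at_cons ha.
  have [a1 ha2] := at_cat ha1; rewrite size_flat in ha2.
  have [cp pN _] := at_cons ha2.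
  move: hr; rewrite geq_max => /andP[hr hc].
  suff H n : forall st v, wl (wp A c) r Q n st v ->
      fv K1 code A i st v (T + (n * (cost A c + 2) + 1) * s) by apply: H.
  elim: n => [|n IHn] st' v' h'; rewrite addn1 mulSnr addnA; apply: (fv_br iN ci hr);
    move: h' => /=; case e: (st' r) => [|b w] h' //.
  + by apply: fv_mono (hQ _ _ h'); rewrite leq_addr.
  + by apply: fv_mono (hQ _ _ h'); rewrite leq_addr.
  have -> : (if b then i.+1 else i.+1) = i.+1 by case: (b).
  apply: (fv_mono (T := T + (n * (cost A c + 2) + 1) * s + s + cost A c * s)).
    by rewrite mulSn; move: (n * _) => x; rewrite !mulnDl mul1n; lia.
  apply: (IH _ _ _ _ _ a1 hc h') => st2 v2 h2.
  exact: (fv_pop pN cp hr (IHn _ _ h2)).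
- move=> [sA h] hQ; have [ci iN _] := at_cons ha; rewrite mul1n.
  move: hr; rewrite geq_max => /andP[_ hr].
  by apply: (fv_push iN ci hr sA); move: (hQ _ _ h); rewrite addn1.
- move=> [sA [u -> hu]] hQ; have [ci iN _] := at_cons ha; rewrite mul1n.
  by apply: (fv_flip iN ci hr sA) => b; move: (hQ _ _ (hu b)); rewrite addn1.
Qed.

(** * Answering the queries by coin flips *)

(** An evaluation makes finitely many queries; hence the events about its value are open, and
    measurable. *)
Lemma ev_continuous p : forall o e, exists S : seq word, forall o' : word -> bool,
  (forall s, s \in S -> o' s = o s) -> ev p o' e = ev p o e.
Proof.
elim: p => /= [n||b p IH|p IHp q IHq|p IHp q IHq|p IH|x IHx i IHi h0 IH0 h1 IH1 bd IHb] o e.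
- by exists [::].
- by exists [::].
- by have [S hS] := IH o e; exists S => o' /hS ->.
- have [S hS] := IHp o e; have [S' hS'] := IHq o e; exists (S ++ S') => o' h.
  by rewrite hS ?hS' // => s sS; apply: h; rewrite mem_cat sS ?orbT.
- have [S hS] := IHp o e; have [S' hS'] := IHq o e; exists (S ++ S') => o' h.
  by rewrite hS ?hS' // => s sS; apply: h; rewrite mem_cat sS ?orbT.
- have [S hS] := IH o e; exists (ev p o e :: S) => o' h.
  by rewrite hS ?h ?mem_head // => s sS; apply: h; rewrite inE sS orbT.
- have hr (X : word) : forall m s pre, exists S : seq word, forall o' : word -> bool,
      (forall s, s \in S -> o' s = o s) ->
      recw (fun b s pre => ev (if b then h1 else h0) o' (dcons s (dcons pre e))) m s pre X =
      recw (fun b s pre => ev (if b then h1 else h0) o (dcons s (dcons pre e))) m s pre X.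
    elim: X => [|b X IHX] m s pre /=; first by exists [::].
    have [S hS] : exists S : seq word, forall o' : word -> bool, (forall s, s \in S -> o' s = o s) ->
        ev (if b then h1 else h0) o' (dcons s (dcons pre e)) =
        ev (if b then h1 else h0) o (dcons s (dcons pre e)).
      by case: (b); [exact: IH1|exact: IH0].
    have [S' hS'] := IHX m (take m (ev (if b then h1 else h0) o (dcons s (dcons pre e)))) (rcons pre b).
    by exists (S ++ S') => o' h; rewrite hS ?hS' // => t tS; apply: h; rewrite mem_cat tS ?orbT.
  have [S1 e1] := IHx o e; have [S2 e2] := IHi o e; have [S3 e3] := IHb o e.
  have [S4 e4] := hr (ev x o e) (size (ev bd o e)) (take (size (ev bd o e)) (ev i o e)) [::].
  exists (S1 ++ S2 ++ S3 ++ S4) => o' h.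
  by rewrite e1 ?e2 ?e3 ?e4 // => t tS; apply: h; rewrite !mem_cat tS ?orbT.
Qed.

Fixpoint enc (l : log) : word :=
  if l is qb :: l' then pair2 qb.1 (pair2 [:: qb.2] (enc l')) else [::].

Fixpoint lookup (l : log) (q : word) : word :=
  if l is qb :: l' then (if qb.1 == q then [:: qb.2] else lookup l' q) else [::].

Lemma lookupP l q : (exists2 b, lookup l q = [:: b] & (q, b) \in l) \/
  (lookup l q = [::] /\ q \notin map fst l).
Proof.
elim: l => [|[q' b] l IH] /=; first by right.
rewrite !inE /= [q == q']eq_sym; case: (eqVneq q' q) => [->|qq].
  by left; exists b => //; rewrite mem_head.
case: IH => [[c -> h]|[-> h]]; last by right.
by left; exists c => //; rewrite inE h orbT.
Qed.

Lemma size_enc_ge l : size l <= size (enc l).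
Proof. by elim: l => //= qb l IH; rewrite !size_pair2; lia. Qed.

Lemma size_enc_le l B : all (fun qb => size qb.1 <= B) l -> size (enc l) <= size l * (2 * B + 4).
Proof.
elim: l => // qb l IH; rewrite [all _ _]/= => /andP[hq /IH {}IH].
have -> : enc (qb :: l) = pair2 qb.1 (pair2 [:: qb.2] (enc l)) by [].
have -> : size (qb :: l) = (size l).+1 by [].
rewrite mulSn !size_pair2 (_ : size [:: qb.2] = 1) //.
by move: (size l * _) IH => y IH; lia.
Qed.

(** The state is the part of the encoded log not yet discarded; it stops changing at an entry for
    [q]. *)
Definition look_step (q s : word) : word :=
  if s == [::] then [::] else if fst2 s == q then s else snd2 (snd2 s).

Lemma look_step_pair q q' b w : look_step q (pair2 q' (pair2 [:: b] w)) =
  if q' == q then pair2 q' (pair2 [:: b] w) else w.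
Proof. by rewrite /look_step -size_eq0 size_pair2 fst_pair !snd_pair. Qed.

Lemma look_iter l q n : size l <= n ->
  fst2 (snd2 (iter n (look_step q) (enc l))) = lookup l q.
Proof.
elim: l n => [|[q' b] l IH] n /=.
  by move=> _; have -> : iter n (look_step q) [::] = [::] by elim: n => //= n ->.
case: n => // n ln; rewrite iterSr look_step_pair; case: eqVneq => [->|qq]; last exact: IH.
have -> : iter n (look_step q) (pair2 q (pair2 [:: b] (enc l))) = pair2 q (pair2 [:: b] (enc l)).
  by elim: n {ln} => //= n ->; rewrite look_step_pair eqxx.
by rewrite snd_pair fst_pair.
Qed.

Lemma size_look_step q s : size (look_step q s) <= size s.
Proof.
have h p : size (snd2 p) <= size p by rewrite /snd2 !size_drop; lia.
rewrite /look_step; case: eqP => // _; case: eqP => // _.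
exact: leq_trans (h _) (h _).
Qed.

Lemma pf_lookup : exists p, forall o q l e, e 0 = q -> e 1 = enc l -> ev p o e = lookup l q.
Proof.
have [p hp] : pf (fun o e => fst2 (snd2 (iter (size (e 1)) (look_step (e 0)) (e 1)))).
  apply: pf_fst; apply: pf_snd.
  (* The encoded log serves as the clock of the recursion, being at least as long as its number of
     entries. *)
  apply: (@pf_rec (fun o e x => iter (size x) (look_step (e 0)) (e 1)) (fun o e => e 1)
    (fun o e => e 1) (fun b o e => look_step (e 2) (e 0)) (fun o e => e 1)).
  - exact: pf_var.
  - exact: pf_var.
  - move=> b; apply: (pf_ext (pf_if (pfp_eq (pf_var 0) pf_nil) pf_nil
      (pf_if (pfp_eq (pf_fst (pf_var 0)) (pf_var 2)) (pf_var 0) (pf_snd (pf_snd (pf_var 0)))))).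
    move=> o e; rewrite /look_step; case: asboolP => [->//|/eqP/negPf->].
    by case: asboolP => [->|/eqP/negPf->]; rewrite ?eqxx.
  - exact: pf_var.
  - by [].
  - by move=> o e x b; rewrite size_rcons.
  - move=> o e x _; elim: (size x) => //= n; apply: leq_trans; exact: size_look_step.
exists p => o q l e e0 e1; rewrite hp e0 e1; apply: look_iter; exact: size_enc_ge.
Qed.

Lemma pf_insert : exists p, forall o e, ev p o e = pair2 (e 0) (pair2 (e 2) (e 1)).
Proof. exact: (pf_pair (pf_var 0) (pf_pair (pf_var 2) (pf_var 1))). Qed.

Fixpoint nask (B : nat) (c : cmd) : nat :=
  match c with
  | CSeq c d => nask B c + nask B d
  | CIf _ c1 c0 cE => nask B c1 + nask B c0 + nask B cE
  | CFor _ c => B * nask B c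
  | CAsk _ _ => 1
  | _ => 0
  end.

(** Distinct queries make a log consistent. The oracle obtained turns a hypothesis on all extensions
    of a log into facts about the store. *)
Lemma ext_inh l : uniq (map fst l) -> exists o, ext l o.
Proof.
move=> u; exists (fun q => (q, true) \in l); apply/allP => -[q b] ql /=; apply/eqP.
case h: ((q, true) \in l); first exact: log_inj u h ql.
by case: b ql => //; rewrite h.
Qed.

(** * Replacing the queries of a program by flips and a log *)

Section Ask.
Variables (R : realType) (K0 : nat) (plook pins : pexp) (al ai : nat).
Hypotheses (lookP : forall o q l e, e 0 = q -> e 1 = enc l -> ev plook o e = lookup l q)
  (insP : forall o e, ev pins o e = pair2 (e 0) (pair2 (e 2) (e 1)))
  (cl : compiles plook al) (ci : compiles pins ai).

Definition push_bit (d : nat) : cmd :=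
  CIf K0.+1 (CSeq (CPush d true) (CPop K0.+1)) (CSeq (CPush d false) (CPop K0.+1)) CSkip.

(* Register K0 holds the log of the queries answered so far; the registers above it are empty
   between two queries. *)
Definition ask_code (r d : nat) : cmd :=
  CSeq (comp plook (fun i => if i is 0 then r else K0) K0.+1)
    (CIf K0.+1 (push_bit d) (push_bit d)
      (CSeq (CFlip K0.+1)
        (CSeq (comp pins (fun i => match i with 0 => r | 1 => K0 | _ => K0.+1 end) K0.+2)
          (CSeq (CClear K0) (CSeq (CApp K0.+2 K0 K0.+3) (push_bit d)))))).

Fixpoint noask (c : cmd) : cmd :=
  match c with
  | CSeq c d => CSeq (noask c) (noask d)
  | CIf r c1 c0 cE => CIf r (noask c1) (noask c0) (noask cE)
  | CFor r c => CFor r (noask c)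
  | CAsk r d => ask_code r d
  | c => c
  end.

Definition join (st : store) (l : log) : store :=
  fun r => if r < K0 then st r else if r == K0 then rev (enc l) else [::].

Lemma joinr st l r : r < K0 -> join st l r = st r.
Proof. by rewrite /join => ->. Qed.

Lemma joinK st l : join st l K0 = rev (enc l).
Proof. by rewrite /join ltnn eqxx. Qed.

Lemma join_above st l r : K0 < r -> join st l r = [::].
Proof. by move=> h; rewrite /join ifF ?ifF //; lia. Qed.

Lemma upd_join st l r v : r < K0 -> upd (join st l) r v = join (upd st r v) l.
Proof.
move=> rK; apply: funext => k; rewrite /upd /join; case: (eqVneq k r) => [->|//].
by rewrite rK.
Qed.

Lemma runs_bit o A d S b : S K0.+1 = [:: b] -> d < K0 -> size (S d) < A ->
  runs o A (push_bit d) S (upd (upd S d (b :: S d)) K0.+1 [::]).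
Proof.
move=> Sb dK sA; rewrite /runs /= Sb.
have e v : upd S d v K0.+1 = [:: b] by rewrite upd_neq //; lia.
by case: (b) e => e; rewrite /= /opush sA /= e.
Qed.

Variables (B n A Mx : nat) (phi : set oracle).
Hypotheses (mphi : measurable phi) (n2 : 2 <= n) (Bn : B <= n) (nA : n <= A)
  (alA : n ^ al <= A) (aiA : n ^ ai <= A).

Definition okl (l : log) := uniq (map fst l) && all (fun qb => size qb.1 <= B) l.
Hypothesis encn : forall l, okl l -> size l <= Mx -> size (enc l) <= n.

Let BA : B <= A := leq_trans Bn nA.

Lemma wp_seq c d Q st (v : R) : wp A (CSeq c d) Q st v = wp A c (wp A d Q) st v.
Proof. by []. Qed.

Lemma wp_if r c1 c0 cE Q st (v : R) : wp A (CIf r c1 c0 cE) Q st v =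
  match st r with
  | true :: _ => wp A c1 Q st v
  | false :: _ => wp A c0 Q st v
  | [::] => wp A cE Q st v
  end.
Proof. by []. Qed.

Lemma wp_flip r Q st (v : R) : wp A (CFlip r) Q st v = (size (st r) < A /\
  exists2 u : bool -> R, v = ((u false + u true) / 2)%R & forall b, Q (upd st r (b :: st r)) (u b)).
Proof. by []. Qed.

Lemma runs_insert r d st l b : r < K0 -> d < K0 -> size (st r) <= B -> size (st d) < B ->
  okl l -> okl ((rev (st r), b) :: l) -> size l < Mx ->
  runs (fun=> true) A
    (CSeq (comp pins (fun i => match i with 0 => r | 1 => K0 | _ => K0.+1 end) K0.+2)
          (CSeq (CClear K0) (CSeq (CApp K0.+2 K0 K0.+3) (push_bit d))))
    (upd (join st l) K0.+1 [:: b]) (join (upd st d (b :: st d)) ((rev (st r), b) :: l)).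
Proof.
move=> rK dK sr sd ol ol' lM; set S1 := upd _ _ _; set l' := _ :: l.
have en := encn ol (ltnW lM); have en' : size (enc l') <= n by apply: encn.
have S1r k : k < K0 -> S1 k = st k by move=> kK; rewrite /S1 upd_neq ?joinr //; lia.
have S1K : S1 K0 = rev (enc l) by rewrite /S1 upd_neq ?joinK //; lia.
have S1b : S1 K0.+1 = [:: b] by rewrite /S1 updE.
have S1x k : K0.+1 < k -> S1 k = [::] by move=> h; rewrite /S1 upd_neq ?join_above //; lia.
have H := @ci (fun i => match i with 0 => r | 1 => K0 | _ => K0.+1 end) K0.+2 S1 (fun=> true) n A.
rewrite insP /= (S1r r rK) S1K S1b revK -/(enc l') in H.
apply: runs_seq (H _ _ n2 _ aiA) _.
- by case=> [|[|i]] _; lia.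
- by move=> k kK; apply: S1x; lia.
- case=> [|[|i]] _; first by rewrite S1r //; apply: leq_trans sr Bn.
    by rewrite S1K size_rev.
  by rewrite S1b /=; lia.
have H2 := @runs_clear (fun=> true) A K0 (upd S1 K0.+2 (rev (enc l'))).
rewrite upd_neq ?S1K ?size_rev in H2; last by lia.
apply: runs_seq (H2 (leq_trans en nA)) _; set S3 := upd _ K0 [::].
have S30 : S3 K0 = [::] by rewrite /S3 updE.
have S32 : S3 K0.+2 = rev (enc l') by rewrite /S3 upd_neq ?updE //; lia.
have S33 : S3 K0.+3 = [::] by rewrite /S3 !upd_neq ?S1x //; lia.
have H3 := @runs_app (fun=> true) A K0.+2 K0 K0.+3 S3; rewrite S30 S32 S33 cats0 size_rev addn0 in H3.
apply: runs_seq (H3 _ _ _ erefl (leq_trans en' nA)) _; try lia.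
set S4 := upd _ K0 _; have S4b : S4 K0.+1 = [:: b] by rewrite /S4 /S3 !upd_neq ?S1b //; lia.
have S4r k : k < K0 -> S4 k = st k by move=> kK; rewrite /S4 /S3 !upd_neq ?S1r //; lia.
have H4 := @runs_bit (fun=> true) A d S4 b S4b dK; rewrite S4r // in H4.
have := H4 (leq_trans sd BA); congr runs; apply: funext => k.
rewrite {1}/upd; case: eqP => [->|k1]; first by rewrite join_above.
case: (ltngtP k K0) => kK; last first.
- by rewrite kK joinK upd_neq ?/S4 ?updE //; lia.
- rewrite join_above // upd_neq /S4; last by lia.
  rewrite upd_neq; last by lia.
  case: (eqVneq k K0.+2) => [->|k2]; first by rewrite updE.
  by rewrite /S3 !upd_neq ?S1x //; lia.
by rewrite joinr // /upd; case: eqP => // _; rewrite S4r.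
Qed.

(** A logged query leaves log and value as they are. A new one extends the log by either answer, and
    [cp_split] provides the average required by the flip. *)
Lemma ask_step r d Q l st : r < K0 -> d < K0 -> okl l -> size l < Mx ->
  size (st r) <= B -> size (st d) < B ->
  (forall l' b, okl l' -> size l' <= (size l).+1 -> (ext l' `<=` ext l)%classic ->
     (forall o, ext l' o -> o (rev (st r)) = b) ->
     Q (join (upd st d (b :: st d)) l') (cp R l' phi)) ->
  wp A (ask_code r d) Q (join st l) (cp R l phi).
Proof.
move=> rK dK ol lM sr sd hQ; set q := rev (st r).
have en := encn ol (ltnW lM).
rewrite /ask_code wp_seq.
apply: (wp_exec (st' := upd (join st l) K0.+1 (rev (lookup l q)))).
- by apply: wf_comp => -[|i] _; lia.
- have H := @cl (fun i => if i is 0 then r else K0) K0.+1 (join st l) (fun=> true) n A.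
  have evE : ev plook (fun=> true) (fun i => rev (join st l (if i is 0 then r else K0))) = lookup l q.
    by apply: lookP => /=; [rewrite joinr|rewrite joinK revK].
  rewrite -evE; apply: H => //.
  + by case=> [|i] _; lia.
  + by move=> k kK; apply: join_above.
  + case=> [|i] _; first by rewrite joinr //; apply: leq_trans sr Bn.
    by rewrite joinK size_rev.
rewrite wp_if updE; case: (lookupP l q) => [[b -> ql]|[-> ql]].
  have G : wp A (push_bit d) Q (upd (join st l) K0.+1 [:: b]) (cp R l phi).
    apply: (wp_exec (st' := join (upd st d (b :: st d)) l)) => //; last first.
      by apply: hQ => // o /allP/(_ _ ql)/eqP.
    have := @runs_bit (fun=> true) A d (upd (join st l) K0.+1 [:: b]) b.
    rewrite updE upd_neq ?joinr; try lia; move=> /(_ erefl dK (leq_trans sd BA)).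
    congr runs; rewrite -upd_join //; apply: funext => k; rewrite /upd.
    case: (k =P K0.+1) => [->|//]; rewrite ifF ?join_above //; lia.
  by rewrite (_ : rev [:: b] = [:: b]) //; case: (b) G.
rewrite (_ : rev [::] = [::]) // wp_seq wp_flip updE; split; first by apply: leq_trans nA; apply: leq_trans n2.
exists (fun b => cp R ((q, b) :: l) phi); first exact: cp_split.
move=> b; have ol' : okl ((q, b) :: l).
  move: ol => /andP[u a]; rewrite /okl /= ql u a size_rev sr //.
rewrite (_ : upd (upd (join st l) K0.+1 [::]) K0.+1 [:: b] = upd (join st l) K0.+1 [:: b]); last first.
  by apply: funext => k; rewrite /upd; case: eqP.
apply: (wp_exec (st' := join (upd st d (b :: st d)) ((q, b) :: l))).
- rewrite /= wf_comp; last by case=> [|[|i]] _; lia.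
  by rewrite /=; lia.
- exact: runs_insert.
apply: hQ => //; first by move=> o /andP[].
by move=> o /andP[/eqP].
Qed.

(** The program is followed under all oracles extending the current log at once: the log holds every
    answer that has influenced the run, so they all reach the same store. *)
Lemma ask_wp c Q l st : wf c -> regs c <= K0 -> okl l -> size l + nask B c <= Mx ->
  (forall o, ext l o -> exec o B c st <> None) ->
  (forall st' l', okl l' -> size l' <= size l + nask B c -> (ext l' `<=` ext l)%classic ->
     (forall o, ext l' o -> exec o B c st = Some st') -> Q (join st' l') (cp R l' phi)) ->
  wp A (noask c) Q (join st l) (cp R l phi).
Proof.
elim: c Q l st => [|r b|r|c IHc d IHd|r c1 IH1 c0 IH0 cE IHE|r c IH|r d|r] Q l st /= wfc rc ol lM hE hQ.
- by apply: hQ => //; rewrite addn0.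
- have [w0 eo] := ext_inh (proj1 (andP ol)); have := hE w0 eo; rewrite /opush; case: ltnP => // sB _.
  rewrite joinr // upd_join //; split; first exact: leq_trans sB BA.
  by apply: hQ => //; [rewrite addn0|move=> o _; rewrite /opush sB].
- rewrite joinr // upd_join //; apply: hQ => //; by rewrite addn0.
- move: wfc rc => /andP[wc wd]; rewrite geq_max => /andP[rc rd].
  apply: IHc => //; first by lia.
    by move=> o eo; have := hE o eo; case: (exec o B c st).
  move=> st1 l1 ol1 sl1 sub1 h1; apply: IHd => //; first by lia.
    by move=> o eo; have := hE o (sub1 o eo); rewrite (h1 o eo).
  move=> st2 l2 ol2 sl2 sub2 h2; apply: hQ => //; first by lia.
    exact: subset_trans sub2 sub1.
  by move=> o eo; rewrite (h1 o (sub2 o eo)) /=; apply: h2.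
- move: wfc rc => /and3P[w1 w0 wE]; rewrite !geq_max => /and4P[rr r1 r0 rE].
  rewrite joinr //; case e: (st r) hE hQ => [|[] w] hE hQ.
  + by apply: IHE => //; [lia|move=> st' l' o1 o2 o3 o4; apply: hQ => //; lia].
  + by apply: IH1 => //; [lia|move=> st' l' o1 o2 o3 o4; apply: hQ => //; lia].
  + by apply: IH0 => //; [lia|move=> st' l' o1 o2 o3 o4; apply: hQ => //; lia].
- move: wfc rc => /andP[wr wc]; rewrite geq_max => /andP[rr rc].
  have [w0 eo0] := ext_inh (proj1 (andP ol)).
  have sr : size (st r) <= B by have := hE w0 eo0; case: ifP.
  have le_nask : size (st r) * nask B c <= B * nask B c by rewrite leq_mul2r sr orbT.
  suff H k : forall m s l0, size (s r) = k -> k <= m -> okl l0 -> size l0 + k * nask B c <= Mx ->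
      (forall o, ext l0 o -> loop (exec o B c) r k s <> None) ->
      (forall st' l', okl l' -> size l' <= size l0 + k * nask B c -> (ext l' `<=` ext l0)%classic ->
        (forall o, ext l' o -> loop (exec o B c) r k s = Some st') -> Q (join st' l') (cp R l' phi)) ->
      wl (wp A (noask c)) r Q m (join s l0) (cp R l0 phi).
    apply: (H (size (st r)) A) => //; first exact: leq_trans sr BA.
    + by apply: leq_trans lM; rewrite leq_add2l.
    + by move=> o eo; have := hE o eo; rewrite sr.
    move=> st' l' o1 o2 o3 o4; apply: hQ => //; first by apply: leq_trans o2 _; rewrite leq_add2l.
    by move=> o eo; rewrite sr; apply: o4.
  elim: k => [|k IHk] m s l0 sk km ol0 lM0 hE0 hQ0.
    by case: m {km} => [|m] /=; rewrite joinr // (size0nil sk); apply: hQ0 => //; rewrite mul0n addn0.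
  case: m km => // m km /=; rewrite joinr //; case es: (s r) sk => [|b w] // sk.
  move: lM0 hQ0; rewrite mulSn => lM0 hQ0.
  apply: IH => //; first by lia.
    by move=> o eo; have := hE0 o eo => /=; case: (exec o B c s).
  move=> s1 l1 ol1 sl1 sub1 h1; rewrite joinr // upd_join //; apply: IHk => //.
  + have [w1 eo1] := ext_inh (proj1 (andP ol1)).
    by rewrite updE size_behead (exec_writes (h1 w1 eo1) wr) es sk.
  + by lia.
  + by move=> o eo; have := hE0 o (sub1 o eo) => /=; rewrite (h1 o eo).
  move=> s2 l2 ol2 sl2 sub2 h2; apply: hQ0 => //; first by lia.
    exact: subset_trans sub2 sub1.
  by move=> o eo /=; rewrite (h1 o (sub2 o eo)) /=; apply: h2.
- move: rc; rewrite geq_max => /andP[rr rd].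
  have [w0 eo0] := ext_inh (proj1 (andP ol)).
  have h0 := hE w0 eo0; have sr : size (st r) <= B by move: h0; case: ifP.
  have sd : size (st d) < B by move: h0; rewrite sr /opush; case: ifP.
  change (wp A (ask_code r d) Q (join st l) (cp R l phi)).
  apply: ask_step => //; first by lia.
  move=> l' b ol' sl' sub hb; apply: hQ => //; first by lia.
  by move=> o eo; rewrite sr /opush sd hb.
- by have [w0 eo] := ext_inh (proj1 (andP ol)); have := hE w0 eo.
Qed.

End Ask.

(** * A probabilistic machine for a function with oracle *)

Lemma nask_poly c : exists d, forall B, 2 <= B -> nask B c <= B ^ d.
Proof.
elim: c => [|r b|r|c [d IHc] c2 [d2 IHd]|r c1 [d1 IH1] c0 [d0 IH0] cE [dE IHE]|r c [d IH]|r s|r] /=;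
  try by exists 0.
- exists (d + d2).+1 => B B2; apply: (pw_add B2 (IHc B B2) (IHd B B2)); lia.
- exists (d1 + d0 + dE).+2 => B B2; apply: (pw_add (a := (d1 + d0).+1) B2 _ (IHE B B2)); try lia.
  by apply: (pw_add (c := (d1 + d0).+1) B2 (IH1 B B2) (IH0 B B2)); lia.
- by exists d.+1 => B B2; rewrite expnS leq_mul2l IH ?orbT.
Qed.

Lemma cost_poly c : exists d, forall A, 2 <= A -> cost A c <= A ^ d.
Proof.
elim: c => [|r b|r|c [d IHc] c2 [d2 IHd]|r c1 [d1 IH1] c0 [d0 IH0] cE [dE IHE]|r c [d IH]|r s|r] /=;
  try by exists 0.
- exists (d + d2).+1 => B B2; apply: (pw_add B2 (IHc B B2) (IHd B B2)); lia.
- exists (d1 + d0 + dE).+3 => B B2.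
  have h2 : 2 <= B ^ 1 by rewrite expn1.
  apply: (pw_add B2 _ h2); [|exact: (ltnSn (d1 + d0 + dE).+2)|by []].
  apply: (pw_add B2 _ (IHE B B2)); [|exact: (ltnSn (d1 + d0 + dE).+1)|by lia].
  by apply: (pw_add B2 (IH1 B B2) (IH0 B B2)); lia.
- exists d.+4 => B B2; have h2 : 2 <= B ^ 1 by rewrite expn1.
  have h : cost B c + 2 <= B ^ d.+2 by apply: (pw_add B2 (IH B B2) h2).
  apply: (pw_add (a := d.+3) (b := 0) B2) => //.
  by rewrite expnS leq_mul2l h orbT.
Qed.

Lemma ptm_of_pexp (R : realType) f : exists (M : PTM) (a : nat), forall x : word,
  (forall s : seq bool, size s = (size x + 2) ^ a -> ptm_halted (ptm_run M x s)) /\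
  bits_prob R ((size x + 2) ^ a) (fun s => ptm_accepting (ptm_run M x s)) =
  fine (coin_measure R [set o : oracle | ev f o (dcons x (fun=> [::])) = [::]]%classic).
Proof.
have [plook lookP] := pf_lookup; have [pins insP] := pf_insert.
have [al cl] := compP plook; have [ai ci] := compP pins; have [af cf] := compP f.
(* Register 1 receives the input; register 2 stays empty and stands for all other variables. *)
pose rho i := if i is 0 then 1 else 2.
have rho3 i : rho i < 3 by case: i.
(* The tape presents the first letter of the input on top of stack 0, whereas a stack represents its
   reversal; the move turns it round. *)
pose c := CSeq (CMove 0 1) (comp f rho 3).
have wfc : wf c by rewrite /= wf_comp.
pose K0 := regs c + 4; have K04 : 3 < K0 by rewrite /K0; lia.
have rcK : regs c <= K0 by rewrite leq_addr.
pose c' := noask K0 plook pins c.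
pose e := clen c'.
(* An empty register 3, which means the value [::], leads to the accepting halt. *)
pose code := flat c' 0 ++ [:: IBr 3 e.+1 e.+1 e.+2; IHalt false; IHalt true].
pose K1 := maxn (regs c') 4.
have [d hd] := nask_poly c; have [d' hd'] := cost_poly c'.
(* [B] = N^b1 bounds the stacks of [c]. [n] = B^d B^3 bounds the encoded log, which has at most B^d
   entries of at most 2 B + 4 letters each. [A] = N^g gives room to look up and insert in a log of
   size [n]. *)
pose b1 := af.+1; pose k := b1 * d + 3 * b1; pose g := k * (al + ai).+1.
exists (stack_ptm K1 code), (g * (d' + 6)) => x.
set N := size x + 2; have N2 : 2 <= N by rewrite /N addn2.
pose B := N ^ b1; pose n := N ^ k; pose A := N ^ g.
have NB : N <= B by rewrite -{1}(expn1 N); apply: pw_le.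
have xN : size x <= N by rewrite leq_addr.
have B2 : 2 <= B by apply: leq_trans NB.
have b1k : b1 <= k by apply: leq_trans (leq_addl _ _); rewrite -{1}[b1]mul1n leq_mul2r orbT.
have Bn : B <= n by apply: pw_le.
have n2 : 2 <= n by apply: leq_trans Bn.
have AE : A = n ^ (al + ai).+1 by rewrite /A /g expnM.
have nA : n <= A by rewrite AE -{1}(expn1 n); apply: pw_le.
have alA : n ^ al <= A by rewrite AE; apply: pw_le => //; lia.
have aiA : n ^ ai <= A by rewrite AE; apply: pw_le => //; lia.
have A2 : 2 <= A by apply: leq_trans nA.
have nE : n = B ^ d * B ^ 3 by rewrite /n /k expnD expnM [3 * b1]mulnC expnM.
have encn l : okl B l -> size l <= nask B c -> size (enc l) <= n.
  move=> /andP[_ hl] sl; apply: leq_trans (size_enc_le hl) _; rewrite nE.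
  apply: leq_mul; first exact: leq_trans sl (hd B B2).
  apply: (@leq_trans (2 * 2 * B)); first by lia.
  by rewrite !expnS expn0 muln1 mulnA; apply: leq_mul => //; apply: leq_mul.
pose ex := dcons x (fun=> [::]) : nat -> word.
pose phi : set oracle := [set o : oracle | ev f o ex = [::]]%classic.
have mphi : measurable phi.
  apply: measurable_continuous => o ho; have [S hS] := ev_continuous f o ex.
  by exists S => o' h; rewrite /phi /= (hS o' h).
pose st0 : store := fun k => if k == 0 then x else [::].
pose S1 := upd (upd st0 0 [::]) 1 (rev x).
pose S3 o := upd S1 3 (rev (ev f o ex)).
have run o : exec o B c st0 = Some (S3 o).
  apply: (runs_seq (s1 := S1)).
    have := @runs_move o B 0 1 st0; rewrite /= cats0; apply=> //.
    by rewrite addn0; apply: leq_trans xN NB.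
  have H := @cf rho 3 S1 o N B.
  rewrite (_ : (fun i => rev (S1 (rho i))) = ex) in H; last first.
    by apply: funext => -[|i] /=; rewrite /S1 /upd /= ?revK.
  apply: H => //; last by apply: pw_le.
    by case=> [|[|r]].
  by case=> [|i] _; rewrite /S1 /upd //= size_rev.
pose Q (st : store) (v : R) := v = ((st 3 == [::])%:R)%R.
have W : wp A c' Q (join K0 st0 [::]) (cp R [::] phi).
  apply: (@ask_wp R K0 plook pins al ai lookP insP cl ci B n A (nask B c) phi mphi n2 Bn nA alA aiA encn) => //.
    by move=> o _; rewrite run.
  move=> st' l' ol' _ _ h; rewrite /Q joinr //.
  have E o : ext l' o -> st' 3 = rev (ev f o ex).
    by move=> eo; have := h o eo; rewrite run => -[<-]; rewrite /S3 updE.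
  case: eqP => z.
    rewrite cp_sure //; first by case/andP: ol'.
    by move=> o eo; rewrite /phi /= -(revK (ev f o ex)) -(E o eo) z.
  by rewrite cp_null // => o eo; rewrite /phi /= => h0; apply: z; rewrite (E o eo) h0.
have F : fv K1 code A 0 (join K0 st0 [::]) (cp R [::] phi) (2 * stepcost A + cost A c' * stepcost A).
  apply: (flat_ok (c := c') (Q := Q)) => //.
  - by exists [::], [:: IBr 3 e.+1 e.+1 e.+2; IHalt false; IHalt true].
  - by apply: leq_trans (leq_maxl _ _) (leqnSn _).
  move=> st v ->; rewrite add0n.
  have at2 : occurs_at code e [:: IBr 3 e.+1 e.+1 e.+2; IHalt false; IHalt true].
    by exists (flat c' 0), [::]; rewrite cats0 size_flat.
  have [c0 N0 a1] := at_cons at2; have [c1 N1 a2] := at_cons a1; have [c2 Nc2 _] := at_cons a2.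
  rewrite mul2n -addnn; apply: (fv_br N0 c0); first by rewrite ltnS leq_max orbT.
  have hT : fv K1 code A e.+2 st (true%:R : R)%R (stepcost A) by apply: fv_halt.
  have hF : fv K1 code A e.+1 st (false%:R : R)%R (stepcost A) by apply: fv_halt.
  by case: (st 3) => [|[] w].
have jE r : join K0 st0 [::] r = st0 r.
  rewrite /join /st0; case: ltnP => // h.
  have -> : (r == 0) = false by lia.
  by case: eqP.
have En : encodes A 0 (join K0 st0 [::]) (@ptm_init (stack_ptm K1 code) x).
  exists [::], [seq Some (inl b) | b <- x], [::]; split=> //.
  - by rewrite cats0.
  - by elim: (x).
  - by rewrite size_map (leq_trans xN) // (leq_trans NB) // (leq_trans Bn).
  move=> r j; rewrite jE /st0; have [jx|jx] := ltnP j (size x); last first.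
    rewrite !nth_default ?size_map //; by case: ifP.
  rewrite (nth_map false) //= -(inj_eq val_inj) /=.
  case: ifP => _; first by rewrite (nth_map false).
  by rewrite /= nth_nil.
(* The cost of a step is at most 8 A, hence at most A^4, and the number of steps at most A^(d' +
   2). *)
have bound : 2 * stepcost A + cost A c' * stepcost A <= N ^ (g * (d' + 6)).
  rewrite expnM -/A -mulnDl (_ : d' + 6 = d'.+2 + 4); last by lia.
  rewrite expnD; apply: leq_mul.
    rewrite addnC; apply: (pw_add (b := 1) A2 (hd' A A2)) => //.
  rewrite /stepcost; apply: (@leq_trans (2 * (2 * (2 * A)))); first by lia.
  by rewrite !expnS expn0 muln1; do 3 apply: leq_mul => //.
have [h1 h2] := F _ En _ bound; split; first exact: h1.
by rewrite -cp_nil -h2.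
Qed.

(** * The equivalence *)

Lemma teval_numeral r w : teval r (numeral w) = w.
Proof.
elim/last_ind: w => // w b IH; rewrite -cats1 /numeral foldl_cat /= -/(numeral w) IH.
by case: b.
Qed.

Lemma interp_fapp2 G s t o : interp (fapp2 G s t) o = sat o (scons t (scons s (fun=> [::]))) G.
Proof.
have -> : interp (fapp2 G s t) o = sat o (fun=> [::]) (fapp2 G s t) by [].
rewrite !sat_std /fapp2 ssat_subst; congr ssat; apply: funext => -[|[|n]] //=;
  by rewrite dval_std teval_numeral.
Qed.

Lemma sat_flip_free o o' F : Flip_free F -> forall r, sat o r F = sat o' r F.
Proof.
elim: F => //= [A IH|A IHA B IHB|A IHA B IHB|A IH|A IH].
- by move=> h r; rewrite (IH h).
- by move=> /andP[a b] r; rewrite (IHA a) (IHB b).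
- by move=> /andP[a b] r; rewrite (IHA a) (IHB b).
- by move=> h r; apply/propext; split=> -[w H]; exists w; [rewrite -(IH h)|rewrite (IH h)].
- by move=> h r; apply/propext; split=> H w; [rewrite -(IH h)|rewrite (IH h)].
Qed.

Lemma unique_std G o r x y y' : RSigma1bNIA_proves (fAllExUnique G) ->
  sat o (scons y (scons x r)) G -> sat o (scons y' (scons x r)) G -> y = y'.
Proof.
move=> pG; have : ssat (r : nat -> Std o) (fAllExUnique G).
  by apply: (soundness (std_congruent o) (@std_model o) pG) => H [].
rewrite -sat_std => /(_ x) [y0 [_ u0]].
have key w : sat o (scons w (scons x r)) G -> w = y0.
  have E : sat o (scons w (scons y0 (scons x r)))
      (fsubst (fun n => if n is m.+1 then tVar m.+2 else tVar 0) G) = sat o (scons w (scons x r)) G.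
    by rewrite !sat_std ssat_subst; congr ssat; apply: funext => -[|n].
  move=> hw; have : ~ sat o (scons w (scons y0 (scons x r)))
      (fsubst (fun n => if n is m.+1 then tVar m.+2 else tVar 0) G) \/ w = y0 := u0 w.
  by rewrite E => -[/(_ hw)|].
by move=> /key -> /key ->.
Qed.

Lemma sat_le1 o r w : sat o (scons w r) (fLe (tVar 0) (tshift tZero)) <-> size w <= 1.
Proof.
have -> : sat o (scons w r) (fLe (tVar 0) (tshift tZero)) =
  prefix (wtimes [:: true] w) (wtimes [:: true] [:: false]) by [].
rewrite !wtimes1; split=> [h|]; first by have := size_prefix h; rewrite !size_nseq.
by case: w => [|b [|]].
Qed.

Section Probability.
Variable R : realType.
Local Notation mu := (coin_measure R).
Local Open Scope ring_scope.

Lemma NotErraticP TwoThirds G : is_TwoThirds R G (TwoThirds G) ->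
  models (NotErratic TwoThirds G) <->
  forall s, exists2 t : word, (size t <= 1)%N & ((2 / 3 : R)%:E <= prob_of R G s t)%E.
Proof.
move=> [ff _ fv2 hT]; split=> h.
  move=> s; have [t [st ht]] := h (fun=> true) s.
  exists t; first exact: (proj1 (sat_le1 (fun=> true) (scons s (fun=> [::])) t) st).
  apply/hT => o; rewrite interp_fapp2 -(sat_flip_free (fun=> true) o ff); exact: ht.
move=> o s; have [t st ht] := h s; exists t; split.
  exact: (proj2 (sat_le1 o (scons s (fun=> [::])) t) st).
by move/hT: ht => /(_ o); rewrite interp_fapp2.
Qed.

Lemma bits_prob_neg n (phi : seq bool -> bool) :
  bits_prob R n (fun s => ~~ phi s) = 1 - bits_prob R n phi.
Proof.
elim: n phi => [|n IH] phi /=; first by case: (phi _); rewrite ?subrr ?subr0.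
by rewrite !IH; field.
Qed.

Lemma bits_prob_pad T k (phi : seq bool -> bool) :
  (forall u v, size u = T -> phi (u ++ v) = phi u) ->
  bits_prob R (T + k) phi = bits_prob R T phi.
Proof.
elim: T phi => [|T IH] phi h.
  rewrite add0n /= -(bits_prob_const R k); congr bits_prob.
  by apply: funext => v; rewrite -(h [::] v).
by rewrite addSn /= !IH // => u v uT; apply: (h (_ :: u) v); rewrite /= uT.
Qed.

(** One side is rational and the other real; both amount to the same inequality between natural
    numbers. *)
Lemma error_prob_le M x T ans : (ptm_error_prob M x T ans <= 1 / 3) =
  (bits_prob R T (fun s => ptm_accepting (ptm_run M x s) != ans) <= 1 / 3).
Proof.
have := bits_prob_count R T (fun s => ptm_accepting (ptm_run M x s) != ans).
rewrite /ptm_error_prob; set cnt := #|_|; set bp := bits_prob _ _ _ => e.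
have key (F : realFieldType) : (cnt%:R <= 1 / 3 * 2 ^+ T :> F) = (3 * cnt <= 2 ^ T)%N.
  by rewrite mul1r mulrC ler_pdivlMr // -natrX -natrM ler_nat mulnC.
rewrite ler_pdivrMr ?exprn_gt0 // key -(key R) e ler_pM2r // exprn_gt0 //.
Qed.

Lemma mu_disjoint A B : measurable A -> measurable B -> (A `&` B)%classic = set0%classic ->
  fine (mu A) + fine (mu B) <= 1.
Proof.
move=> mA mB dAB; rewrite -lee_fin EFinD !fineK ?fin_num_measure //.
by rewrite -measureU //; apply: probability_le1; apply: measurableU.
Qed.

Lemma measurable_bits (S : seq word) (phi : seq bool -> bool) :
  measurable [set o : oracle | phi (map o S)]%classic.
Proof.
apply: measurable_continuous => o ho; exists S => o' h; rewrite /=.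
have -> : map o' S = map o S by apply/eq_in_map.
exact: ho.
Qed.

Lemma measurable_ev f e t : measurable [set o : oracle | ev f o e = t]%classic.
Proof.
apply: measurable_continuous => o ho; have [S hS] := ev_continuous f o e.
by exists S => o' h; rewrite /= (hS o' h).
Qed.

Lemma exp_poly a : exists p : {poly nat}, forall n : nat, p.[n] = ((n + 2) ^ a)%N.
Proof.
elim: a => [|a [p hp]]; first by exists 1%:P => n; rewrite hornerC.
exists (p * 'X + p + p) => n; rewrite !hornerD hornerMX hp expnS.
by rewrite mulnDl mul2n -addnn addnA [(n * _)%N]mulnC.
Qed.

Lemma poly_le_exp (p : {poly nat}) : exists a, forall n : nat, (p.[n] <= (n + 2) ^ a)%N.
Proof.
elim/poly_ind: p => [|p c [a IH]]; first by exists 0%N => n; rewrite horner0.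
exists (a.+1 + c).+1 => n; rewrite hornerD hornerMX hornerC.
have n2 : (2 <= n + 2)%N by rewrite addn2.
apply: (pw_add (a := a.+1) (b := c) n2); try lia.
  by rewrite expnSr; apply: leq_mul (IH n) _; rewrite leq_addr.
(* The constant c is at most 2^c, hence at most (n + 2)^c. *)
apply: leq_trans (ltnW (ltn_expl c (isT : 1 < 2)%N)) _.
by case: c => // c; rewrite leq_exp2r.
Qed.

Lemma BPP_of_formula TwoThirds (L : set word) G : is_TwoThirds R G (TwoThirds G) -> Sigma1b G ->
  RSigma1bNIA_proves (fAllExUnique G) -> models (NotErratic TwoThirds G) ->
  L = lang_of (prob_of R G) -> BPP L.
Proof.
move=> h23 sG pG /(NotErraticP h23) ne ->; have [f hf] := witnessing sG pG.
have [M [a hM]] := ptm_of_pexp R f; have [p hp] := exp_poly a.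
exists M, p => x; rewrite /= hp; have [h1 h2] := hM x; split.
  by move=> coins; apply: h1; rewrite size_tuple.
set E := fun t => [set o : oracle | ev f o (dcons x (fun=> [::])) = t]%classic.
(* As [G] is single-valued in every standard structure, it holds at t exactly when [f] returns t. *)
have pE t : prob_of R G x t = mu (E t).
  congr (mu _); apply/seteqP; split=> o; rewrite interp_fapp2 /E /=.
    have := hf o x; rewrite -!scons_dcons => h h'; exact: unique_std pG h h'.
  by move=> <-; rewrite !scons_dcons.
have mE t : measurable (E t) by apply: measurable_ev.
have fE t : mu (E t) \is a fin_num by apply: fin_num_measure.
have [t st ht] := ne x; rewrite pE -(fineK (fE t)) lee_fin in ht.
have dis : t <> [::] -> fine (mu (E t)) + fine (mu (E [::])) <= 1.
  move=> tn; apply: mu_disjoint => //; apply/seteqP; split=> o //.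
  by rewrite /E /= => -[-> /tn].
rewrite error_prob_le.
have LE : lang_of (prob_of R G) x = (2^-1 < fine (mu (E [::]))).
  by rewrite /lang_of /= pE -{1}(fineK (fE [::])) lte_fin.
have third : 1 - 2 / 3 = 1 / 3 :> R by field.
have [hL|hL] := pselect (lang_of (prob_of R G) x).
  rewrite asboolT //; move: hL; rewrite LE => hL.
  rewrite (_ : (fun s => _) = (fun s => ~~ ptm_accepting (ptm_run M x s))); last first.
    by apply: funext => s; case: ptm_accepting.
  rewrite bits_prob_neg h2 -/(E [::]) -third lerB //.
  case: (pselect (t = [::])) => [<-//|/dis]; lra.
rewrite asboolF //; move: hL; rewrite LE => /negP hL.
rewrite (_ : (fun s => _) = (fun s => ptm_accepting (ptm_run M x s))); last first.
  by apply: funext => s; case: ptm_accepting.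
rewrite h2 -/(E [::]); case: (pselect (t = [::])) => [et|/dis]; last by lra.
by move: hL ht; rewrite -leNgt et; lra.
Qed.

Lemma formula_of_BPP TwoThirds (L : set word) :
  (forall G, Sigma1b G -> ffv 2 G -> is_TwoThirds R G (TwoThirds G)) -> BPP L ->
  exists G : formula, [/\ Sigma1b G /\ ffv 2 G, RSigma1bNIA_proves (fAllExUnique G),
    models (NotErratic TwoThirds G) & L = lang_of (prob_of R G)].
Proof.
move=> h23 [M [p hM]]; have [a ha] := poly_le_exp p.
pose G := histG (nextF M a) (accF M) (tLen M a (tVar 0)).
have sG : Sigma1b G by apply: Sigma1b_histG; [exact: subword_next|exact: subword_acc].
have fG : ffv 2 G by apply: ffv_histG.
pose m (x : word) := sz a (size x).
pose P x := bits_prob R (m x) (fun s => ptm_accepting (ptm_run M x s)).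
have runE x (o : oracle) : mkseq (fun j => o (nseq j.+1 true)) (m x) =
    map o [seq nseq j.+1 true | j <- iota 0 (m x)] by rewrite -map_comp.
have uS x : uniq [seq nseq j.+1 true | j <- iota 0 (m x)].
  rewrite map_inj_uniq ?iota_uniq // => i j /(congr1 size).
  by rewrite !size_nseq => -[].
have szS x : size [seq nseq j.+1 true | j <- iota 0 (m x)] = m x by rewrite size_map size_iota.
have prob x t (phi : seq bool -> bool) :
    (forall s, (t = if ptm_accepting (ptm_run M x s) then [::] else [:: false]) <-> phi s) ->
    prob_of R G x t = (bits_prob R (m x) phi)%:E.
  move=> h; rewrite -[in RHS](szS x) -(mu_bits R phi (uS x)) /prob_of.
  have -> : interp (fapp2 G x t) =
      [set o : oracle | phi (map o [seq nseq j.+1 true | j <- iota 0 (m x)])]%classic.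
    apply/seteqP; split=> o; rewrite interp_fapp2 /=.
      by move=> /histG_std; rewrite -/(m x) runE => /h.
    by move=> /h e; apply/histG_std; rewrite -/(m x) runE.
  by rewrite fineK // fin_num_measure //; apply: measurable_bits.
have pT x : prob_of R G x [::] = (P x)%:E.
  by apply: prob => s; case: ptm_accepting.
have pF x : prob_of R G x [:: false] = (1 - P x)%:E.
  by rewrite -bits_prob_neg; apply: prob => s; case: ptm_accepting.
(* The machine has halted after p steps, so that the further coins, up to (n + 2)^a, change
   nothing. *)
have PT x : P x = bits_prob R p.[size x] (fun s => ptm_accepting (ptm_run M x s)).
  rewrite /P /m /sz -(subnKC (ha (size x))); apply: bits_prob_pad => u v su.
  have [hh _] := hM x; have hu := hh (@Tuple _ _ u (introT eqP su)).
  rewrite /ptm_run foldl_cat -/(ptm_run M x u); congr ptm_accepting.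
  elim: v => //= b v IH; rewrite -[RHS]IH; congr foldl.
  by rewrite /ptm_step hu.
have LT x : L x -> 2 / 3 <= P x.
  move=> Lx; have [_] := hM x; rewrite error_prob_le asboolT //.
  rewrite (_ : (fun s => _) = (fun s => ~~ ptm_accepting (ptm_run M x s))); last first.
    by apply: funext => s; case: ptm_accepting.
  by rewrite bits_prob_neg -PT; lra.
have LF x : ~ L x -> P x <= 1 / 3.
  move=> Lx; have [_] := hM x; rewrite error_prob_le asboolF //.
  rewrite (_ : (fun s => _) = (fun s => ptm_accepting (ptm_run M x s))) ?PT //.
  by apply: funext => s; case: ptm_accepting.
exists G; split=> //.
- by apply: histG_provable; exact: subword_next.
- apply/(NotErraticP (h23 G sG fG)) => x; case: (pselect (L x)) => Lx.
    by exists [::] => //; rewrite pT lee_fin LT.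
  by exists [:: false] => //; rewrite pF lee_fin; have := LF x Lx; lra.
apply/seteqP; split=> x; rewrite /lang_of /= pT lte_fin.
  by move=> /LT; lra.
by move=> h; case: (pselect (L x)) => // /LF; lra.
Qed.

End Probability.

Theorem theorem4p10 (R : realType) (TwoThirds : formula -> formula)
  (TwoThirdsP : forall G : formula,
     Sigma1b G -> ffv 2 G -> is_TwoThirds R G (TwoThirds G))
  (L : set word) :
  BPP L <->
  exists G : formula,
    [/\ Sigma1b G /\ ffv 2 G,
        RSigma1bNIA_proves (fAllExUnique G),
        models (NotErratic TwoThirds G) &
        L = lang_of (prob_of R G)].
Proof.
split; first exact: formula_of_BPP.
move=> [G [[sG fG] pG ne LG]].
exact: BPP_of_formula (TwoThirdsP G sG fG) sG pG ne LG.
Qed.
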